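(* Fix a phase $\theta\in\mathbb R/2\pi\mathbb Z$. The local bundles $P_{V,\theta}\to V$ constructed on semistable charts adapted to $Y_1$ glue canonically to a global principal $S^1$-bundle over $Q$. This global bundle, denoted $Q^{\log}|_\theta\to Q$, is canonically isomorphic, up to isotopy, to the unit circle bundle $$S(\mathcal N_{Q/Y_1})\longrightarrow Q.$$ In particular, $$c_1\bigl(Q^{\log}|_\theta\bigr)=c_1(\mathcal N_{Q/Y_1})\in H^2(Q;\mathbb Z).$$
   Context: Let $Z_1,Z_2$ be twistor spaces of compact anti-self-dual $4$-manifolds, $\ell_i\subset Z_i$ twistor lines, $\widetilde Z_i=\mathrm{Bl}_{\ell_i}(Z_i)$ with exceptional divisor $Q_i\simeq\mathbb P^1\times\mathbb P^1$, and $Z_0=\widetilde Z_1\cup_Q\widetilde Z_2$ the normal crossings pushout obtained by gluing $Q_1\simeq Q_2=:Q$ via an isomorphism exchanging the two rulings. $Z_0$ is the central fibre of a semistable family $\mathcal Z\to\Delta$ with local model $t=uv$ along $Q$. Write $Y_1:=\widetilde Z_1$. A semistable chart adapted to $Y_1$ along $Q$ is a neighbourhood $V\subset Q$, an analytic space $\mathcal V$ and a flat map $\pi_V:\mathcal V\to\Delta$ such that, analytically near $V$, $\mathcal V$ has coordinates $(u,v,z_3,\dots,z_n,t)$ with equation $t=uv$, $\mathcal V_0=\{uv=0\}$, $V=\{u=v=0\}$, and the branch $\{u=0\}\subset\mathcal V_0$ is identified with a neighbourhood of $V$ in $Y_1$ (so $Q$ is locally cut out in $Y_1$ by $v$). Kato--Nakayama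 space: for a log analytic space $(X,M_X)$ with the divisorial log structure of a normal crossings divisor, $X^{\log}$ is the set of pairs $(x,h)$ with $x\in X$ and $h:M_{X,x}^{\mathrm{gp}}\to S^1$ a homomorphism with $h(f)=f(x)/|f(x)|$ for units $f$. $P_{V,\theta}$ is the restriction over $V$ of the fibre $(\pi_V^{\log})^{-1}(0,\theta)$; with $\rho_1=h(u)$, $\rho_2=h(v)$ its fibre over a point of $V$ is $\{(\rho_1,\rho_2)\in S^1\times S^1\mid\rho_1\rho_2=e^{i\theta}\}\cong S^1$, and it is a principal $S^1$-bundle whose circle coordinate is the phase $\eta=\rho_2=h(v)$ of $v$. For a Hermitian line bundle $L$, $S(L)$ is its unit circle bundle. *)

(* Defs.v *)
From HB Require Import structures.
From mathcomp Require Import all_boot all_order all_algebra.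
From mathcomp Require Import all_classical all_reals all_analysis.
From mathcomp.real_closed Require Import complex.
Set Implicit Arguments.
Unset Strict Implicit.
Unset Printing Implicit Defensive.
Import Order.TTheory GRing.Theory Num.Theory.
Import numFieldNormedType.Exports.
Local Open Scope classical_set_scope.
Local Open Scope ring_scope.

(* Typing R[i] as a numClosedFieldType gives it the topology and the normed
   module structure of a numFieldType. *)
Definition Cx (R : realType) : numClosedFieldType := R[i].

Definition toC (R : realType) (r : R) : Cx R := (r%:C)%C.

Definition phase (R : realType) (z : Cx R) : Cx R := z / `|z|.

(* exp(i theta) *)
Definition expi (R : realType) (theta : R) : Cx R := (cos theta +i* sin theta)%C.

(* exp(2 i pi z) *)
Definition exp2ipi (R : realType) (z : Cx R) : Cx R :=
  toC (expR (- (2 * pi * complex.Im z))) * expi (2 * pi * complex.Re z).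

Fixpoint diff_times (K : numFieldType) (V W : normedModType K) (k : nat)
    (A : set V) (f : V -> W) : Prop :=
  (forall x, A x -> differentiable f x) /\
  (if k is k'.+1 then forall v, diff_times k' A (fun x => 'D_v f x) else True).

(* K-differentiability of all orders near x: this is C^oo for K = R, and
   holomorphy for K = C, the differentials being C-linear. *)
Definition smooth_near (K : numFieldType) (V W : normedModType K)
    (x : V) (f : V -> W) : Prop :=
  exists2 A : set V, open_nbhs x A & forall k, diff_times k A f.

Record coord_system (K : numFieldType) (X : Type) (n : nat) := CoordSystem {
  dom : set X;
  coo : X -> 'rV[K]_n;
  inv : 'rV[K]_n -> X }.

(* k-th coordinate, counted from 0 *)
Definition crd (K : numFieldType) (X : Type) (n : nat)
    (c : coord_system K X n.+1) (k : nat) (x : X) : K := coo c x 0 (inord k).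

(* "reg x f" reads "f is a regular function near x", and c identifies the open
   set dom c, with its regular functions, with an open subset of K^n. *)
Definition is_coord (K : numFieldType) (X : topologicalType)
    (reg : X -> (X -> K) -> Prop) (n : nat) (c : coord_system K X n) : Prop :=
  [/\ open (dom c), open (coo c @` dom c),
      forall x, dom c x -> inv c (coo c x) = x,
      forall x, dom c x ->
        {for x, continuous (coo c)} /\ {for coo c x, continuous (inv c)} &
      forall x f, dom c x -> (reg x f <-> smooth_near (coo c x) (f \o inv c))].

(* A manifold is given by its sheaf of regular K-valued functions; it is a
   C^oo manifold for K = R and a complex manifold for K = C. *)
Record manifold (K : numFieldType) (n : nat) := Manifold {
  mspace :> topologicalType;
  reg : mspace -> (mspace -> K) -> Prop;
  m_hausdorff : hausdorff_space mspace;
  m_second_countable : @second_countable mspace;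
  m_locally : forall x, exists2 c : coord_system K mspace n,
    is_coord reg c & dom c x }.

Definition coords (K : numFieldType) (n : nat) (X : manifold K n)
  (c : coord_system K X n) : Prop := is_coord (@reg K n X) c.

Definition regmap (K : numFieldType) (n m : nat) (X : manifold K n)
    (Y : manifold K m) (A : set X) (F : X -> Y) : Prop :=
  forall x, A x -> {for x, continuous F} /\
    (forall g, reg (F x) g -> reg x (g \o F)).

(* Regular functions near q on the reduced closed subspace Q of X. *)
Definition reg_on (K : numFieldType) (n : nat) (X : manifold K n) (Q : set X)
    (q : X) (f : X -> K) : Prop :=
  exists2 g, reg q g & \forall y \near q, Q y -> f y = g y.

Definition partial (R : realType) (i : 'I_4) (F : 'rV[R]_4 -> R)
  (y : 'rV[R]_4) : R := 'D_(delta_mx 0 i) F y.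

Section Curvature.
Variables (R : realType) (G : 'rV[R]_4 -> 'M[R]_4).
Implicit Types (y : 'rV[R]_4) (i j k l : 'I_4).

(* Gamma^k_{ij} *)
Definition christoffel k i j y : R :=
  2^-1 * \sum_l invmx (G y) k l *
    (partial i (fun x => G x j l) y + partial j (fun x => G x i l) y
     - partial l (fun x => G x i j) y).

(* R^l_{kij}, where R(d_i, d_j) d_k = R^l_{kij} d_l *)
Definition riem_up l k i j y : R :=
  partial i (christoffel l j k) y - partial j (christoffel l i k) y
  + \sum_m (christoffel l i m y * christoffel m j k y
            - christoffel l j m y * christoffel m i k y).

Definition riem l k i j y : R := \sum_m G y l m * riem_up m k i j y.

Definition ricci k j y : R := \sum_i riem_up i k i j y.

Definition scal y : R := \sum_k \sum_j invmx (G y) k j * ricci k j y.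

Definition weyl l k i j y : R :=
  riem l k i j y
  - 2^-1 * (G y l i * ricci k j y - G y l j * ricci k i y
            - G y k i * ricci l j y + G y k j * ricci l i y)
  + scal y / 6 * (G y l i * G y k j - G y l j * G y k i).

Definition levi_civita (a b c d : 'I_4) : R :=
  \det (\matrix_(r < 4, s < 4) (nth 0 [:: a; b; c; d] r == s)%:R).

(* Hodge star of W acting on its first pair of indices *)
Definition star_weyl l k i j y : R :=
  2^-1 * \sum_a \sum_b \sum_p \sum_q
    Num.sqrt (\det (G y)) * levi_civita l k a b
    * invmx (G y) a p * invmx (G y) b q * weyl p q i j y.

End Curvature.

(* Tensors are given by their components in positively oriented coordinates;
   tangent vectors are row vectors and endomorphisms act on the right. *)
Record riemannian4 (R : realType) := Riemannian4 {
  rm_space :> manifold R 4;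
  rm_pos : set (coord_system R rm_space 4);
  rm_pos_coords : forall c, rm_pos c -> coords c;
  rm_pos_cover : forall x, exists2 c, rm_pos c & dom c x;
  rm_pos_det : forall c c' x, rm_pos c -> rm_pos c' -> dom c x -> dom c' x ->
    0 < \det (jacobian (coo c' \o inv c) (coo c x));
  rm_g : coord_system R rm_space 4 -> 'rV[R]_4 -> 'M[R]_4;
  rm_smooth : forall c x i j, rm_pos c -> dom c x ->
    smooth_near (coo c x) (fun y => rm_g c y i j);
  rm_sym : forall c x, rm_pos c -> dom c x ->
    (rm_g c (coo c x))^T = rm_g c (coo c x);
  rm_posdef : forall c x (v : 'rV[R]_4), rm_pos c -> dom c x -> v != 0 ->
    0 < (v *m rm_g c (coo c x) *m v^T) 0 0;
  rm_change : forall c c' x, rm_pos c -> rm_pos c' -> dom c x -> dom c' x ->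
    let J := jacobian (coo c' \o inv c) (coo c x) in
    rm_g c (coo c x) = J *m rm_g c' (coo c' x) *m J^T }.

(* W^+ = (W + *W) / 2 vanishes *)
Definition anti_self_dual (R : realType) (M : riemannian4 R) : Prop :=
  forall (c : coord_system R M 4) x, rm_pos c -> dom c x ->
    forall l k i j : 'I_4,
    weyl (rm_g c) l k i j (coo c x) + star_weyl (rm_g c) l k i j (coo c x) = 0.

Section TwistorSpace.
Variables (R : realType) (M : riemannian4 R).
Implicit Types (c : coord_system R M 4) (y xi : 'rV[R]_4) (A B : 'M[R]_4).

(* A is an orthogonal complex structure at y compatible with the orientation. *)
Definition twistor_fibre c y A : Prop :=
  [/\ A *m A = - 1%:M, A *m rm_g c y *m A^T = rm_g c y &
      forall xi zeta : 'rV[R]_4,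
        0 <= \det (\matrix_(r < 4) nth 0 [:: xi; xi *m A; zeta; zeta *m A] r)].

(* Connection matrix: nabla_xi eta = d eta(xi) + eta *m connection c y xi. *)
Definition connection c y xi : 'M[R]_4 :=
  \matrix_(j, k) \sum_i christoffel (rm_g c) k i j y * xi 0 i.

(* The linearized equations of twistor_fibre: w = (xi, B) is tangent at (y, A)
   to the total space of the twistor fibration. *)
Definition twistor_tangent c (p w : 'rV[R]_4 * 'M[R]_4) : Prop :=
  let: (y, A) := p in let: (xi, B) := w in
  let dg : 'M[R]_4 := 'D_xi (rm_g c) y in
  B *m A + A *m B = 0 /\
  B *m rm_g c y *m A^T + A *m rm_g c y *m B^T + A *m dg *m A^T = dg.

(* The almost complex structure of Atiyah, Hitchin and Singer: the tautological
   A on the horizontal space of the Levi-Civita connection, and on the vertical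
   space V |-> (V followed by A), the complex structure of the sphere. *)
Definition twistor_J c (p w : 'rV[R]_4 * 'M[R]_4) : 'rV[R]_4 * 'M[R]_4 :=
  let: (y, A) := p in let: (xi, B) := w in
  let om := connection c y in
  let V := B + A *m om xi - om xi *m A in
  (xi *m A, V *m A - A *m om (xi *m A) + om (xi *m A) *m A).

(* Fr + i Fi satisfies the Cauchy-Riemann equations for twistor_J at p. *)
Definition twistor_CR c (Fr Fi : 'rV[R]_4 * 'M[R]_4 -> R)
    (p : 'rV[R]_4 * 'M[R]_4) : Prop :=
  forall w, twistor_tangent c p w ->
    'D_(twistor_J c p w) Fr p = - 'D_w Fi p /\
    'D_(twistor_J c p w) Fi p = 'D_w Fr p.

(* The complex 3-manifold Z is the twistor space of M: z corresponds to the
   complex structure J z on the tangent space at tau z (with components J z c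
   in the coordinates c), Z has the topology of the bundle of such complex
   structures, and its holomorphic functions are the C^oo functions that
   satisfy the Cauchy-Riemann equations for twistor_J. *)
Definition is_twistor_space (Z : manifold (Cx R) 3) (tau : Z -> M)
    (J : Z -> coord_system R M 4 -> 'M[R]_4) : Prop :=
  let T c z : 'rV[R]_4 * 'M[R]_4 := (coo c (tau z), J z c) in
  [/\ continuous tau,
      forall c z, rm_pos c -> dom c (tau z) ->
        twistor_fibre c (coo c (tau z)) (J z c),
      forall c c' z, rm_pos c -> rm_pos c' -> dom c (tau z) ->
        dom c' (tau z) ->
        let Jac := jacobian (coo c' \o inv c) (coo c (tau z)) in
        J z c *m Jac = Jac *m J z c',
      forall c x A, rm_pos c -> dom c x -> twistor_fibre c (coo c x) A ->
        exists! z, tau z = x /\ J z c = A &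
      forall c z, rm_pos c -> dom c (tau z) ->
        (forall S : set Z, nbhs z S <->
          exists2 B, nbhs (T c z) B &
            forall z', dom c (tau z') -> B (T c z') -> S z') /\
        (forall f : Z -> Cx R, reg z f <->
          exists Fr Fi : 'rV[R]_4 * 'M[R]_4 -> R,
          [/\ smooth_near (T c z) Fr, smooth_near (T c z) Fi &
              \forall z' \near z,
                f z' = toC (Fr (T c z')) + 'i * toC (Fi (T c z')) /\
                twistor_CR c Fr Fi (T c z')])].

End TwistorSpace.

Definition row3 (K : numFieldType) (a b c : K) : 'rV[K]_3 :=
  \row_i nth 0 [:: a; b; c] i.

(* b is the blow-up of the smooth curve l of the complex 3-manifold Z: it is an
   isomorphism off l and, over coordinates (w0, w1, w2) in which l is
   {w0 = w1 = 0}, it is the map from {(w, [a0 : a1]) | w0 a1 = w1 a0}, which is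
   covered by the charts c0 (a0 <> 0, fibre coordinate a1/a0) and c1 (a1 <> 0,
   fibre coordinate a0/a1). *)
Definition is_blowup (R : realType) (Z Y : manifold (Cx R) 3) (l : set Z)
    (b : Y -> Z) : Prop :=
  [/\ closed l, regmap setT b,
      exists s : Z -> Y,
        [/\ regmap (~` l) s, forall z, ~ l z -> b (s z) = z &
            forall p, ~ l (b p) -> s (b p) = p] &
      forall z, l z -> exists (c : coord_system (Cx R) Z 3)
          (c0 c1 : coord_system (Cx R) Y 3),
        [/\ coords c /\ dom c z,
            coords c0 /\ coords c1,
            forall x, dom c x -> (l x <-> crd c 0 x = 0 /\ crd c 1 x = 0),
            b @^-1` dom c = dom c0 `|` dom c1 &
        [/\ coo c0 @` dom c0 = [set w | (coo c @` dom c)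
              (row3 (w 0 0) (w 0 0 * w 0 1) (w 0 (inord 2)))] /\
            coo c1 @` dom c1 = [set w | (coo c @` dom c)
              (row3 (w 0 0 * w 0 1) (w 0 0) (w 0 (inord 2)))],
            forall p, dom c0 p -> coo c (b p) =
              row3 (crd c0 0 p) (crd c0 0 p * crd c0 1 p) (crd c0 2 p),
            forall p, dom c1 p -> coo c (b p) =
              row3 (crd c1 0 p * crd c1 1 p) (crd c1 0 p) (crd c1 2 p),
            forall p, dom c0 p -> (dom c1 p <-> crd c0 1 p != 0) &
            forall p, dom c1 p -> (dom c0 p <-> crd c1 1 p != 0) /\
              (dom c0 p -> crd c0 1 p * crd c1 1 p = 1)]]].

Definition same_line (R : realType) (a a' : 'rV[Cx R]_2) : Prop :=
  exists2 k : Cx R, k != 0 & a' = k *: a.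

(* Psi(a, b), for nonzero a and b in C^2, is the point of Q with bihomogeneous
   coordinates ([a], [b]) under an isomorphism P^1 x P^1 ~ Q. *)
Definition is_quadric (R : realType) (Y : manifold (Cx R) 3) (Q : set Y)
    (Psi : 'rV[Cx R]_2 * 'rV[Cx R]_2 -> Y) : Prop :=
  [/\ forall a b, a != 0 -> b != 0 -> Q (Psi (a, b)),
      forall q, Q q -> exists a b, [/\ a != 0, b != 0 & Psi (a, b) = q],
      forall a b a' b', a != 0 -> b != 0 -> a' != 0 -> b' != 0 ->
        (Psi (a, b) = Psi (a', b') <-> same_line a a' /\ same_line b b') &
      forall a b, a != 0 -> b != 0 ->
        {for (a, b), continuous Psi} /\
        (forall f : Y -> Cx R, reg_on Q (Psi (a, b)) f <->
           smooth_near (a, b) (f \o Psi))].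

(* The blow-up of the twistor line over tb_x in the twistor space of a compact
   anti-self-dual 4-manifold; the rulings of its exceptional divisor are the
   fibres of the two projections ([a], [b]) |-> [a] and ([a], [b]) |-> [b] in
   the bihomogeneous coordinates tb_Psi, the first one being the blow-down. *)
Record twistor_blowup (R : realType) := TwistorBlowup {
  tb_M : riemannian4 R;
  tb_compact : compact [set: tb_M];
  tb_asd : anti_self_dual tb_M;
  tb_Z : manifold (Cx R) 3;
  tb_tau : tb_Z -> tb_M;
  tb_J : tb_Z -> coord_system R tb_M 4 -> 'M[R]_4;
  tb_twistor : is_twistor_space tb_tau tb_J;
  tb_x : tb_M;
  tb_Y : manifold (Cx R) 3;
  tb_b : tb_Y -> tb_Z;
  tb_blowup : is_blowup (tb_tau @^-1` [set tb_x]) tb_b;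
  tb_Psi : 'rV[Cx R]_2 * 'rV[Cx R]_2 -> tb_Y;
  tb_quadric : is_quadric (tb_b @^-1` (tb_tau @^-1` [set tb_x])) tb_Psi;
  tb_ruling : forall a b a' b', a != 0 -> b != 0 -> a' != 0 -> b' != 0 ->
    (tb_b (tb_Psi (a, b)) = tb_b (tb_Psi (a', b')) <-> same_line a a') }.

Definition tb_line (R : realType) (T : twistor_blowup R) : set (tb_Z T) :=
  @tb_tau R T @^-1` [set tb_x T].
Arguments tb_line {R} T.

Definition tb_Q (R : realType) (T : twistor_blowup R) : set (tb_Y T) :=
  @tb_b R T @^-1` tb_line T.
Arguments tb_Q {R} T.
Arguments tb_Psi {R} t.

Definition swaps_rulings (R : realType) (T1 T2 : twistor_blowup R)
    (phi : tb_Y T1 -> tb_Y T2) : Prop :=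
  forall a b a' b' c d c' d' : 'rV[Cx R]_2,
    [/\ a != 0, b != 0, a' != 0 & b' != 0] ->
    [/\ c != 0, d != 0, c' != 0 & d' != 0] ->
    phi (tb_Psi T1 (a, b)) = tb_Psi T2 (c, d) ->
    phi (tb_Psi T1 (a', b')) = tb_Psi T2 (c', d') ->
    (same_line a a' <-> same_line d d') /\ (same_line b b' <-> same_line c c').

Definition gluing_iso (R : realType) (T1 T2 : twistor_blowup R)
    (phi : tb_Y T1 -> tb_Y T2) : Prop :=
  [/\ set_bij (tb_Q T1) (tb_Q T2) phi,
      {within tb_Q T1, continuous phi},
      forall q f, tb_Q T1 q ->
        (reg_on (tb_Q T2) (phi q) f <-> reg_on (tb_Q T1) q (f \o phi)) &
      swaps_rulings phi].

(* Flatness over the disc: the local rings are torsion free. *)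
Definition flat (R : realType) (n : nat) (X : manifold (Cx R) n)
    (p : X -> Cx R) : Prop :=
  forall x f, reg x f -> (\forall y \near x, (p y - p x) * f y = 0) ->
    \forall y \near x, f y = 0.

Definition flat_to_disc (R : realType) (n : nat) (X : manifold (Cx R) n)
    (p : X -> Cx R) : Prop :=
  [/\ forall x, reg x p, forall x, `|p x| < 1 & flat p].

Definition closed_embedding (R : realType) (n m : nat)
    (Y : manifold (Cx R) n) (X : manifold (Cx R) m) (j : Y -> X) : Prop :=
  [/\ injective j, continuous j,
      forall F : set Y, closed F -> closed (j @` F) &
      forall y f, reg y f <->
        exists2 g, reg (j y) g & \forall y' \near y, f y' = g (j y')].

(* p : X -> C is a semistable family over the unit disc whose central fibre is
   the union of the closed submanifolds j1 and j2, glued along phi. *)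
Definition semistable_family (R : realType) (T1 T2 : twistor_blowup R)
    (phi : tb_Y T1 -> tb_Y T2) (X : manifold (Cx R) 4) (p : X -> Cx R)
    (j1 : tb_Y T1 -> X) (j2 : tb_Y T2 -> X) : Prop :=
  [/\ flat_to_disc p,
      closed_embedding j1 /\ closed_embedding j2,
      (forall x, p x = 0 <-> range j1 x \/ range j2 x) /\
      (forall y1 y2, j1 y1 = j2 y2 <-> tb_Q T1 y1 /\ y2 = phi y1),
      forall q, tb_Q T1 q -> exists c : coord_system (Cx R) X 4,
        [/\ coords c, dom c (j1 q) &
            forall x, dom c x -> [/\ p x = crd c 0 x * crd c 1 x,
              range j1 x <-> crd c 0 x = 0 & range j2 x <-> crd c 1 x = 0]] &
      forall x, p x = 0 -> ~ (j1 @` tb_Q T1) x ->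
        exists c : coord_system (Cx R) X 4,
          [/\ coords c, dom c x & forall x', dom c x' -> p x' = crd c 0 x']].

Section KatoNakayama.
Variables (R : realType) (n : nat) (X : manifold (Cx R) n) (D : set X).

(* Stalk at x of the divisorial log structure: germs of holomorphic functions
   that are invertible outside D. *)
Definition log_monoid (x : X) : set (X -> Cx R) :=
  [set f | reg x f /\ \forall y \near x, ~ D y -> f y != 0].

(* Its group completion, inside the functions defined outside D. *)
Definition log_group (x : X) : set (X -> Cx R) :=
  [set f | exists g h, [/\ log_monoid x g, log_monoid x h &
             \forall y \near x, ~ D y -> f y = g y / h y]].

(* h is a homomorphism from the stalk of M^gp to the unit circle, extending
   f |-> f(x)/|f(x)| on units; h is set to 0 outside of its domain. *)
Definition is_log_phase (x : X) (h : (X -> Cx R) -> Cx R) : Prop :=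
  [/\ forall f, log_group x f -> `|h f| = 1,
      forall f g, log_group x f -> log_group x g ->
        h (fun y => f y * g y) = h f * h g,
      forall f g, log_group x f ->
        (\forall y \near x, ~ D y -> f y = g y) -> h f = h g,
      forall f, reg x f -> f x != 0 -> h f = phase (f x) &
      forall f, ~ log_group x f -> h f = 0].

Record kn := KN {
  kn_pt : X;
  kn_h : (X -> Cx R) -> Cx R;
  kn_phase : is_log_phase kn_pt kn_h }.

HB.instance Definition _ := gen_eqMixin kn.
HB.instance Definition _ := gen_choiceMixin kn.

(* The coarsest topology for which the projection to X and the functions
   (x, h) |-> h(f), for sections f of M^gp over an open subset of X, are
   continuous. *)
Definition kn_index : set (set X * (X -> Cx R) * set (Cx R)) :=
  [set t | [/\ open t.1.1, forall x, t.1.1 x -> log_group x t.1.2 & open t.2]].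

Definition kn_subbase (t : set X * (X -> Cx R) * set (Cx R)) : set kn :=
  [set p | t.1.1 (kn_pt p) /\ t.2 (kn_h p t.1.2)].

HB.instance Definition _ :=
  @isSubBaseTopological.Build kn _ kn_index kn_subbase.

End KatoNakayama.

(* Data of a principal bundle over a subset of X: the structure group is a
   subgroup bgrp of C^*, the total space is the subspace bset of btot. Only the
   action of bgrp on bset is meaningful. *)
Record bundle (R : realType) (X : topologicalType) := Bundle {
  bgrp : set (Cx R);
  btot : topologicalType;
  bset : set btot;
  bproj : btot -> X;
  bact : Cx R -> btot -> btot }.
Arguments btot {R X} b.
Arguments bgrp {R X} b _.
Arguments bset {R X} b _.
Arguments bproj {R X} b _.
Arguments bact {R X} b _ _.

Definition unit_circle (R : realType) : set (Cx R) := [set z | `|z| = 1].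

Definition restrict_bundle (R : realType) (X : topologicalType)
    (P : bundle R X) (V : set X) : bundle R X :=
  Bundle (bgrp P) (bset P `&` bproj P @^-1` V) (bproj P) (bact P).

Definition principal_bundle (R : realType) (X : topologicalType) (A : set X)
    (P : bundle R X) : Prop :=
  [/\ {within bset P, continuous bproj P} /\
      (forall p, bset P p -> A (bproj P p)),
      forall k p, bgrp P k -> bset P p ->
        bset P (bact P k p) /\ bproj P (bact P k p) = bproj P p,
      forall p, bset P p -> bact P 1 p = p /\
        (forall k k', bgrp P k -> bgrp P k' ->
           bact P k (bact P k' p) = bact P (k * k') p),
      forall k p, bgrp P k -> bset P p -> bact P k p = p -> k = 1 &
      forall x, A x -> exists (U : set X) (s : X -> btot P)
          (phi : btot P -> Cx R),
        [/\ open_nbhs x U,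
            forall y, A y -> U y -> bset P (s y) /\ bproj P (s y) = y,
            forall p, bset P p -> U (bproj P p) ->
              bgrp P (phi p) /\ p = bact P (phi p) (s (bproj P p)),
            {within bset P `&` bproj P @^-1` U, continuous phi} &
            {within [set yk : X * Cx R | [/\ A yk.1, U yk.1 & bgrp P yk.2]],
               continuous (fun yk : X * Cx R => bact P yk.2 (s yk.1))}]].

Definition bundle_iso (R : realType) (X : topologicalType) (P P' : bundle R X)
    (F : btot P -> btot P') : Prop :=
  [/\ bgrp P = bgrp P', set_bij (bset P) (bset P') F,
      {within bset P, continuous F} /\
      (exists G : btot P' -> btot P, {within bset P', continuous G} /\
         forall p, bset P p -> G (F p) = p),
      forall p, bset P p -> bproj P' (F p) = bproj P p &
      forall k p, bgrp P k -> bset P p -> F (bact P k p) = bact P' k (F p)].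

(* Cech cohomology H^2(A; Z) of a subspace A of X as the direct limit over the
   open covers (U_x) indexed by the points x of A, with x in U_x; these are
   cofinal among all open covers, and refinements keep the index. *)
Section Cech.
Variables (R : realType) (X : topologicalType) (A : set X).

Definition cover_of (U : X -> set X) : Prop :=
  forall x, A x -> open_nbhs x (U x).

Definition overlap2 (U : X -> set X) (x y q : X) : Prop :=
  [/\ A x, A y & [/\ A q, U x q & U y q]].

Definition overlap3 (U : X -> set X) (x y z q : X) : Prop :=
  overlap2 U x y q /\ overlap2 U y z q.

Definition loc_const_at (f : X -> int) (q : X) : Prop :=
  \forall q' \near q, A q' -> f q' = f q.

Definition cochain2 : Type := X -> X -> X -> X -> int.

Definition cocycle2 (Uc : (X -> set X) * cochain2) : Prop :=
  let: (U, c) := Uc in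
  [/\ cover_of U,
      forall x y z q, overlap3 U x y z q -> loc_const_at (c x y z) q &
      forall x y z w q, overlap3 U x y z q -> overlap2 U z w q ->
        c y z w q - c x z w q + c x y w q - c x y z q = 0].

Definition cohomologous (Uc Uc' : (X -> set X) * cochain2) : Prop :=
  let: (U, c) := Uc in let: (U', c') := Uc' in
  exists (V : X -> set X) (b : X -> X -> X -> int),
    [/\ cover_of V, forall x, A x -> V x `<=` U x `&` U' x,
        forall x y q, overlap2 V x y q -> loc_const_at (b x y) q &
        forall x y z q, overlap3 V x y z q ->
          c' x y z q - c x y z q = b y z q - b x z q + b x y q].

Definition cech_class (Uc : (X -> set X) * cochain2) :
    set ((X -> set X) * cochain2) :=
  [set Uc' | cocycle2 Uc' /\ cohomologous Uc Uc'].

Record H2 := MkH2 {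
  h2_set : set ((X -> set X) * cochain2);
  h2_class : exists2 Uc, cocycle2 Uc & h2_set = cech_class Uc }.

HB.instance Definition _ := gen_eqMixin H2.
HB.instance Definition _ := gen_choiceMixin H2.

Lemma cocycle2_0 : cocycle2 (fun=> setT, fun _ _ _ _ => 0).
Proof.
split=> [x _|x y z q _|x y z w q _ _].
- by split; [exact: openT|].
- by apply: nearW.
- by rewrite !subr0.
Qed.

Definition H2_0 : H2 := MkH2 (ex_intro2 _ _ _ cocycle2_0 erefl).

(* The connecting map of 0 -> Z -> C -> C^* -> 0 (z |-> exp(2 i pi z)) applied
   to the transition functions of P between local sections s_x over U_x. *)
Definition is_c1 (P : bundle R X) (K : H2) : Prop :=
  exists (U : X -> set X) (s : X -> X -> btot P)
    (f : X -> X -> X -> Cx R) (c : cochain2),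
  [/\ cover_of U /\ h2_set K = cech_class (U, c),
      forall x, A x -> {within A `&` U x, continuous (s x)} /\
        (forall q, A q -> U x q -> bset P (s x q) /\ bproj P (s x q) = q),
      forall x y, A x -> A y ->
        {within A `&` U x `&` U y, continuous (f x y)},
      forall x y q, overlap2 U x y q ->
        bgrp P (exp2ipi (f x y q)) /\
        s y q = bact P (exp2ipi (f x y q)) (s x q) &
      forall x y z q, overlap3 U x y z q ->
        (c x y z q)%:~R = f y z q - f x z q + f x y q].

(* The class K in is_c1 is unique, and it exists for the paracompact bases that
   are used here; H2_0 is only a default value. *)
Definition c1 (P : bundle R X) : H2 := xget H2_0 [set K | is_c1 P K].

End Cech.

Section NormalBundle.
Variables (R : realType) (n : nat) (Y : manifold (Cx R) n) (Q : set Y).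

(* Stalk at q of the ideal sheaf of Q. *)
Definition ideal_at (q : Y) : set (Y -> Cx R) :=
  [set f | reg q f /\ \forall y \near q, Q y -> f y = 0].

(* The fibre of N_{Q/Y} = Hom(I/I^2, O_Q) at q: O-linear maps from the stalk of
   I to the residue field C at q, set to 0 outside of their domain. *)
Definition normal_space (q : Y) : set ((Y -> Cx R) -> Cx R) :=
  [set nu |
   [/\ forall f g, ideal_at q f -> ideal_at q g ->
         nu (fun y => f y + g y) = nu f + nu g,
       forall a f, reg q a -> ideal_at q f ->
         nu (fun y => a y * f y) = a q * nu f,
       forall f g, ideal_at q f -> (\forall y \near q, f y = g y) ->
         nu f = nu g &
       forall f, ~ ideal_at q f -> nu f = 0]].

Record nvec := NVec {
  nv_pt : Y;
  nv_fun : (Y -> Cx R) -> Cx R;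
  nv_mem : Q nv_pt;
  nv_normal : normal_space nv_pt nv_fun }.

HB.instance Definition _ := gen_eqMixin nvec.
HB.instance Definition _ := gen_choiceMixin nvec.

(* The topology of the total space of N_{Q/Y}: the coarsest one for which the
   projection and the pairings with the sections of I are continuous. *)
Definition nvec_index : set (set Y * (Y -> Cx R) * set (Cx R)) :=
  [set t | [/\ open t.1.1, forall x, t.1.1 x -> ideal_at x t.1.2 & open t.2]].

Definition nvec_subbase (t : set Y * (Y -> Cx R) * set (Cx R)) : set nvec :=
  [set v | t.1.1 (nv_pt v) /\ t.2 (nv_fun v t.1.2)].

HB.instance Definition _ :=
  @isSubBaseTopological.Build nvec _ nvec_index nvec_subbase.

Lemma normal_spaceZ (q : Y) (k : Cx R) nu :
  normal_space q nu -> normal_space q (fun f => k * nu f).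
Proof.
case=> nD nM nE n0; split=> [f g If Ig|a f ra If|f g If fg|f If].
- by rewrite nD// mulrDr.
- by rewrite nM// mulrCA.
- by rewrite (nE _ _ If fg).
- by rewrite n0// mulr0.
Qed.

Definition nv_scale (k : Cx R) (v : nvec) : nvec :=
  NVec (nv_mem v) (normal_spaceZ k (nv_normal v)).

Definition hermitian_metric
    (h : Y -> ((Y -> Cx R) -> Cx R) -> ((Y -> Cx R) -> Cx R) -> Cx R) : Prop :=
  [/\ forall q k nu mu om, Q q -> normal_space q nu -> normal_space q mu ->
        normal_space q om ->
        h q (fun f => k * nu f + mu f) om = k * h q nu om + h q mu om,
      forall q nu mu, Q q -> normal_space q nu -> normal_space q mu ->
        h q mu nu = (h q nu mu)^*,
      forall q nu, Q q -> normal_space q nu -> (exists f, nu f != 0) ->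
        0 < h q nu nu &
      continuous (fun v : nvec => h (nv_pt v) (nv_fun v) (nv_fun v))].

Definition circle_normal_bundle
    (h : Y -> ((Y -> Cx R) -> Cx R) -> ((Y -> Cx R) -> Cx R) -> Cx R) :
    bundle R Y :=
  Bundle (@unit_circle R)
    [set v : nvec | h (nv_pt v) (nv_fun v) (nv_fun v) = 1] nv_pt nv_scale.

(* The complex line bundle N_{Q/Y}, through its C^*-bundle of nonzero vectors. *)
Definition normal_bundle : bundle R Y :=
  Bundle [set k : Cx R | k != 0]
    [set v : nvec | exists f, nv_fun v f != 0] nv_pt nv_scale.

End NormalBundle.

(* The coordinates on the open subset dom sc_c of the total space are
   (u, v, z_3, ..., z_{n+2}), with t = uv; sc_emb identifies the open subset
   sc_B of Y with the branch {u = 0}. *)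
Record semistable_chart (R : realType) (n : nat) (Y : manifold (Cx R) n.+1)
    (Q : set Y) := SemistableChart {
  sc_tot : manifold (Cx R) n.+2;
  sc_pi : sc_tot -> Cx R;
  sc_flat : flat_to_disc sc_pi;
  sc_c : coord_system (Cx R) sc_tot n.+2;
  sc_coords : coords sc_c;
  sc_t : forall x, dom sc_c x -> sc_pi x = crd sc_c 0 x * crd sc_c 1 x;
  sc_B : set Y;
  sc_B_open : open sc_B;
  sc_emb : Y -> sc_tot;
  sc_ret : sc_tot -> Y;
  sc_embK : forall y, sc_B y -> sc_ret (sc_emb y) = y;
  sc_retK : forall x, dom sc_c x -> crd sc_c 0 x = 0 ->
    sc_B (sc_ret x) /\ sc_emb (sc_ret x) = x;
  sc_emb_branch : forall y, sc_B y ->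
    dom sc_c (sc_emb y) /\ crd sc_c 0 (sc_emb y) = 0;
  sc_emb_cont : {within sc_B, continuous sc_emb};
  sc_ret_cont : {within dom sc_c `&` [set x | crd sc_c 0 x = 0],
                   continuous sc_ret};
  sc_emb_reg : forall y f, sc_B y ->
    (reg y f <-> exists2 g, reg (sc_emb y) g &
                   \forall y' \near y, f y' = g (sc_emb y'));
  sc_emb_Q : forall y, sc_B y -> (Q y <-> crd sc_c 1 (sc_emb y) = 0) }.
Arguments sc_tot {R n Y Q} s.
Arguments sc_pi {R n Y Q} s _.
Arguments sc_c {R n Y Q} s.
Arguments sc_B {R n Y Q} s _.
Arguments sc_emb {R n Y Q} s _.
Arguments sc_ret {R n Y Q} s _.

Section Charts.
Variables (R : realType) (n : nat) (Y : manifold (Cx R) n.+1) (Q : set Y).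
Implicit Types c : semistable_chart Q.

Definition sc_V c : set Y := sc_B c `&` Q.
Definition sc_u c (x : sc_tot c) : Cx R := crd (sc_c c) 0 x.
Definition sc_v c (x : sc_tot c) : Cx R := crd (sc_c c) 1 x.
Arguments sc_u c x : clear implicits.
Arguments sc_v c x : clear implicits.
Definition sc_kn c : topologicalType := kn (sc_pi c @^-1` [set 0]).

(* The principal action for which the circle coordinate is eta = h(v): k
   multiplies h(v) by k and h(u) by 1/k. *)
Definition sc_act c (k : Cx R) (p : sc_kn c) : sc_kn c :=
  xget p [set p' : sc_kn c |
    [/\ kn_pt p' = kn_pt p,
        kn_h p' (sc_u c) = k^-1 * kn_h p (sc_u c) &
        kn_h p' (sc_v c) = k * kn_h p (sc_v c)]].

(* P_{V,theta}: the points (x, h) with x in V and pi^log(x, h) = (0, theta) *)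
Definition sc_bundle (theta : R) c : bundle R Y :=
  Bundle (@unit_circle R)
    [set p : sc_kn c | (sc_emb c @` sc_V c) (kn_pt p) /\
                       kn_h p (sc_pi c) = expi theta]
    (fun p : sc_kn c => sc_ret c (kn_pt p)) (@sc_act c).

(* The canonical identifications of the P_{V,theta} on overlaps: p' is the
   image of p under the map of Kato-Nakayama spaces induced by a local
   isomorphism om, over the disc, which is compatible with the identifications
   of the branches {u = 0} with Y. *)
Definition kn_identified c c' (p : sc_kn c) (p' : sc_kn c') : Prop :=
  exists (q : Y) (O : set (sc_tot c)) (O' : set (sc_tot c'))
    (om : sc_tot c -> sc_tot c') (om' : sc_tot c' -> sc_tot c),
  [/\ [/\ sc_V c q, sc_V c' q, kn_pt p = sc_emb c q & kn_pt p' = sc_emb c' q],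
      [/\ open_nbhs (kn_pt p) O, open_nbhs (kn_pt p') O',
          regmap O om & regmap O' om'],
      (forall x, O x -> O' (om x) /\ om' (om x) = x) /\
      (forall x', O' x' -> O (om' x') /\ om (om' x') = x'),
      (forall x, O x -> sc_pi c' (om x) = sc_pi c x) /\
      (\forall y \near q, om (sc_emb c y) = sc_emb c' y) &
      forall f, log_group (sc_pi c' @^-1` [set 0]) (kn_pt p') f ->
        kn_h p' f = kn_h p (f \o om)].

(* P, together with the psi c, is a global principal bundle over Q obtained by
   gluing the P_{V,theta} along their canonical identifications. *)
Definition is_gluing (theta : R) (P : bundle R Y)
    (psi : forall c, btot (sc_bundle theta c) -> btot P) : Prop :=
  [/\ principal_bundle Q P,
      forall c, @bundle_iso _ _ (sc_bundle theta c)
                  (restrict_bundle P (sc_V c)) (psi c) &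
      forall c c' (p : btot (sc_bundle theta c))
                  (p' : btot (sc_bundle theta c')),
        bset (sc_bundle theta c) p -> bset (sc_bundle theta c') p' ->
        (psi c p = psi c' p' <-> kn_identified p p')].

(* The canonical isomorphism with S(N_{Q/Y}): in every chart it sends the point
   with circle coordinate eta = h(v) to the unit normal vector nu with
   dv(nu) / |dv(nu)| = eta. *)
Definition canonical_iso (theta : R) (P : bundle R Y)
    (psi : forall c, btot (sc_bundle theta c) -> btot P)
    (h : Y -> ((Y -> Cx R) -> Cx R) -> ((Y -> Cx R) -> Cx R) -> Cx R)
    (Phi : btot P -> nvec Q) : Prop :=
  @bundle_iso _ _ P (circle_normal_bundle Q h) Phi /\
  (forall c (p : btot (sc_bundle theta c)), bset (sc_bundle theta c) p ->
     phase (nv_fun (Phi (psi c p)) (sc_v c \o sc_emb c)) = kn_h p (sc_v c)).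

(* An isotopy from Phi0 to Phi1 through isomorphisms onto the circle bundles of
   the metrics (1 - s) h0 + s h1. *)
Definition isotopic (P : bundle R Y)
    (h0 h1 : Y -> ((Y -> Cx R) -> Cx R) -> ((Y -> Cx R) -> Cx R) -> Cx R)
    (Phi0 Phi1 : btot P -> nvec Q) : Prop :=
  exists H : R * btot P -> nvec Q,
  [/\ {within [set sp | 0 <= sp.1 <= 1 /\ bset P sp.2], continuous H},
      forall s : R, 0 <= s <= 1 ->
        @bundle_iso _ _ P
          (circle_normal_bundle Q (fun q nu mu =>
             toC (1 - s) * h0 q nu mu + toC s * h1 q nu mu))
          (fun p => H (s, p)) &
      forall p, bset P p -> H (0, p) = Phi0 p /\ H (1, p) = Phi1 p].

End Charts.

(* Main.v *)
Require Import Defs.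
From HB Require Import structures.
From mathcomp Require Import all_boot all_order all_algebra.
From mathcomp Require Import all_classical all_reals all_analysis.
From mathcomp.real_closed Require Import complex.
From mathcomp Require Import ring.
Set Implicit Arguments.
Unset Strict Implicit.
Unset Printing Implicit Defensive.
Import Order.TTheory GRing.Theory Num.Theory.
Import numFieldNormedType.Exports.
Local Open Scope classical_set_scope.
Local Open Scope ring_scope.

(** The bundles P_{V,theta} glue to the circle bundle of oriented normal
    directions of Q in Y_1, because in both of them the fibre coordinate changes by
    the phase of the same function.

    On the log side, a point of P_{V,theta} over q is determined by the phase h(v):
    a section of M^gp at q is a unit times a monomial in u and v, and
    h(u) h(v) = exp(i theta) (log_phase_eq, log_phase_exists). This description of
    M^gp is a statement on holomorphic functions: a function without zeros off
    uv = 0 is a unit times a monomial (monomial_factorization). Its proof divides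
    by u or by v as long as the function vanishes at q (smooth_division); that a
    zero at q spreads to a branch follows from the maximum principle
    (max_modulus). On the normal side, the ideal of Q in a chart is generated by v
    (ideal_generator), so that a normal vector nu is determined by nu(v), and its
    direction by the phase of nu(v).

    Let v' = a v on Y_1 be the equations of Q in two charts. Then
    nu(v') = a(q) nu(v), and two points of the log spaces over q are canonically
    identified exactly when h'(v') is h(v) times the phase of a(q): the pullback of
    v' by a local isomorphism that is the identity on Y_1 can only be a unit times v
    with the unit equal to a on Q (identified_circle), and conversely
    u' = u / a, v' = a v defines such an isomorphism (circle_identified). Hence
    h(v) |-> phase of nu(v) is compatible with the gluing.

    The consequences are drawn for all circle bundles over Q with fibre coordinates
    over the charts that change by these phases (adapted). A map that preserves the
    coordinates is an isomorphism (preserves_iso), it exists and it is unique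
    (preserves_exists, preserves_unique). The bundle of directions, any gluing, and
    the unit circle bundle of any hermitian metric are adapted; this gives the
    gluing, its universal property (gluing_map), and the canonical isomorphism with
    S(N) (canonical_exists). Rescaling unit vectors along a segment of metrics gives
    the isotopy (canonical_isotopic). For the Chern class, transition functions of N
    and their phases have logarithms whose differences form an additive cocycle of
    functions, so that both bundles have the same integral cocycles (circle_c1). *)

(* Simplification must not unfold Cx R to the pairs of its real and imaginary
   parts. *)
Arguments Num.ClosedField.sort _ : simpl never.

(** * Calculus of smooth functions *)

Section SmoothCalculus.
Variables (K : numFieldType) (V : normedModType K).
Implicit Types (W : normedModType K) (A : set V).

(** A quotient F / u is only known near u = 0 through an approximation by a
    differentiable function; this is enough to differentiate it there. *)
Lemma differentiable_approx W (f T : V -> W) (x : V) :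
  differentiable T x -> f x = T x ->
  (forall e : K, 0 < e -> \forall y \near x, `|f y - T y| <= e * `|y - x|) ->
  differentiable f x /\ 'd f x = 'd T x :> (V -> W).
Proof.
move=> dT fT fe.
have cT : continuous ('d T x) by exact: diff_continuous.
suff dec : f \o shift x = cst (f x) + 'd T x +o_ 0 id.
  have E := diff_unique cT dec; split => //.
  by apply/diff_locallyP; rewrite E.
apply/eqaddoP => _/posnumP[e].
have e2 : (0 : K) < e%:num / 2 by [].
have /eqaddoP/(_ _ e2) H := diff_locally dT.
have := fe _ e2; rewrite (near_shift 0 x) => {}fe.
near=> h.
have H1 : `|T (h + x) - (T x + 'd T x h)| <= e%:num / 2 * `|h|.
  by near: h; exact: H.
have H2 : `|f (h + x) - T (h + x)| <= e%:num / 2 * `|h|.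
  suff : `|f (h + x) - T (h + x)| <= e%:num / 2 * `|h + x - x| by rewrite addrK.
  by near: h; apply: filterS fe => h; rewrite /= subr0.
rewrite /= fT -[X in `|X|]/(f (h + x) - (T x + 'd T x h)).
rewrite -(subrK (T (h + x)) (f (h + x))) -addrA.
rewrite (le_trans (ler_normD _ _))// (splitr e%:num) mulrDl.
exact: lerD.
Unshelve. all: by end_near. Qed.

Lemma near_eq_differentiable W (f g : V -> W) (x : V) :
  (\forall y \near x, f y = g y) -> differentiable f x -> differentiable g x.
Proof.
move=> fg df; have fgx := nbhs_singleton fg.
have [] // := @differentiable_approx W g f x df (esym fgx) _.
move=> e e0; near=> y.
have -> : f y = g y by near: y.
by rewrite subrr normr0 mulr_ge0// ltW.
Unshelve. all: by end_near. Qed.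

(** C^oo for K = R and holomorphic for K = C. All the closure properties below
    go by induction on the order of differentiation. *)
Definition smooth_on W A (f : V -> W) := forall k, diff_times k A f.

Lemma diff_timesW W k A (f : V -> W) : diff_times k.+1 A f -> diff_times k A f.
Proof.
elim: k f => [|k IH] f [df Df]; split => // v; apply: IH; exact: Df.
Qed.

Lemma diff_times_sub W k A B (f : V -> W) : B `<=` A ->
  diff_times k A f -> diff_times k B f.
Proof.
move=> BA; elim: k f => [|k IH] f [df Df]; split => //.
- by move=> x /BA; exact: df.
- by move=> x /BA; exact: df.
- by move=> v; apply: IH; exact: Df.
Qed.

Lemma eq_diff_times W k A (f g : V -> W) : open A ->
  (forall x, A x -> f x = g x) -> diff_times k A f -> diff_times k A g.
Proof.
move=> oA; elim: k f g => [|k IH] f g fg [df Df]; split => //.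
- move=> x Ax; apply: near_eq_differentiable (df _ Ax).
  by apply: filterS (open_nbhs_nbhs (conj oA Ax)) => y; exact: fg.
- move=> x Ax; apply: near_eq_differentiable (df _ Ax).
  by apply: filterS (open_nbhs_nbhs (conj oA Ax)) => y; exact: fg.
- move=> v; apply: IH (Df v) => x Ax; apply: near_eq_derive.
  by apply: filterS (open_nbhs_nbhs (conj oA Ax)) => y; exact: fg.
Qed.

Lemma smooth_on_differentiable W A (f : V -> W) x : smooth_on A f -> A x ->
  differentiable f x.
Proof. by move=> /(_ 0%N)[df _] /df. Qed.

Lemma smooth_on_continuous W A (f : V -> W) x : smooth_on A f -> A x ->
  {for x, continuous f}.
Proof.
move=> sf Ax; exact/differentiable_continuous/(smooth_on_differentiable sf).
Qed.

Lemma smooth_on_derive W A (f : V -> W) v : smooth_on A f ->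
  smooth_on A (fun x => 'D_v f x).
Proof. by move=> sf k; have [_] := sf k.+1; apply. Qed.

Lemma smooth_on_sub W A B (f : V -> W) : B `<=` A ->
  smooth_on A f -> smooth_on B f.
Proof. by move=> BA sf k; exact: diff_times_sub (sf k). Qed.

Lemma eq_smooth_on W A (f g : V -> W) : open A ->
  (forall x, A x -> f x = g x) -> smooth_on A f -> smooth_on A g.
Proof. by move=> oA fg sf k; exact: eq_diff_times (sf k). Qed.

Lemma diff_times_cst W k A (a : W) : diff_times k A (fun=> a).
Proof.
elim: k a => [|k IH] a; split => //; try by move=> x _; exact: differentiable_cst.
move=> v; rewrite (_ : 'D_v _ = fun=> 0); first exact: IH.
  by apply/funext => x; rewrite [LHS]derive_cst.
Qed.

Lemma smooth_on_cst W A (a : W) : smooth_on A (fun=> a).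
Proof. by move=> k; exact: diff_times_cst. Qed.

Lemma diff_timesD W k A (f g : V -> W) : open A ->
  diff_times k A f -> diff_times k A g -> diff_times k A (fun x => f x + g x).
Proof.
move=> oA; elim: k f g => [|k IH] f g [df Df] [dg Dg]; split => //.
- by move=> x Ax; apply: differentiableD; [exact: df|exact: dg].
- by move=> x Ax; apply: differentiableD; [exact: df|exact: dg].
- move=> v.
  apply: (eq_diff_times oA _ (IH _ _ (Df v) (Dg v))) => x Ax.
  by rewrite -[RHS]/('D_v (f + g) x) deriveD//; apply: diff_derivable;
    [exact: df|exact: dg].
Qed.

Lemma smooth_onD W A (f g : V -> W) : open A ->
  smooth_on A f -> smooth_on A g -> smooth_on A (fun x => f x + g x).
Proof. by move=> oA sf sg k; exact: diff_timesD. Qed.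

Lemma diff_times_sum W k A n (f : 'I_n -> V -> W) : open A ->
  (forall i, diff_times k A (f i)) -> diff_times k A (fun x => \sum_i f i x).
Proof.
move=> oA; elim: n f => [|n IH] f sf.
  apply: (eq_diff_times oA _ (diff_times_cst k A (0 : W))) => x _.
  by rewrite big_ord0.
have := diff_timesD oA (IH _ (fun i => sf (widen_ord (leqnSn n) i))) (sf ord_max).
by apply: eq_diff_times => // x _; rewrite big_ord_recr.
Qed.

Lemma diff_timesM k A (f g : V -> K) : open A ->
  diff_times k A f -> diff_times k A g -> diff_times k A (fun x => f x * g x).
Proof.
move=> oA; elim: k f g => [|k IH] f g Hf Hg.
  have [df _] := Hf; have [dg _] := Hg; split => // x Ax.
  by apply: differentiableM; [exact: df|exact: dg].
have [df Df] := Hf; have [dg Dg] := Hg; split.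
  by move=> x Ax; apply: differentiableM; [exact: df|exact: dg].
move=> v.
have := diff_timesD oA (IH _ _ (diff_timesW Hf) (Dg v))
  (IH _ _ (diff_timesW Hg) (Df v)).
apply: eq_diff_times => // x Ax.
by rewrite -[RHS]/('D_v (f * g) x) deriveM//; apply: diff_derivable;
    [exact: df|exact: dg].
Qed.

Lemma smooth_onM A (f g : V -> K) : open A ->
  smooth_on A f -> smooth_on A g -> smooth_on A (fun x => f x * g x).
Proof. by move=> oA sf sg k; exact: diff_timesM. Qed.

Lemma smooth_onX A (f : V -> K) n : open A ->
  smooth_on A f -> smooth_on A (fun x => f x ^+ n).
Proof.
move=> oA sf; elim: n => [|n IH].
  by apply: (eq_smooth_on oA _ (smooth_on_cst A (1 : K))).
by apply: (eq_smooth_on oA _ (smooth_onM oA sf IH)) => x _; rewrite exprS.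
Qed.

Lemma smooth_onB A (f g : V -> K) : open A ->
  smooth_on A f -> smooth_on A g -> smooth_on A (fun x => f x - g x).
Proof.
move=> oA sf sg.
have := smooth_onD oA sf (smooth_onM oA (smooth_on_cst A (-1 : K)) sg).
by apply: eq_smooth_on => // x _; rewrite mulN1r.
Qed.

Lemma smooth_onV A (f : V -> K) : open A -> (forall x, A x -> f x != 0) ->
  smooth_on A f -> smooth_on A (fun x => (f x)^-1).
Proof.
move=> oA f0 sf; elim => [|k IH].
  split => // x Ax; apply: differentiableV; last exact: f0.
  exact: smooth_on_differentiable Ax.
split.
  move=> x Ax; apply: differentiableV; last exact: f0.
  exact: smooth_on_differentiable Ax.
move=> v.
have := diff_timesM oA (diff_timesM oA (diff_times_cst k A (-1 : K))
   (smooth_on_derive v sf k)) (diff_timesM oA IH IH).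
apply: eq_diff_times => // x Ax.
rewrite deriveV ?f0//; last exact/diff_derivable/(smooth_on_differentiable sf).
by rewrite mulN1r -exprVn expr2 scaleNr mulNr mulrC.
Qed.

End SmoothCalculus.

Section SmoothRow.
Variables (K : numFieldType) (V : normedModType K) (n : nat).
Implicit Types A : set V.

Lemma derive_coord (i : 'I_n) (v y : 'rV[K]_n) :
  'D_v (fun x : 'rV[K]_n => x 0 i) y = v 0 i.
Proof.
have lf : linear (fun x : 'rV[K]_n => x 0 i : K^o) by move=> ???; rewrite !mxE.
pose f := HB.pack_for {linear 'rV[K]_n -> K^o} (fun x : 'rV[K]_n => x 0 i : K^o)
  (GRing.isLinear.Build _ _ _ _ _ lf).
have cf : continuous f by move=> x; exact: coord_continuous.
rewrite deriveE; last exact: differentiable_coord.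
have -> : (fun x : 'rV[K]_n => x 0 i) = f by [].
by rewrite (diff_lin y cf).
Qed.

Lemma smooth_on_coord (i : 'I_n) (B : set 'rV[K]_n) : open B ->
  smooth_on B (fun x : 'rV[K]_n => x 0 i).
Proof.
move=> oB; case=> [|k]; split => //; try by move=> x _; exact: differentiable_coord.
move=> v; apply: (eq_diff_times oB _ (diff_times_cst k B (v 0 i))) => x _.
by rewrite derive_coord.
Qed.

Lemma differentiable_row (Phi : 'I_n -> V -> K) x :
  (forall i, differentiable (Phi i) x) ->
  differentiable (fun y => \row_i Phi i y) x /\
  forall v, 'd (fun y => \row_i Phi i y) x v = \row_i 'd (Phi i) x v.
Proof.
move=> dPhi.
pose F i : V -> 'rV[K]_n := fun y => Phi i y *: delta_mx 0 i.
have dF i : differentiable (F i) x by exact: differentiableZl.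
have E : (fun y => \row_i Phi i y) = \sum_i F i.
  apply/funext => y; rewrite fct_sumE; apply/rowP => j; rewrite mxE summxE.
  rewrite (bigD1 j)//= !mxE !eqxx mulr1 big1 ?addr0// => i ij.
  by rewrite !mxE eqxx/= (eq_sym j) (negbTE ij) mulr0.
have dE : differentiable (fun y => \row_i Phi i y) x.
  by rewrite E; exact: differentiable_sum.
split => // v; apply/rowP => j; rewrite mxE.
have H := derive_coord j ('d (fun y => \row_i Phi i y) x v) (\row_i Phi i x).
rewrite deriveE in H; last exact: differentiable_coord.
rewrite -H {H}.
have -> : Phi j = (fun y : 'rV[K]_n => y 0 j) \o (fun y => \row_i Phi i y).
  by apply/funext => y /=; rewrite mxE.
by rewrite diff_comp//=; exact: differentiable_coord.
Qed.

Lemma derive_comp_row (f : 'rV[K]_n -> K) (Phi : 'I_n -> V -> K) x v :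
  (forall i, differentiable (Phi i) x) ->
  differentiable f (\row_i Phi i x) ->
  'D_v (fun y => f (\row_i Phi i y)) x =
  \sum_i 'D_(delta_mx 0 i) f (\row_i Phi i x) * 'D_v (Phi i) x.
Proof.
move=> dPhi df; have [dR DR] := differentiable_row dPhi.
rewrite -[X in 'D_v X x]/(f \o (fun y => \row_i Phi i y)).
rewrite deriveE; last exact: differentiable_comp.
rewrite diff_comp//= DR [X in 'd f _ X]row_sum_delta linear_sum.
apply: eq_bigr => i _; rewrite linearZ/= mxE mulrC.
by rewrite deriveE// deriveE.
Qed.

Lemma smooth_on_comp A (B : set 'rV[K]_n) (f : 'rV[K]_n -> K)
    (Phi : 'I_n -> V -> K) : open A -> open B ->
  smooth_on B f -> (forall i, smooth_on A (Phi i)) ->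
  (forall x, A x -> B (\row_i Phi i x)) ->
  smooth_on A (fun x => f (\row_i Phi i x)).
Proof.
move=> oA oB sf sPhi AB k.
have dfP g : smooth_on B g -> forall x, A x ->
    differentiable (fun x => g (\row_i Phi i x)) x.
  move=> sg x Ax.
  apply: (@differentiable_comp _ _ _ _ (fun x => \row_i Phi i x)).
    by apply: (differentiable_row _).1 => i; exact: smooth_on_differentiable Ax.
  exact/(smooth_on_differentiable sg)/AB.
elim: k f sf => [|k IH] f sf; split => //; try exact: dfP.
move=> v.
pose G i x := 'D_(delta_mx 0 i) f (\row_i Phi i x) * 'D_v (Phi i) x.
suff : diff_times k A (fun x => \sum_i G i x).
  apply: eq_diff_times => // x Ax.
  rewrite derive_comp_row//; last exact/(smooth_on_differentiable sf)/AB.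
  by move=> i; exact: smooth_on_differentiable Ax.
have GP i : diff_times k A (G i).
  apply: diff_timesM => //; last exact: smooth_on_derive.
  exact: (IH _ (smooth_on_derive _ sf)).
exact: diff_times_sum.
Qed.

End SmoothRow.

(** * Mean value inequality over the complex numbers *)

Section ComplexBasics.
Variable R : realType.
Implicit Types (r s t : R) (z w : Cx R).
Local Notation Re := (@complex.Re R).
Local Notation Im := (@complex.Im R).

Lemma toCD r s : toC (r + s) = toC r + toC s.
Proof. exact: (rmorphD (real_complex R)). Qed.

Lemma toCB r s : toC (r - s) = toC r - toC s.
Proof. exact: (rmorphB (real_complex R)). Qed.

Lemma toCM r s : toC (r * s) = toC r * toC s.
Proof. exact: (rmorphM (real_complex R)). Qed.

Lemma toC1 : toC (1 : R) = 1. Proof. by []. Qed.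
Lemma toC0 : toC (0 : R) = 0. Proof. by []. Qed.

Lemma toCV r : toC r^-1 = (toC r)^-1.
Proof. exact: (fmorphV (real_complex R)). Qed.

Lemma toCX r n : toC (r ^+ n) = toC r ^+ n.
Proof. exact: (rmorphXn (real_complex R)). Qed.

Lemma toC_le r s : (toC r <= toC s) = (r <= s).
Proof. exact: lecR. Qed.

Lemma toC_lt r s : (toC r < toC s) = (r < s).
Proof. exact: ltcR. Qed.

Lemma toC_ge0 r : (0 <= toC r) = (0 <= r).
Proof. exact: (lecR 0 r). Qed.

Lemma toC_gt0 r : (0 < toC r) = (0 < r).
Proof. exact: (ltcR 0 r). Qed.

Lemma toC_inj : injective (@toC R).
Proof. exact: complexI. Qed.

Lemma norm_toC r : `|toC r| = toC `|r|.
Proof. by rewrite [LHS]normc_def /= expr0n/= addr0 sqrtr_sqr. Qed.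

Lemma ReD z w : Re (z + w) = Re z + Re w.
Proof. exact: raddfD. Qed.

Lemma ReB z w : Re (z - w) = Re z - Re w.
Proof. exact: raddfB. Qed.

Lemma Re_toCM r z : Re (toC r * z) = r * Re z.
Proof. by case: z => a b /=; rewrite mul0r subr0. Qed.

Lemma toC_Re z : z \is Num.real -> toC (Re z) = z.
Proof. exact: RRe_real. Qed.

Lemma ge0_toC z : 0 <= z -> exists2 r, 0 <= r & z = toC r.
Proof.
move=> z0; have zr := ger0_real z0; exists (Re z); last by rewrite toC_Re.
by rewrite -toC_ge0 toC_Re.
Qed.

Lemma gt0_toC z : 0 < z -> exists2 r, 0 < r & z = toC r.
Proof.
move=> z0; have [r r0 E] := ge0_toC (ltW z0); exists r => //.
by rewrite -toC_gt0 -E.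
Qed.

Lemma normRe z : toC `|Re z| <= `|z|.
Proof. exact: normc_ge_Re. Qed.

Lemma continuous_toC : continuous (@toC R).
Proof.
move=> r; apply/(@cvgrPdist_lt _ _ _ (nbhs r)) => e /gt0_toC[d d0 ->].
near=> s; rewrite -toCB norm_toC toC_lt; near: s.
exact: nbhsx_ballx.
Unshelve. all: by end_near. Qed.

Lemma continuous_Re : continuous (Re : Cx R -> R).
Proof.
move=> z; apply/(@cvgrPdist_lt _ _ _ (nbhs (z : Cx R))) => e e0; near=> w.
rewrite -toC_lt -ReB (le_lt_trans (normRe _))//; near: w.
by apply: nbhsx_ballx; rewrite toC_gt0.
Unshelve. all: by end_near. Qed.

Lemma is_derive_Re (phi : Cx R -> Cx R) d t w :
  is_derive (toC t) 1 phi d ->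
  is_derive t 1 (fun s => Re (w * phi (toC s))) (Re (w * d)).
Proof.
move=> [dphi <-].
have H : (fun s : R => s^-1 *: (Re (w * phi (toC (s *: 1 + t))) -
    Re (w * phi (toC t)))) @ 0^' --> Re (w * 'D_1 phi (toC t)).
  have toC0' : (@toC R) @ 0^' --> 0^'.
    move=> A HA.
    have H : \forall s \near (0 : R), toC s != 0 -> A (toC s).
      exact: (continuous_toC (x := 0) HA).
    suff H' : \forall s \near (0 : R), s != 0 -> A (toC s) by exact: H'.
    apply: filterS H => s /= + s0; apply.
    by apply: contra s0 => /eqP/(@toC_inj s 0) ->.
  have H0 := cvg_comp _ _ toC0' dphi.
  have H1 : (fun s : R => w * ((toC s)^-1 *: ((phi \o shift (toC t)) (toC s *: 1)
      - phi (toC t)))) @ 0^' --> w * 'D_1 phi (toC t).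
    by apply: cvgM; [exact: cvg_cst|exact: H0].
  have := cvg_comp _ _ H1 (continuous_Re (x := w * 'D_1 phi (toC t))).
  apply: cvg_trans; apply: near_eq_cvg; near=> s => /=.
  rewrite -ReB -mulrBr [RHS](_ : _ = s^-1 * Re (w * (phi (toC (s *: 1 + t)) -
    phi (toC t)))) // -(Re_toCM s^-1) toCV mulrCA.
  by rewrite toCD [s *: 1]mulr1 [_%:A]mulr1.
exact: DeriveDef (cvgP _ H) (cvg_lim _ H).
Unshelve. all: by end_near. Qed.

(** The real mean value theorem, applied to the real part of the product of phi
    with the conjugate of its increment. *)
Lemma mean_value (phi dphi : Cx R -> Cx R) (M : Cx R) :
  (forall t, 0 <= t <= 1 -> is_derive (toC t) 1 phi (dphi (toC t))) ->
  (forall t, 0 <= t <= 1 -> `|dphi (toC t)| <= M) ->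
  forall t, 0 <= t <= 1 -> `|phi (toC t) - phi 0| <= M.
Proof.
move=> dP dM t /andP[t0 t1].
have M0 : 0 <= M by apply: le_trans (dM 0 _) => //; rewrite lexx ler01.
set D := phi (toC t) - phi 0.
have [->|D0] := eqVneq D 0; first by rewrite normr0.
have dpsi s : 0 <= s <= 1 -> is_derive s 1 (fun s => Re (D^* * phi (toC s)))
   (Re (D^* * dphi (toC s))) by move=> /dP; exact: is_derive_Re.
have [|| c] := @MVT_segment R (fun s => Re (D^* * phi (toC s)))
    (fun s => Re (D^* * dphi (toC s))) 0 t t0.
- move=> s; rewrite in_itv/= => /andP[s0 st]; apply: dpsi.
  by rewrite (ltW s0)/= (le_trans (ltW st)).
- apply: derivable_within_continuous => s; rewrite in_itv/= => /andP[s0 st].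
  apply: ex_derive; apply: dpsi; by rewrite s0 (le_trans st).
rewrite in_itv/= subr0 -ReB -mulrBr => /andP[c0 ct] E.
have DD : toC (Re (D^* * D)) = `|D| ^+ 2.
  by rewrite mulrC -normCK toC_Re// realX.
have : `|D| ^+ 2 <= `|D| * M.
  rewrite -DD /D E toCM -/D.
  apply: (@le_trans _ _ (`|D^* * dphi (toC c)|)); last first.
    rewrite normrM norm_conjC ler_wpM2l// dM// c0/=; exact: le_trans t1.
  apply: (@le_trans _ _ (toC `|Re (D^* * dphi (toC c))|)); last exact: normRe.
  rewrite -toCM toC_le; apply: (@le_trans _ _ (`|Re (D^* * dphi (toC c))| * t)).
    by rewrite ler_wpM2r// ler_norm.
  by rewrite ler_piMr.
by rewrite expr2 ler_pM2l// normr_gt0.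
Qed.

(** By induction on the order: the derivative of a Taylor remainder of phi is the
    Taylor remainder of phi' of the order below, and it is bounded by M. *)
Lemma taylor_chain n (phi : nat -> Cx R -> Cx R) (M : Cx R) :
  (forall j t, (j < n)%N -> 0 <= t <= 1 ->
     is_derive (toC t) 1 (phi j) (phi j.+1 (toC t))) ->
  (forall t, 0 <= t <= 1 -> `|phi n (toC t)| <= M) ->
  forall t, 0 <= t <= 1 ->
    `|phi 0%N (toC t) - \sum_(j < n) phi j 0 / j`!%:R * toC t ^+ j| <= M.
Proof.
elim: n phi => [|n IH] phi dphi Mphi.
  by move=> t t01; rewrite big_ord0 subr0; exact: Mphi.
have {}IH := IH (fun j => phi j.+1) (fun j t jn => dphi j.+1 t jn) Mphi.
pose P z := phi 0%N z - \sum_(j < n.+1) phi j 0 / j`!%:R * z ^+ j.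
pose dP z := phi 1%N z - \sum_(j < n) phi j.+1 0 / j`!%:R * z ^+ j.
have isd t : 0 <= t <= 1 -> is_derive (toC t) 1 P (dP (toC t)).
  move=> t01.
  have -> : P = phi 0%N - \sum_(j < n.+1) (fun z : Cx R =>
      phi j 0 / j`!%:R * z ^+ j).
    by apply/funext => z; rewrite /P !fctE fct_sumE.
  apply: is_deriveB; first exact: dphi.
  rewrite big_ord_recl/= -[X in is_derive _ _ _ X]add0r.
  apply: is_deriveD.
    rewrite (_ : (fun z => _) = cst (phi 0%N 0 / 0`!%:R)); last first.
      by apply/funext => z; rewrite expr0 mulr1.
    exact: is_derive_cst.
  apply: is_derive_sum => i.
  have := @is_deriveX _ _ (id : Cx R -> Cx R) (bump 0 i) (toC t) 1 1 _.
  move=> /(_ (is_derive_id _ _)) /(is_deriveZ (phi (bump 0 i) 0 / (bump 0 i)`!%:R)).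
  rewrite (_ : _ \*: _ = fun z : Cx R =>
      phi (bump 0 i) 0 / (bump 0 i)`!%:R * z ^+ bump 0 i); last first.
    by apply/funext => z; rewrite /= exprfctE.
  move=> H; apply: is_derive_eq H _.
  rewrite /GRing.scale/= mulr1 /bump /= add1n factS natrM invfM.
  rewrite add0n -!mulrA; congr (_ * _).
  by rewrite mulrCA mulKf// pnatr_eq0.
move=> t t01.
have := mean_value isd IH t01.
suff -> : P 0 = 0 by rewrite subr0.
rewrite /P big_ord_recl/= expr0 divr1 mulr1 big1 ?addr0 ?subrr// => i _.
by rewrite expr0n/= mulr0.
Qed.

End ComplexBasics.

(** * Taylor estimate and symmetry of second derivatives *)

Lemma open_near (T : topologicalType) (A : set T) x : open A -> A x ->
  \forall y \near x, A y.
Proof. by move=> oA Ax; exact: (open_nbhs_nbhs (conj oA Ax)). Qed.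

Lemma second_difference_sub (K : comRingType) (a b c d s L L' : K) :
  s * (L - L') = (a - c - b + d - s * L') - (a - b - c + d - s * L).
Proof. by ring. Qed.

Lemma segment_ends (K : comRingType) (a b s : K) :
  a - 1 * s - (b - 0 * s) = a - b - s.
Proof. by ring. Qed.

Lemma second_difference_split (K : comRingType) (a b c d s : K) :
  a - b - (c - d) - s = a - b - c + d - s.
Proof. by ring. Qed.

Lemma ler_norm_sub_half (K : numFieldType) (a b s e : K) :
  `|a| <= s * (e / 2) -> `|b| <= s * (e / 2) -> `|a - b| <= s * e.
Proof.
move=> la lb; rewrite (le_trans (ler_normB _ _))// [e]splitr mulrDr.
exact: lerD.
Qed.

Section Taylor.
Variables (R : realType) (V : normedModType (Cx R)).
Implicit Types (A : set V) (f g : V -> Cx R) (x h u w : V).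

Definition iterD h j f := iter j (fun g x => 'D_h g x) f.
Arguments iterD : simpl never.

Lemma smooth_on_iterD A h j f : smooth_on A f -> smooth_on A (iterD h j f).
Proof.
move=> sf; elim: j => [|j IH]; first exact: sf.
exact: (smooth_on_derive h IH).
Qed.

Lemma iterDS h j f : iterD h j.+1 f = (fun x => 'D_h (iterD h j f) x).
Proof. by []. Qed.

Lemma is_derive_line f x h (z : Cx R) : differentiable f (x + z *: h) ->
  is_derive z 1 (fun s => f (x + s *: h)) ('D_h f (x + z *: h)).
Proof.
move=> df; have := diff_derivable (v := h) df.
have E : (fun s : Cx R => s^-1 *: (((fun s => f (x + s *: h)) \o shift z) (s *: 1)
    - f (x + z *: h)))
   = (fun s : Cx R => s^-1 *: ((f \o shift (x + z *: h)) (s *: h)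
    - f (x + z *: h))).
  apply/funext => s /=; congr (_ *: (f _ - _)).
  by rewrite [s%:A]mulr1 scalerDl addrCA.
move=> dv; apply: DeriveDef.
- by rewrite /derivable E.
- by rewrite /derive E.
Qed.

Lemma taylor A f x h n (M : Cx R) : smooth_on A f ->
  (forall t : R, 0 <= t <= 1 -> A (x + toC t *: h)) ->
  (forall t : R, 0 <= t <= 1 -> `|iterD h n f (x + toC t *: h)| <= M) ->
  `|f (x + h) - \sum_(j < n) iterD h j f x / j`!%:R| <= M.
Proof.
move=> sf seg Mf.
have l01 : 0 <= (1 : R) <= 1 by rewrite ler01 lexx.
have := @taylor_chain _ n (fun j z => iterD h j f (x + z *: h)) M _ Mf 1 l01.
rewrite toC1 scale1r => H.
rewrite (eq_bigr (fun j : 'I_n =>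
    iterD h j f (x + 0 *: h) / j`!%:R * 1 ^+ j)); last first.
  by move=> j _; rewrite scale0r addr0 expr1n mulr1.
apply: H => j t _ t01; rewrite iterDS; apply: is_derive_line.
apply: smooth_on_differentiable (seg t t01).
exact: smooth_on_iterD.
Qed.

Lemma deriveZdir f x h (c : Cx R) : differentiable f x ->
  'D_(c *: h) f x = c * 'D_h f x.
Proof. by move=> df; rewrite !deriveE// linearZ. Qed.

Lemma deriveDdir f x h h' : differentiable f x ->
  'D_(h + h') f x = 'D_h f x + 'D_h' f x.
Proof. by move=> df; rewrite !deriveE// linearD. Qed.

Lemma eq_derive_open (W : normedModType (Cx R)) A (f g : V -> W) x h : open A -> A x ->
  (forall y, A y -> f y = g y) -> 'D_h f x = 'D_h g x :> W.
Proof.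
move=> oA Ax fg; apply: near_eq_derive.
by apply: filterS (open_near oA Ax).
Qed.

Lemma deriveMc f x h (c : Cx R) : differentiable f x ->
  'D_h (fun y => c * f y) x = c * 'D_h f x.
Proof. by move=> df; rewrite -[RHS]deriveZ//; exact: diff_derivable. Qed.

Lemma iterDZ A f x h (c : Cx R) j : open A -> smooth_on A f -> A x ->
  iterD (c *: h) j f x = c ^+ j * iterD h j f x.
Proof.
move=> oA sf; elim: j x => [|j IH] x Ax; first by rewrite expr0 mul1r.
transitivity ('D_(c *: h) (fun y => c ^+ j * iterD h j f y) x).
  exact: eq_derive_open oA Ax IH.
have dj : differentiable (iterD h j f) x.
  by apply: smooth_on_differentiable Ax; exact: smooth_on_iterD.
by rewrite (deriveMc _ _ dj) (deriveZdir _ _ dj) mulrA -exprSr.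
Qed.

(** Two applications of the mean value inequality: in the direction u to the
    increments of f in the direction w, then in the direction w to 'D_u f. *)
Lemma second_difference A f x u w (e : Cx R) : open A -> smooth_on A f ->
  A x -> 0 < e -> \forall t \near (0 : R)^'+,
  `|f (x + toC t *: u + toC t *: w) - f (x + toC t *: u) - f (x + toC t *: w)
    + f x - toC t ^+ 2 * 'D_w (fun y => 'D_u f y) x| <= toC t ^+ 2 * e.
Proof.
move=> oA sf Ax e0; set L := 'D_w _ x.
have sDu := smooth_on_derive u sf; have sDD := smooth_on_derive w sDu.
have cDD := smooth_on_continuous sDD Ax.
have /nbhs_ballP[d /= d0 dA] : \forall y \near x, A y /\
    `|L - 'D_w (fun y => 'D_u f y) y| <= e.
  apply: filterI; first exact: open_near.
  by near=> y; near: y; move: e e0; apply/cvgrPdist_le.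
have [d' d'0 dE] := gt0_toC d0.
have N0 : 0 < `|u| + `|w| + 1 by rewrite ltr_wpDl// addr_ge0.
have [N N0' NE] := gt0_toC N0.
have dN : 0 < d' / N by rewrite divr_gt0.
near=> t; have t0 : 0 < t by [].
have Et : `|toC t| = toC t by rewrite norm_toC gtr0_norm.
have tN : toC t * (`|u| + `|w| + 1) < d.
  rewrite NE dE -toCM toC_lt -ltr_pdivlMr//.
have inB (s r : R) : 0 <= s <= 1 -> 0 <= r <= 1 ->
    ball x d (x + toC s *: (toC t *: u) + toC r *: (toC t *: w)).
  move=> /andP[s0 s1] /andP[r0 r1].
  rewrite -ball_normE /ball_/= -addrA opprD addNKr normrN.
  apply: le_lt_trans tN; rewrite (le_trans (ler_normD _ _))//.
  rewrite !normrZ !norm_toC !ger0_norm// ?(ltW t0)//.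
  rewrite mulrA [X in _ + X]mulrA.
  apply: (@le_trans _ _ (toC t * `|u| + toC t * `|w|)).
    apply: lerD; apply: ler_wpM2r => //; rewrite -toCM toC_le ler_piMl// ltW//.
  by rewrite -mulrDr ler_wpM2l ?toC_ge0 ?(ltW t0)// lerDl.
pose phi s := f (x + s *: (toC t *: u) + toC t *: w) - f (x + s *: (toC t *: u))
  - s * (toC t ^+ 2 * L).
pose dphi s := toC t * ('D_u f (x + s *: (toC t *: u) + toC t *: w)
  - 'D_u f (x + s *: (toC t *: u)) - toC t * L).
have l11 : 0 <= (1 : R) <= 1 by rewrite ler01 lexx.
have l00 : 0 <= (0 : R) <= 1 by rewrite ler01 lexx.
have inA1 (s : R) : 0 <= s <= 1 -> A (x + toC s *: (toC t *: u) + toC t *: w).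
  by move=> s01; have /dA[] := inB s 1 s01 l11; rewrite toC1 scale1r.
have inA0 (s : R) : 0 <= s <= 1 -> A (x + toC s *: (toC t *: u)).
  by move=> s01; have /dA[] := inB s 0 s01 l00; rewrite toC0 scale0r addr0.
have dP (s : R) : 0 <= s <= 1 -> is_derive (toC s) 1 phi (dphi (toC s)).
  move=> s01.
  have E z : x + z *: (toC t *: u) + toC t *: w = x + toC t *: w + z *: (toC t *: u).
    by rewrite addrAC.
  have D1 : is_derive (toC s) 1 (fun z => f (x + z *: (toC t *: u) + toC t *: w))
      (toC t * 'D_u f (x + toC s *: (toC t *: u) + toC t *: w)).
    under eq_fun do rewrite E.
    have dfs : differentiable f (x + toC t *: w + toC s *: (toC t *: u)).
      by rewrite -E; exact: smooth_on_differentiable (inA1 s s01).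
    rewrite E -(deriveZdir u (toC t) dfs).
    exact: is_derive_line.
  have D0 : is_derive (toC s) 1 (fun z => f (x + z *: (toC t *: u)))
      (toC t * 'D_u f (x + toC s *: (toC t *: u))).
    have dfs := smooth_on_differentiable sf (inA0 s s01).
    rewrite -(deriveZdir u (toC t) dfs).
    exact: is_derive_line.
  have D2 := is_deriveZ (toC t ^+ 2 * L) (is_derive_id (toC s) 1).
  have := is_deriveB (is_deriveB D1 D0) D2.
  rewrite (_ : _ - _ - _ = phi); last first.
    by apply/funext => z; rewrite /phi !fctE/= [X in _ - X]mulrC.
  move=> H; apply: is_derive_eq H _.
  by rewrite /dphi /GRing.scale/= mulr1 !mulrBr expr2 mulrA.
have Mphi (s : R) : 0 <= s <= 1 -> `|dphi (toC s)| <= toC t ^+ 2 * e.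
  move=> s01; rewrite (_ : toC t ^+ 2 * e = toC t * (toC t * e)); last first.
    by rewrite mulrA -expr2.
  rewrite /dphi normrM Et.
  apply: ler_wpM2l; first by rewrite toC_ge0 ltW.
  set y := x + toC s *: (toC t *: u).
  pose psi r := 'D_u f (y + r *: (toC t *: w)) - r * (toC t * L).
  pose dpsi r := toC t * ('D_w (fun y => 'D_u f y) (y + r *: (toC t *: w)) - L).
  have dQ (r : R) : 0 <= r <= 1 -> is_derive (toC r) 1 psi (dpsi (toC r)).
    move=> r01; have [Ar _] := dA _ (inB s r s01 r01).
    have D1 : is_derive (toC r) 1 (fun z => 'D_u f (y + z *: (toC t *: w)))
      (toC t * 'D_w (fun y => 'D_u f y) (y + toC r *: (toC t *: w))).
      have dfs := smooth_on_differentiable sDu Ar.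
      rewrite -(deriveZdir w (toC t) dfs).
      exact: (@is_derive_line (fun y => 'D_u f y)).
    have D2 := is_deriveZ (toC t * L) (is_derive_id (toC r) 1).
    have := is_deriveB D1 D2.
    rewrite (_ : _ - _ = psi); last first.
      by apply/funext => z; rewrite /psi !fctE/= [X in _ - X]mulrC.
    move=> H; apply: is_derive_eq H _.
    by rewrite /dpsi /GRing.scale/= mulr1 !mulrBr.
  have Mpsi (r : R) : 0 <= r <= 1 -> `|dpsi (toC r)| <= toC t * e.
    move=> r01; have [_ Hr] := dA _ (inB s r s01 r01).
    rewrite /dpsi normrM Et; apply: ler_wpM2l; first by rewrite toC_ge0 ltW.
    by rewrite distrC.
  have := mean_value dQ Mpsi l11.
  by rewrite /psi toC1 scale1r scale0r addr0 segment_ends.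
have := mean_value dP Mphi l11.
by rewrite /phi toC1 !scale1r !scale0r !addr0 segment_ends
  second_difference_split.
Unshelve. all: by end_near. Qed.

(** Both mixed derivatives are the limit of the same second difference
    quotient. *)
Lemma derive_comm A f x u w : open A -> smooth_on A f -> A x ->
  'D_w (fun y => 'D_u f y) x = 'D_u (fun y => 'D_w f y) x.
Proof.
move=> oA sf Ax; apply/eqP; rewrite -subr_eq0 -normr_le0.
apply/ler_addgt0Pr => e e0; rewrite add0r.
have e2 : 0 < e / 2 by rewrite divr_gt0.
have S1 := second_difference u w oA sf Ax e2.
have S2 := second_difference w u oA sf Ax e2.
have [t [[t0 H1] H2]] := @filter_ex _ _ (at_right_proper_filter (0 : R)) _
  (filterI (filterI (nbhs_right_gt (0 : R)) S1) S2).
have tt : 0 < toC t ^+ 2 by rewrite exprn_gt0// toC_gt0.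
have : `|toC t ^+ 2 * ('D_w (fun y => 'D_u f y) x - 'D_u (fun y => 'D_w f y) x)|
    <= toC t ^+ 2 * e.
  rewrite (second_difference_sub (f (x + toC t *: u + toC t *: w))
    (f (x + toC t *: u)) (f (x + toC t *: w)) (f x)).
  rewrite (addrAC x (toC t *: w)) in H2.
  exact: (ler_norm_sub_half H2 H1).
by rewrite normrM (gtr0_norm tt) (ler_pM2l tt).
Qed.

End Taylor.
Arguments iterD : simpl never.

(** * Division by a coordinate *)

Lemma quotient_derivative0 (K : numFieldType) (k : nat) (X Y w : K) :
  (X - w * Y) / k`!%:R + w * (Y / (k.+1)`!%:R) =
  (k.+1%:R * X - k%:R * w * Y) / (k.+1)`!%:R.
Proof.
have k0 : (k`!%:R : K) != 0 by rewrite pnatr_eq0 -lt0n fact_gt0.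
have k1 : (k%:R + 1 : K) != 0 by rewrite natr1 pnatr_eq0.
rewrite factS natrM -natr1.
by move: (k`!%:R : K) (k%:R : K) k0 k1 => a b a0 b0; field; rewrite a0 b0.
Qed.

Lemma quotient_derivative (K : fieldType) (k : nat) (u f D w q : K) : u != 0 ->
  D = f / u ^+ k * (k%:R * u ^+ k.-1 * w) + u ^+ k * q ->
  q = (u * D - k%:R * w * f) / u ^+ k.+1.
Proof.
move=> u0 ->; case: k => [|k].
  by rewrite !mul0r mulr0 add0r expr0 mul1r subr0 expr1 mulrC mulKf.
rewrite -pred_Sn !exprS; have : u ^+ k != 0 by rewrite expf_neq0.
by move: (u ^+ k) => v v0; field; rewrite u0 v0.
Qed.

Lemma quotient_remainder (K : numFieldType) (k : nat) (u f a c M b : K) : u != 0 ->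
  `|f - (u ^+ k * a + u ^+ k.+1 * c)| <= `|u| ^+ k.+2 * M ->
  `|f / u ^+ k - (a + u * b)| <= `|u| * (M * `|u| + `|b - c|).
Proof.
move=> u0 H; have uk : u ^+ k != 0 by rewrite expf_neq0.
have -> : f / u ^+ k - (a + u * b) =
    (f - (u ^+ k * a + u ^+ k.+1 * c)) / u ^+ k - u * (b - c).
  by rewrite exprS; move: (u ^+ k) uk => v v0; field.
rewrite (le_trans (ler_normB _ _))// [leRHS]mulrDr; apply: lerD;
  last by rewrite normrM.
rewrite normrM normfV ler_pdivrMr ?normr_gt0// (le_trans H)// normrX.
by rewrite !exprS le_eqVlt; apply/orP; left; apply/eqP; ring.
Qed.

Lemma norm_coord_le (K : numFieldType) n (y : 'rV[K]_n) (j : 'I_n) :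
  `|y 0 j| <= `|y|.
Proof.
rewrite [leRHS]mx_normE -[leLHS]nngE num_le.
exact: (le_bigmax _ (fun ij => `|y ij.1 ij.2|%:nng) (0, j)).
Qed.

Lemma near_neq0 (K : numFieldType) (T : topologicalType) (f : T -> K) x :
  {for x, continuous f} -> f x != 0 -> \forall y \near x, f y != 0.
Proof. by move=> cf fx; exact: cvgr_neq0 cf fx. Qed.

Section Division.
Variables (R : realType) (n : nat) (i : 'I_n) (A : set 'rV[Cx R]_n).
Local Notation V := 'rV[Cx R]_n.
Implicit Types (F G H : V -> Cx R) (y p w : V).
Hypothesis oA : open A.

Local Notation e := (delta_mx 0 i : V).

Lemma ball_rowP p y (d : Cx R) : 0 < d ->
  (ball p d y <-> forall j, `|p 0 j - y 0 j| < d).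
Proof.
move=> d0; split => [[_ H] j|H]; first exact: H.
by split => // a b; rewrite (ord1 a); exact: H.
Qed.

(** The hyperplane where the i-th coordinate is 0 contributes nothing to the
    derivatives of a function that vanishes on it. *)
Lemma derive_tangent G y w : A y -> y 0 i = 0 -> differentiable G y ->
  (forall z, A z -> z 0 i = 0 -> G z = 0) -> 'D_w G y = w 0 i * 'D_e G y.
Proof.
move=> Ay yi dG G0.
rewrite -[X in 'D_X G y](subrK (w 0 i *: e)) deriveDdir// deriveZdir//.
rewrite -[RHS]add0r; congr (_ + _).
set v := w - _.
have vi : v 0 i = 0 by rewrite !mxE !eqxx mulr1 subrr.
have dG0 : differentiable G (y + 0 *: v) by rewrite scale0r addr0.
have := derive_val (is_derive := is_derive_line dG0).
rewrite scale0r addr0 => <-.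
rewrite (@near_eq_derive _ _ _ _ (fun=> 0)) ?derive_cst//.
have cl : {for 0, continuous (fun s : Cx R => y + s *: v)}.
  apply: differentiable_continuous; apply: differentiableD.
    exact: differentiable_cst.
  by apply: differentiableZl; exact: ex_diff.
have : \forall z \near y + 0 *: v, A z.
  by rewrite scale0r addr0; exact: (open_near oA Ay).
move=> /cl H; have {}H : \forall s \near (0 : Cx R), A (y + s *: v) by exact: H.
apply: filterS H => s As; apply: G0 => //.
by rewrite mxE yi add0r mxE vi mulr0.
Qed.

Lemma iterDM F j y : smooth_on A F -> A y ->
  iterD e j (fun z : V => z 0 i * F z) y =
  y 0 i * iterD e j F y + j%:R * iterD e j.-1 F y.
Proof.
move=> sF; elim: j y => [|j IH] y Ay; first by rewrite mul0r addr0.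
transitivity ('D_e (fun z : V => z 0 i * iterD e j F z
                 + j%:R * iterD e j.-1 F z) y).
  exact: eq_derive_open oA Ay IH.
have dc : differentiable (fun z : V => z 0 i) y by exact: differentiable_coord.
have dj k : differentiable (iterD e k F) y.
  by apply: smooth_on_differentiable Ay; exact: smooth_on_iterD.
have dM : differentiable (fun z : V => z 0 i * iterD e j F z) y.
  exact: differentiableM.
have dM' : differentiable (fun z : V => j%:R * iterD e j.-1 F z) y.
  by apply: differentiableM => //; exact: differentiable_cst.
transitivity ('D_e (fun z : V => z 0 i * iterD e j F z) y +
   'D_e (fun z : V => j%:R * iterD e j.-1 F z) y).
  by apply: deriveD; exact: diff_derivable.
rewrite deriveMc//.
have -> : 'D_e (fun z : V => z 0 i * iterD e j F z) y =
    y 0 i * iterD e j.+1 F y + iterD e j F y.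
  transitivity (y 0 i *: 'D_e (iterD e j F) y +
    iterD e j F y *: 'D_e (fun z : V => z 0 i) y).
    by apply: deriveM; exact: diff_derivable.
  by rewrite derive_coord mxE !eqxx; congr (_ + _); exact: mulr1.
rewrite -addrA; congr (_ + _).
case: j {IH dM dM'} => [|j].
  by rewrite /= mul0r addr0 mul1r.
by rewrite -[in RHS]natr1 mulrDl mul1r addrC.
Qed.

Lemma iterDB F G (c : Cx R) j y : smooth_on A F -> smooth_on A G -> A y ->
  iterD e j (fun z => F z - c * G z) y = iterD e j F y - c * iterD e j G y.
Proof.
move=> sF sG; elim: j y => [|j IH] y Ay; first exact: erefl.
transitivity ('D_e (fun z : V => iterD e j F z - c * iterD e j G z) y).
  exact: eq_derive_open oA Ay IH.
have dF : differentiable (iterD e j F) y.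
  by apply: smooth_on_differentiable Ay; exact: smooth_on_iterD.
have dG : differentiable (iterD e j G) y.
  by apply: smooth_on_differentiable Ay; exact: smooth_on_iterD.
have dcG : differentiable (fun z => c * iterD e j G z) y.
  by apply: differentiableM => //; exact: differentiable_cst.
transitivity ('D_e (iterD e j F) y - 'D_e (fun z => c * iterD e j G z) y).
  by apply: deriveB; exact: diff_derivable.
by rewrite deriveMc.
Qed.

Lemma iterD_derive F w j y : smooth_on A F -> A y ->
  iterD e j (fun z => 'D_w F z) y = 'D_w (iterD e j F) y.
Proof.
move=> sF; elim: j y => [|j IH] y Ay; first exact: erefl.
transitivity ('D_e (fun z => 'D_w (iterD e j F) z) y).
  exact: eq_derive_open oA Ay IH.
by apply: (derive_comm _ _ oA) Ay; exact: smooth_on_iterD.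
Qed.

Let vanishing k F :=
  forall j y, (j < k)%N -> A y -> y 0 i = 0 -> iterD e j F y = 0.

(** On the hyperplane, the quotient F / u^k by the i-th coordinate u has the value
    predicted by Taylor's formula. *)
Let quot k F y : Cx R :=
  if y 0 i == 0 then iterD e k F y / k`!%:R else F y / y 0 i ^+ k.

(** The numerator of 'D_w (F / u^k) over u^(k+1): quotients by powers of u of
    functions that vanish to the same order are stable under differentiation. *)
Let next k w F (z : V) : Cx R := z 0 i * 'D_w F z - (k%:R * w 0 i) * F z.

Let smooth_next k w F : smooth_on A F -> smooth_on A (next k w F).
Proof.
move=> sF; apply: smooth_onB => //; apply: smooth_onM => //.
- exact: smooth_on_coord.
- exact: smooth_on_derive.
- exact: smooth_on_cst.
Qed.

Let iterD_next k w F j y : smooth_on A F -> A y -> y 0 i = 0 ->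
  iterD e j (next k w F) y =
  j%:R * iterD e j.-1 (fun z => 'D_w F z) y - (k%:R * w 0 i) * iterD e j F y.
Proof.
move=> sF Ay yi.
have sD := smooth_on_derive w sF.
have sM : smooth_on A (fun z : V => z 0 i * 'D_w F z).
  by apply: smooth_onM => //; exact: smooth_on_coord.
rewrite (iterDB (k%:R * w 0 i) j sM sF Ay).
by rewrite (iterDM j sD Ay) yi mul0r add0r.
Qed.

Let vanishing_next k w F : smooth_on A F -> vanishing k F ->
  vanishing k.+1 (next k w F).
Proof.
move=> sF vF j y jk Ay yi; rewrite iterD_next//.
case: j jk => [|j] jk.
  rewrite mul0r sub0r; case: k vF {jk} => [|k] vF.
    by rewrite mul0r mul0r oppr0.
  by rewrite vF// mulr0 oppr0.
rewrite iterD_derive//= (@derive_tangent _ _ w)//; first last.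
- by move=> z Az zi; exact: vF.
- by apply: smooth_on_differentiable Ay; exact: smooth_on_iterD.
rewrite -[X in _ * (_ * X)]/(iterD e j.+1 F y).
move: jk; rewrite ltnS leq_eqVlt => /orP[/eqP <-|jk].
  by rewrite mulrA subrr.
have := vF _ _ jk Ay yi; rewrite iterDS => ->.
by rewrite !mulr0 subrr.
Qed.

Let pr y : V := y - y 0 i *: e.

Let pr_i y : pr y 0 i = 0.
Proof. by rewrite !mxE !eqxx mulr1 subrr. Qed.

Let differentiable_pr y : differentiable pr y.
Proof.
apply: differentiableB; first exact: ex_diff.
by apply: differentiableZl; exact: differentiable_coord.
Qed.

(** Taylor's formula at the projection of y to the hyperplane: the terms of order
    k and k + 1 remain, and the error is of order k + 2. *)
Let quot_approx k F p (eps : Cx R) : smooth_on A F -> vanishing k F ->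
  A p -> p 0 i = 0 -> 0 < eps ->
  nbhs (p : V) (fun y : V =>
    `|quot k F y - (iterD e k F (pr y) / k`!%:R +
        y 0 i * (iterD e k.+1 F p / (k.+1)`!%:R))| <= eps * `|y - p|).
Proof.
move=> sF vF Ap pi0 eps0.
have prp : pr p = p by rewrite /pr pi0 scale0r subr0.
pose M := `|iterD e k.+2 F p| + 1.
have M0 : 0 < M by rewrite ltr_wpDl.
have /nbhs_ballP[d /= d0 dA] : \forall z \near p, A z /\ `|iterD e k.+2 F z| <= M.
  apply: filterI; first exact: (open_near oA Ap).
  have c2 : {for p, continuous (fun z => `|iterD e k.+2 F z|)}.
    exact: (cvg_norm (smooth_on_continuous (smooth_on_iterD e k.+2 sF) Ap)).
  have : \forall z \near p, `| `|iterD e k.+2 F p| - `|iterD e k.+2 F z| | < 1.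
    by move/cvgrPdist_lt : c2; apply.
  apply: filterS => z; rewrite distrC => /ltW H.
  rewrite -lerBlDl; apply: le_trans H; exact: real_ler_norm.
have e2 : 0 < eps / 2 by rewrite divr_gt0.
have Hc : \forall y \near p, `|iterD e k.+1 F p / (k.+1)`!%:R -
    iterD e k.+1 F (pr y) / (k.+1)`!%:R| <= eps / 2.
  suff : {for p, continuous (fun y => iterD e k.+1 F (pr y) / (k.+1)`!%:R)}.
    by move/cvgrPdist_le => /(_ _ e2); rewrite prp.
  apply: differentiable_continuous; apply: differentiableM; last first.
    exact: differentiable_cst.
  apply: differentiable_comp; first exact: differentiable_pr.
  by rewrite prp; apply: smooth_on_differentiable Ap; exact: smooth_on_iterD.
have Hu : \forall y \near p, M * `|(y : V) 0 i| <= eps / 2.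
  have : \forall y \near p, `|p 0 i - (y : V) 0 i| < eps / 2 / M.
    suff : {for p, continuous (fun y : V => y 0 i)}.
      by move/cvgrPdist_lt; apply; rewrite divr_gt0.
    exact: coord_continuous.
  by apply: filterS => y; rewrite pi0 sub0r normrN ltr_pdivlMr// mulrC => /ltW.
near=> y.
have [yi|yi] := eqVneq (y 0 i) 0.
  by rewrite /quot yi eqxx mul0r addr0 /pr yi scale0r subr0 subrr normr0
    mulr_ge0// ltW.
rewrite /quot (negbTE yi).
have yd : ball p d y by near: y; exact: nbhsx_ballx.
have seg (t : R) : 0 <= t <= 1 -> ball p d (pr y + toC t *: (y 0 i *: e)).
  move=> /andP[t0 t1]; apply/(ball_rowP _ _ d0) => j.
  have /(_ j) yj := (ball_rowP _ _ d0).1 yd.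
  rewrite !mxE eqxx/=; have [->|ji] := eqVneq j i.
    rewrite !mulr1 subrr add0r pi0 sub0r normrN normrM norm_toC (ger0_norm t0).
    have := (ball_rowP _ _ d0).1 yd i; rewrite pi0 sub0r normrN.
    by apply: le_lt_trans; rewrite ler_piMl// -toC1 toC_le.
  by rewrite !mulr0 subr0 addr0.
have Apr : A (pr y).
  have [|+ _] := dA (pr y + toC 0 *: (y 0 i *: e)).
    by apply: seg; rewrite lexx ler01.
  by rewrite toC0 scale0r addr0.
have TM (t : R) : 0 <= t <= 1 ->
  `|iterD (y 0 i *: e) k.+2 F (pr y + toC t *: (y 0 i *: e))| <=
    `|y 0 i| ^+ k.+2 * M.
  move=> t01; have [At Mt] := dA _ (seg t t01).
  rewrite (iterDZ e (y 0 i) k.+2 oA sF At) normrM normrX; exact: ler_wpM2l.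
have := taylor sF (fun t t01 => (dA _ (seg t t01)).1) TM.
rewrite (_ : pr y + y 0 i *: e = y) ?subrK//.
rewrite (eq_bigr (fun j : 'I_k.+2 => y 0 i ^+ j * (iterD e j F (pr y) / j`!%:R)));
  last by move=> j _; rewrite (iterDZ e (y 0 i) j oA sF Apr) mulrA.
rewrite !big_ord_recr/= big1 ?add0r; last first.
  by move=> j _; rewrite (vF _ _ _ Apr (pr_i y))// mul0r mulr0.
move=> HT; apply: (le_trans (quotient_remainder
  (iterD e k.+1 F p / (k.+1)`!%:R) yi HT)).
have yp : `|y 0 i| <= `|y - p|.
  by have := norm_coord_le (y - p) i; rewrite !mxE pi0 subr0.
rewrite [X in X <= _]mulrC.
apply: (@le_trans _ _ (eps * `|y 0 i|)); last first.
  by apply: ler_wpM2l; [exact: ltW|exact: yp].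
apply: ler_wpM2r => //; rewrite [eps]splitr; apply: lerD.
  by near: y.
by near: y.
Unshelve. all: by end_near. Qed.

Let derive_quot k F p : smooth_on A F -> vanishing k F -> A p ->
  differentiable (quot k F) p /\
  forall w, 'D_w (quot k F) p = quot k.+1 (next k w F) p.
Proof.
move=> sF vF Ap; have [pi0|pi0] := eqVneq (p 0 i) 0; last first.
  have nz : \forall y \near p, (y : V) 0 i != 0.
    suff c : {for p, continuous (fun y : V => y 0 i)}.
      exact: near_neq0 c pi0.
    exact: coord_continuous.
  have dc : differentiable (fun y : V => y 0 i) p by exact: differentiable_coord.
  have dF := smooth_on_differentiable sF Ap.
  have dX : differentiable (fun y : V => y 0 i ^+ k) p.
    exact: (smooth_on_differentiable (smooth_onX k oA (smooth_on_coord i oA)) Ap).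
  have dq : differentiable (quot k F) p.
    apply: (@near_eq_differentiable _ _ _ (fun y : V => F y * (y 0 i ^+ k)^-1)).
      by apply: filterS nz => y yi; rewrite /quot (negbTE yi).
    apply: differentiableM => //; apply: differentiableV => //.
    exact: expf_neq0.
  split => // w.
  have : 'D_w F p = 'D_w (fun y : V => quot k F y * y 0 i ^+ k) p.
    apply: near_eq_derive; apply: filterS nz => y yi.
    by rewrite /quot (negbTE yi) divfK// expf_neq0.
  have -> : 'D_w (fun y : V => quot k F y * y 0 i ^+ k) p =
     quot k F p * 'D_w (fun y : V => y 0 i ^+ k) p +
     p 0 i ^+ k * 'D_w (quot k F) p.
    by apply: deriveM; exact: diff_derivable.
  have -> : 'D_w (fun y : V => y 0 i ^+ k) p = k%:R * p 0 i ^+ k.-1 * w 0 i.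
    have := deriveX k (diff_derivable (v := w) dc).
    by rewrite exprfctE derive_coord.
  have qp m G : quot m G p = G p / p 0 i ^+ m by rewrite /quot (negbTE pi0).
  by rewrite !qp => DF; exact: quotient_derivative DF.
pose T y := iterD e k F (pr y) / k`!%:R +
        y 0 i * (iterD e k.+1 F p / (k.+1)`!%:R).
have prp : pr p = p by rewrite /pr pi0 scale0r subr0.
have dk j : differentiable (iterD e j F) p.
  by apply: smooth_on_differentiable Ap; exact: smooth_on_iterD.
have dkp : differentiable (fun y => iterD e k F (pr y)) p.
  by apply: differentiable_comp; [exact: differentiable_pr|rewrite prp].
have d1 : differentiable (fun y => iterD e k F (pr y) / k`!%:R) p.
  by apply: differentiableM => //; exact: differentiable_cst.
have d2 : differentiable (fun y : V => y 0 i *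
    (iterD e k.+1 F p / (k.+1)`!%:R)) p.
  apply: differentiableM; [exact: differentiable_coord|].
  exact: differentiable_cst.
have dT : differentiable T p by exact: differentiableD.
have qT : quot k F p = T p.
  by rewrite /quot /T pi0 eqxx prp mul0r addr0.
have [dq Edq] := differentiable_approx dT qT
  (fun eps eps0 => quot_approx sF vF Ap pi0 eps0).
split; [exact: dq|move=> w].
have -> : 'D_w (quot k F) p = 'D_w T p.
  have E1 := deriveE w dq; have E2 := deriveE w dT.
  by rewrite Edq in E1; rewrite E1 E2.
have -> : 'D_w T p = 'D_w (fun y => iterD e k F (pr y) / k`!%:R) p +
    'D_w (fun y : V => y 0 i * (iterD e k.+1 F p / (k.+1)`!%:R)) p.
  by apply: deriveD; exact: diff_derivable.
have -> : 'D_w (fun y : V => y 0 i * (iterD e k.+1 F p / (k.+1)`!%:R)) p =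
    w 0 i * (iterD e k.+1 F p / (k.+1)`!%:R).
  rewrite -[in RHS](derive_coord i w p) [RHS]mulrC.
  have dc : differentiable (fun y : V => y 0 i) p by exact: differentiable_coord.
  rewrite -(deriveMc w (iterD e k.+1 F p / (k.+1)`!%:R) dc).
  by congr ('D_w _ p); apply/funext => y; rewrite mulrC.
have -> : 'D_w (fun y => iterD e k F (pr y) / k`!%:R) p =
    ('D_w (iterD e k F) p - w 0 i * iterD e k.+1 F p) / k`!%:R.
  transitivity (k`!%:R^-1 * 'D_w (fun y => iterD e k F (pr y)) p).
    rewrite -(deriveMc w (k`!%:R^-1) dkp).
    by congr ('D_w _ p); apply/funext => y; rewrite mulrC.
  rewrite mulrC; congr (_ / _).
  transitivity ('D_(pr w) (iterD e k F) p); last first.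
    rewrite /pr (deriveDdir w _ (dk k)) -scaleNr (deriveZdir e _ (dk k)).
    by rewrite mulNr.
  have E0 (v : V) : p + 0 *: v = p by rewrite scale0r addr0.
  have dkp0 : differentiable (fun y => iterD e k F (pr y)) (p + 0 *: w).
    by rewrite E0; exact: dkp.
  have dk0 : differentiable (iterD e k F) (p + 0 *: pr w).
    by rewrite E0; exact: dk.
  have := derive_val (is_derive := is_derive_line dkp0).
  have := derive_val (is_derive := is_derive_line dk0).
  rewrite !E0 => <- <-.
  have Hpr (s : Cx R) : pr (p + s *: w) = p + s *: pr w.
    by rewrite /pr !mxE pi0 add0r scalerBr scalerA addrA.
  by under eq_fun => s do rewrite Hpr.
rewrite quotient_derivative0.
have -> : quot k.+1 (next k w F) p =
    iterD e k.+1 (next k w F) p / (k.+1)`!%:R by rewrite /quot pi0 eqxx.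
congr (_ / _).
by rewrite (iterD_next k w k.+1 sF Ap pi0) -pred_Sn (iterD_derive w k sF Ap).
Qed.

Let smooth_quot k F : smooth_on A F -> vanishing k F -> smooth_on A (quot k F).
Proof.
move=> + + m; elim: m k F => [|m IH] k F sF vF; split => //.
- by move=> p Ap; have [] := derive_quot sF vF Ap.
- by move=> p Ap; have [] := derive_quot sF vF Ap.
move=> w.
apply: (eq_diff_times oA _ (IH k.+1 (next k w F) _ _)).
- by move=> p Ap; have [_ ->] := derive_quot sF vF Ap.
- exact: smooth_next.
- exact: vanishing_next.
Qed.

(** F / u is differentiable, its derivatives are quotients G / u^2 with G vanishing
    to order 2, and so on: each differentiation raises both orders by one. *)
Lemma smooth_division F : smooth_on A F ->
  (forall y, A y -> y 0 i = 0 -> F y = 0) ->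
  exists2 g, smooth_on A g & forall y, A y -> F y = y 0 i * g y.
Proof.
move=> sF F0.
have vF : vanishing 1 F by case=> // y _; exact: F0.
exists (quot 1 F); first exact: smooth_quot.
move=> y Ay; rewrite /quot; have [yi|yi] := eqVneq (y 0 i) 0.
  by rewrite yi mul0r F0.
by rewrite expr1 mulrC divfK.
Qed.

End Division.

(** * Maximum principle and identity theorem *)

(** Averaging over the fourth roots of unity kills the cross terms of a
    polynomial of degree 2. *)
Lemma four_points (C : numClosedFieldType) (X Y Z : C) :
  `|X + Y + Z| ^+ 2 + `|X + 'i * Y - Z| ^+ 2 + `|X - Y + Z| ^+ 2
    + `|X - 'i * Y - Z| ^+ 2 = 4 * (`|X| ^+ 2 + `|Y| ^+ 2 + `|Z| ^+ 2).
Proof.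
have i2 : ('i : C) * 'i = -1 by rewrite -expr2 sqrCi.
rewrite !normCK !(rmorphD, rmorphN, rmorphM) /= conjCi.
move: ('i : C) i2 (X^*) (Y^*) (Z^*) => i i2 x y z.
transitivity (2 * ((X + Z) * (x + z) + Y * y) + 2 * ((X - Z) * (x - z)
  - (i * i) * (Y * y))); first by ring.
by rewrite i2; ring.
Qed.

Lemma norm_add_sqr (K : numFieldType) (P E B N : K) :
  `|P| <= B -> `|E| <= N -> N <= 1 ->
  `|P - E| ^+ 2 <= `|P| ^+ 2 + (2 * B + 1) * N.
Proof.
move=> PB EN N1; have N0 : 0 <= N by apply: le_trans EN.
apply: (@le_trans _ _ ((`|P| + `|E|) ^+ 2)).
  by rewrite ler_sqr ?nnegrE ?addr_ge0// ler_normB.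
rewrite sqrrD -addrA lerD2l mulrDl mul1r; apply: lerD.
  rewrite -mulr_natl -mulrA ler_wpM2l// ler_pM//.
rewrite expr2 (le_trans (ler_pM _ _ EN EN))// -[leRHS]mulr1.
exact: ler_wpM2l.
Qed.

Section OneVariable.
Variable R : realType.
Local Notation C := (Cx R).
Implicit Types (z s : C) (A : set C) (phi psi : C -> C) (r d : C).

Lemma continuous_Re_norm (T : topologicalType) (f : T -> C) x :
  {for x, continuous f} -> {for x, continuous (fun y => complex.Re `|f y|)}.
Proof.
move=> cf; apply: (@continuous_comp _ _ _ (fun y => `|f y|)).
  exact: (cvg_norm cf).
exact: continuous_Re.
Qed.

Lemma compact_disc (r : R) : compact [set z : C | `|z| <= toC r].
Proof.
pose g (p : R * R) : C := toC p.1 + 'i%C * toC p.2.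
have cg : continuous g.
  move=> p; apply: cvgD.
    by apply: (@continuous_comp _ _ _ fst); [exact: cvg_fst|exact: continuous_toC].
  apply: cvgM; first exact: cvg_cst.
  by apply: (@continuous_comp _ _ _ snd); [exact: cvg_snd|exact: continuous_toC].
have cS : compact (`[- r, r]%classic `*` `[- r, r]%classic).
  by apply: compact_setX; exact: segment_compact.
have cI : compact (g @` (`[- r, r]%classic `*` `[- r, r]%classic)).
  by apply: continuous_compact cS; exact: continuous_subspaceT.
apply: subclosed_compact cI _.
  rewrite (_ : [set z : C | _] =
      (fun z : C => complex.Re `|z|) @^-1` [set x : R | x <= r]).
    apply: closed_comp; last exact: closed_le.
    by move=> z _; apply: continuous_Re_norm; exact: cvg_id.
  have E (z : C) : toC (complex.Re `|z|) = `|z| by rewrite toC_Re// normr_real.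
  by apply/seteqP; split => z H; [rewrite /= -toC_le E|rewrite /= -(E z) toC_le].
move=> z /= zr; exists (complex.Re z, complex.Im z); last first.
  by rewrite /g /= [RHS]complexE.
split; rewrite /= in_itv/= -ler_norml -toC_le; apply: le_trans zr.
  exact: normRe.
rewrite -normrN -ReiNIm; apply: (le_trans (normRe _)).
by rewrite normrM [`|'i%C|]normc_def/= expr0n/= expr1n add0r sqrtr1 mulr1.
Qed.

Lemma smooth_on_id A : open A -> smooth_on A (fun z : C => z).
Proof.
move=> oA; case=> [|k]; split => //; try by move=> x _; exact: ex_diff.
move=> v; apply: (eq_diff_times oA _ (diff_times_cst k A v)) => x _.
by rewrite derive_id.
Qed.

Lemma smooth_onU (V W : normedModType C) (A B : set V) (f : V -> W) :
  smooth_on A f -> smooth_on B f -> smooth_on (A `|` B) f.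
Proof.
move=> sA sB k; elim: k f sA sB => [|k IH] f sA sB; split => //.
- by move=> x [/(smooth_on_differentiable sA)|/(smooth_on_differentiable sB)].
- by move=> x [/(smooth_on_differentiable sA)|/(smooth_on_differentiable sB)].
- by move=> v; apply: IH; exact: smooth_on_derive.
Qed.

(** The mean of |phi|^2 + eps |z|^2 over the four points c + i^k t exceeds the value
    at c by at least eps t^2, up to an error of order t^3. *)
Lemma max_modulus_interior phi A (c eps : C) : open A -> smooth_on A phi ->
  A c -> 0 < eps ->
  ~ (\forall z \near c, `|phi z| ^+ 2 + eps * `|z| ^+ 2 <=
                       `|phi c| ^+ 2 + eps * `|c| ^+ 2).
Proof.
move=> oA sphi Ac eps0 cmax.
pose B := `|phi c| + 1; pose K := `|iterD (1 : C) 3 phi c| + 1.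
have B0 : 0 <= B by rewrite addr_ge0.
have K0 : 0 < K by rewrite ltr_wpDl.
have near_le (f : C -> C) : {for c, continuous f} ->
    \forall z \near c, `|f z| <= `|f c| + 1.
  move=> cf; have : \forall z \near c, `|f c - f z| < 1.
    by move/cvgrPdist_lt : cf; apply.
  apply: filterS => z H; rewrite -lerBlDl; apply: le_trans (ltW H).
  by rewrite distrC; exact: lerB_dist.
have Bphi := near_le _ (smooth_on_continuous sphi Ac).
have K3 := near_le _ (smooth_on_continuous (smooth_on_iterD (1 : C) 3 sphi) Ac).
have /nbhs_ballP[d /= d0 dA] :
    \forall z \near c, (A z /\ `|iterD (1 : C) 3 phi z| <= K) /\
     (`|phi z| <= B /\ `|phi z| ^+ 2 + eps * `|z| ^+ 2 <=
                       `|phi c| ^+ 2 + eps * `|c| ^+ 2).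
  apply: filterI; apply: filterI => //.
  exact: (open_near oA Ac).
pose W := (2 * B + 1) * K.
have W0 : 0 < W by rewrite mulr_gt0// ltr_wpDl// mulr_ge0.
have [d' d'0 dE] := gt0_toC d0.
have [e' e'0 eE] := gt0_toC eps0.
have [W' W'0 WE] := gt0_toC W0.
have [K' K'0 KE] := gt0_toC K0.
pose t' := Num.min (Num.min (d' / 2) (e' / W' / 2)) (Num.min 1 (1 / K')).
have t'0 : 0 < t' by rewrite !lt_min !divr_gt0//= ltr01.
have t'd : t' < d'.
  apply: (@le_lt_trans _ _ (d' / 2)); first by rewrite !ge_min lexx.
  by rewrite ltr_pdivrMr// ltr_pMr// ltr1n.
have t'e : W' * t' < e'.
  rewrite mulrC -ltr_pdivlMr//.
  apply: (@le_lt_trans _ _ (e' / W' / 2)); first by rewrite !ge_min lexx orbT.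
  by rewrite ltr_pdivrMr// ltr_pMr ?divr_gt0// ltr1n.
have t'1 : t' <= 1 by rewrite !ge_min lexx !orbT.
have t'K : K' * t' <= 1.
  by rewrite mulrC -ler_pdivlMr// !ge_min lexx !orbT.
pose t := toC t'.
have t0 : 0 < t by rewrite toC_gt0.
have Et : `|t| = t by rewrite gtr0_norm.
have t1 : t <= 1 by rewrite -toC1 toC_le.
pose a j := iterD (1 : C) j phi c / j`!%:R.
pose p h := a 0%N + a 1%N * h + a 2%N * h ^+ 2.
have Kt : K * t ^+ 3 <= 1.
  apply: (@le_trans _ _ (K * t)).
    apply: ler_wpM2l; first exact: ltW.
    rewrite exprS -[leRHS]mulr1; apply: ler_wpM2l; first exact: ltW.
    by apply: exprn_ile1 => //; exact: ltW.
  by rewrite KE -toCM -toC1 toC_le.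
have bound h : `|h| = t ->
    `|p h| ^+ 2 <= `|phi c| ^+ 2 + eps * `|c| ^+ 2 - eps * `|c + h| ^+ 2
      + W * t ^+ 3.
  move=> hE.
  have seg (s : R) : 0 <= s <= 1 -> ball c d (c + toC s *: (h *: (1 : C))).
    move=> /andP[s0 s1]; rewrite -ball_normE /ball_/= opprD addNKr normrN.
    rewrite normrM norm_toC (ger0_norm s0) [h *: 1]mulr1 hE dE -toCM toC_lt.
    by apply: le_lt_trans t'd; rewrite ler_piMl// ltW.
  have TM (s : R) : 0 <= s <= 1 ->
      `|iterD (h *: (1 : C)) 3 phi (c + toC s *: (h *: (1 : C)))| <= K * t ^+ 3.
    move=> s01; have [[As Ks] _] := dA _ (seg s s01).
    rewrite (iterDZ (1 : C) h 3 oA sphi As) normrM normrX hE mulrC.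
    by apply: ler_wpM2r => //; rewrite exprn_ge0// ltW.
  have := taylor sphi (fun (s : R) s01 => (dA _ (seg s s01)).1.1) TM.
  rewrite !big_ord_recr big_ord0/= add0r.
  rewrite !(iterDZ (1 : C) h _ oA sphi Ac) expr0 mul1r expr1 [h *: 1]mulr1.
  set E := (X in `|X| <= _); move=> HE.
  have -> : p h = phi (c + h) - E.
    rewrite /E subKr /p /a; congr (_ + _ + _).
      by rewrite mulrC mulrA.
    by rewrite mulrC mulrA.
  have [|_ [Bh gh]] := dA (c + h).
    by have := seg 1; rewrite toC1 scale1r [h *: 1]mulr1; apply; rewrite ler01 lexx.
  apply: (le_trans (norm_add_sqr Bh HE Kt)).
  rewrite /W -mulrA lerD2r lerBrDr.
  exact: gh.
have h1 : `|t| = t := Et.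
have h2 : `|'i * t| = t by rewrite normrM normCi mul1r.
have h3 : `|- t| = t by rewrite normrN.
have h4 : `|- ('i * t)| = t by rewrite normrN.
have := lerD (lerD (lerD (bound _ h1) (bound _ h2)) (bound _ h3)) (bound _ h4).
have i2 : ('i : C) ^+ 2 = -1 by exact: sqrCi.
have -> : p t = a 0%N + a 1%N * t + a 2%N * t ^+ 2 by [].
have -> : p ('i * t) = a 0%N + 'i * (a 1%N * t) - a 2%N * t ^+ 2.
  by rewrite /p exprMn i2 mulN1r mulrN mulrCA.
have -> : p (- t) = a 0%N - a 1%N * t + a 2%N * t ^+ 2.
  by rewrite /p sqrrN mulrN.
have -> : p (- ('i * t)) = a 0%N - 'i * (a 1%N * t) - a 2%N * t ^+ 2.
  by rewrite /p sqrrN exprMn i2 mulN1r !mulrN mulrCA.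
rewrite four_points.
have F := four_points c t 0; rewrite !addr0 !subr0 normr0 expr0n/= addr0 Et in F.
set X := (leRHS); have -> : X = 4 * (`|phi c| ^+ 2 - eps * t ^+ 2 + W * t ^+ 3).
  rewrite /X; transitivity (4 * (`|phi c| ^+ 2 + eps * `|c| ^+ 2 + W * t ^+ 3) -
    eps * (`|c + t| ^+ 2 + `|c + 'i * t| ^+ 2 + `|c - t| ^+ 2 + `|c - 'i * t| ^+ 2)).
    by ring.
  by rewrite F; ring.
rewrite ler_pM2l// {1}/a divr1.
have -> : iterD (1 : C) 0 phi c = phi c by [].
move=> H.
have {}H : eps * t ^+ 2 <= W * t ^+ 3.
  have : `|phi c| ^+ 2 <= `|phi c| ^+ 2 - eps * t ^+ 2 + W * t ^+ 3.
    by apply: le_trans H; rewrite -addrA lerDl addr_ge0// exprn_ge0.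
  by rewrite -addrA lerDl addrC subr_ge0.
have : eps <= W * t.
  by rewrite -(ler_pM2r (exprn_gt0 2 t0)) -mulrA -exprS.
by rewrite eE WE -toCM toC_le leNgt t'e.
Qed.

(** The maximum of |phi|^2 + eps |z|^2 on the disc lies on the circle; let eps
    tend to 0. *)
Lemma max_modulus phi A (r : R) (M : C) : open A -> smooth_on A phi -> 0 < r ->
  (forall z, `|z| <= toC r -> A z) ->
  (forall z, `|z| = toC r -> `|phi z| <= M) ->
  forall z, `|z| <= toC r -> `|phi z| <= M.
Proof.
move=> oA sphi r0 rA phiM z zr.
have M0 : 0 <= M.
  by apply: le_trans (phiM (toC r) _) => //; rewrite norm_toC gtr0_norm.
suff : `|phi z| ^+ 2 <= M ^+ 2 by rewrite ler_sqr ?nnegrE.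
apply/ler_addgt0Pr => e e0.
have r20 : 0 < toC r ^+ 2 by rewrite exprn_gt0// toC_gt0.
pose eps := e / toC r ^+ 2.
have eps0 : 0 < eps by rewrite divr_gt0.
pose g z := `|phi z| ^+ 2 + eps * `|z| ^+ 2.
have gr w : g w \is Num.real.
  apply: ger0_real; apply: addr_ge0; first exact: exprn_ge0.
  by apply: mulr_ge0; [exact: ltW|exact: exprn_ge0].
have [||c] := compact_EVT_max (f := fun z : C => complex.Re (g z)) _
  (@compact_disc r).
- by exists 0; rewrite /= normr0 toC_ge0 ltW.
- apply/continuous_in_subspaceT => w; rewrite inE /= => wr.
  apply: (@continuous_comp _ _ _ g); last exact: continuous_Re.
  have cphi := smooth_on_continuous sphi (rA _ wr).
  have cid : {for w, continuous (fun w : C => w)} by exact: cvg_id.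
  have sq (f : C -> C) : {for w, continuous f} ->
      {for w, continuous (fun w => `|f w| ^+ 2)}.
    by move=> cf; exact: (cvgM (cvg_norm cf) (cvg_norm cf)).
  exact: (cvgD (sq _ cphi) (cvgM (cvg_cst eps) (sq _ cid))).
rewrite inE/= => cr cmax.
have gmax w : `|w| <= toC r -> g w <= g c.
  move=> wr; rewrite -(toC_Re (gr w)) -(toC_Re (gr c)) toC_le.
  by apply: cmax; rewrite inE.
have : `|phi z| ^+ 2 <= g c.
  apply: le_trans (gmax _ zr); rewrite lerDl mulr_ge0 ?exprn_ge0//.
  exact: ltW.
move=> H; apply: (le_trans H) => {H}.
have [cE|cr'] := eqVneq `|c| (toC r).
  rewrite /g cE /eps divfK ?gt_eqF// lerD2r.
  by rewrite ler_sqr ?nnegrE// phiM.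
exfalso.
have {}cr' : `|c| < toC r by rewrite lt_neqAle cr' cr.
apply: (max_modulus_interior oA sphi (rA _ cr) eps0).
have : \forall w \near c, complex.Re `|w| < r.
  have : complex.Re `|c| < r by rewrite -toC_lt toC_Re ?normr_real.
  move=> cr2; have cc := continuous_Re_norm (x := c) (cvg_id : id @ c --> c).
  by move: (cc _ (open_near (@open_lt _ _) cr2)).
apply: filterS => w wr; apply: gmax.
by rewrite -(toC_Re (normr_real w)) toC_le ltW.
Qed.

Lemma bounded_on_disc phi A (r : R) : open A -> smooth_on A phi -> 0 < r ->
  (forall z, `|z| <= toC r -> A z) ->
  exists2 M : R, 0 < M & forall z, `|z| <= toC r -> `|phi z| <= toC M.
Proof.
move=> oA sphi r0 rA.
have [||c _ cmax] := compact_EVT_max (f := fun z : C => complex.Re `|phi z|) _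
  (@compact_disc r).
- by exists 0; rewrite /= normr0 toC_ge0 ltW.
- apply/continuous_in_subspaceT => w; rewrite inE /= => wr.
  exact: continuous_Re_norm (smooth_on_continuous sphi (rA _ wr)).
exists (complex.Re `|phi c| + 1).
  by rewrite ltr_wpDl// -toC_ge0 toC_Re// normr_real.
move=> z zr; rewrite -(toC_Re (normr_real (phi z))) toC_le.
by apply: (le_trans (cmax z _)); [rewrite inE|rewrite lerDl].
Qed.

(** If phi = z^m psi and |phi| <= M on the disc then |psi| <= M / r^m on the circle,
    hence |phi z| <= M (|z| / r)^m for all m. *)
Lemma flat_eq0 phi A (r : R) : open A -> smooth_on A phi -> 0 < r ->
  (forall z, `|z| <= toC r -> A z) ->
  (forall m, exists2 psi, smooth_on A psi &
     forall z, A z -> phi z = z ^+ m * psi z) ->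
  forall z, `|z| < toC r -> phi z = 0.
Proof.
move=> oA sphi r0 rA flat z zr; apply/eqP/negPn/negP => nz.
have [M M0 phiM] := bounded_on_disc oA sphi r0 rA.
have [q q0 zE] := ge0_toC (normr_ge0 z).
have nz0 : 0 < `|phi z| by rewrite normr_gt0.
have [x x0 xE] := gt0_toC nz0.
have qr : q < r by rewrite -toC_lt -zE.
have [m mx] : exists m, (q / r) ^+ m * M < x.
  have q1 : `|q / r| < 1.
    by rewrite ger0_norm ?divr_ge0// 1?ltW// ltr_pdivrMr// mul1r.
  have xM : 0 < x / M by rewrite divr_gt0.
  have /cvgrPdist_lt/(_ _ xM) := cvg_expr q1.
  move=> [m _ Hm]; exists m; have := Hm m (leqnn m).
  rewrite /= sub0r normrN => H.
  by rewrite -ltr_pdivlMr//; apply: le_lt_trans H; exact: ler_norm.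
have [psi spsi E] := flat m.
have rm0 : 0 < toC r ^+ m by rewrite exprn_gt0// toC_gt0.
have psiM : `|psi z| <= toC M / toC r ^+ m.
  apply: (max_modulus oA spsi r0 rA) (ltW zr) => w wr.
  rewrite ler_pdivlMr// -wr -normrX mulrC -normrM -E; last by apply: rA; rewrite wr.
  by apply: phiM; rewrite wr.
suff : `|phi z| < toC x by rewrite xE ltxx.
apply: le_lt_trans (_ : toC ((q / r) ^+ m * M) < _); last by rewrite toC_lt.
rewrite E; last by apply: rA; exact: ltW.
rewrite normrM normrX zE toCM toCX toCM toCV expr_div_n -mulrA.
rewrite [_ * toC M]mulrC.
by apply: ler_wpM2l => //; rewrite exprn_ge0// toC_ge0.
Qed.

Lemma vanish_disc phi A (r : R) : open A -> smooth_on A phi -> 0 < r ->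
  (forall z, `|z| <= toC r -> A z) -> (\forall z \near (0 : C), phi z = 0) ->
  forall z, `|z| < toC r -> phi z = 0.
Proof.
move=> oA sphi r0 rA /nbhs_ballP[d /= d0 phi0].
apply: (flat_eq0 oA sphi r0 rA) => m.
exists (fun z => phi z * (z ^+ m)^-1); last first.
  move=> z _; have [->|z0] := eqVneq z 0.
    by rewrite phi0 ?mul0r ?mulr0//; exact: ballxx.
  by rewrite mulrCA mulfV ?mulr1// expf_neq0.
have -> : A = (A `&` ball (0 : C) d) `|` (A `&` [set z | z != 0]).
  apply/seteqP; split => [z Az|z [[]|[]]//].
  have [->|z0] := eqVneq z 0; last by right.
  by left; split; [apply: rA; rewrite normr0 toC_ge0 ltW|exact: ballxx].
apply: smooth_onU.
  have oB : open (A `&` ball (0 : C) d).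
    by apply: openI => //; exact: ball_open.
  apply: (eq_smooth_on oB _ (smooth_on_cst _ (0 : C))) => z [_ zd].
  by rewrite phi0// mul0r.
have oB : open (A `&` [set z : C | z != 0]).
  apply: openI => //; rewrite openE => z /= z0.
  exact: (@near_neq0 _ _ (fun z : C => z) z cvg_id z0).
apply: smooth_onM => //; first by apply: smooth_on_sub sphi => z [].
apply: smooth_onV => //.
  by move=> z [_ /= z0]; exact: expf_neq0.
by apply: smooth_onX => //; exact: smooth_on_id.
Qed.

End OneVariable.

Section SeveralVariables.
Variables (R : realType) (n : nat).
Local Notation C := (Cx R).
Local Notation V := 'rV[C]_n.
Implicit Types (f : V -> C) (p q y h : V) (d : C) (A : set V).

Lemma open_line A y h : open A -> open [set s : C | A (y + s *: h)].
Proof.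
move=> oA; apply: (@open_comp _ _ (fun s : C => y + s *: h)) => // s _.
apply: differentiable_continuous; apply: differentiableD.
  exact: differentiable_cst.
by apply: differentiableZl; exact: ex_diff.
Qed.

Lemma smooth_on_line A f y h : open A -> smooth_on A f ->
  smooth_on [set s : C | A (y + s *: h)] (fun s => f (y + s *: h)).
Proof.
move=> oA sf; have oL := @open_line A y h oA.
pose Phi j (s : C) := y 0 j + s * h 0 j.
have E s : y + s *: h = \row_j Phi j s by apply/rowP => j; rewrite !mxE.
have sPhi j : smooth_on [set s : C | A (y + s *: h)] (Phi j).
  apply: smooth_onD => //; first exact: smooth_on_cst.
  by apply: smooth_onM => //; [exact: smooth_on_id|exact: smooth_on_cst].
have := smooth_on_comp oL oA sf sPhi.
have EE : (fun s => f (y + s *: h)) = (fun s => f (\row_j Phi j s)).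
  by apply/funext => s; rewrite E.
by rewrite EE; apply => s /=; rewrite E.
Qed.

(** Propagate the zeros along the complex line from q to y. *)
Lemma vanish_polydisc f p d q : 0 < d -> smooth_on (ball p d) f ->
  ball p (d / 5) q -> (\forall y \near q, f y = 0) ->
  forall y, ball p (d / 5) y -> f y = 0.
Proof.
move=> d0 sf pq fq y py.
have d5 : 0 < d / 5 by rewrite divr_gt0.
have oB : open (ball p d) by exact: ball_open.
pose h := y - q.
(* The line meets the polydisc of radius d in more than the unit disc: this is
   where the factor 5 comes from. *)
have inB (s : C) : `|s| <= toC 2 -> ball p d (q + s *: h).
  move=> s2; apply/(ball_rowP _ _ d0) => j; rewrite !mxE.
  have /(_ j) Hq := (ball_rowP _ _ d5).1 pq.
  have /(_ j) Hy := (ball_rowP _ _ d5).1 py.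
  have -> : p 0 j - (q 0 j + s * (y 0 j - q 0 j)) =
     (p 0 j - q 0 j) + s * ((p 0 j - y 0 j) - (p 0 j - q 0 j)) by ring.
  apply: (le_lt_trans (ler_normD _ _)).
  have -> : d = d / 5 + 2 * (d / 5 + d / 5) by field.
  apply: ltr_leD => //; rewrite normrM; apply: ler_pM => //.
    by rewrite (le_trans s2)// /toC rmorph_nat.
  by apply: (le_trans (ler_normB _ _)); apply: lerD; exact: ltW.
have := @vanish_disc R (fun s => f (q + s *: h)) _ 2 (@open_line _ q h oB)
  (smooth_on_line q h oB sf) _ inB _ 1.
have Eh : q + h = y by rewrite /h addrC subrK.
rewrite scale1r Eh; apply => //.
  have c0 : {for 0, continuous (fun s : C => q + s *: h)}.
    apply: differentiable_continuous; apply: differentiableD.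
      exact: differentiable_cst.
    by apply: differentiableZl; exact: ex_diff.
  have H : \forall z \near q + 0 *: h, f z = 0 by rewrite scale0r addr0; exact: fq.
  exact: (c0 _ H).
by rewrite normr1 -toC1 toC_lt ltr1n.
Qed.

End SeveralVariables.

(** * Functions without zeros off a normal crossing *)

Section MonomialFactorization.
Variables (R : realType) (n : nat) (i0 i1 : 'I_n).
Hypothesis i01 : i0 != i1.
Local Notation C := (Cx R).
Local Notation V := 'rV[C]_n.
Implicit Types (f g : V -> C) (p y : V) (d s : C).

(** The direction of the diagonal u = v, where u and v are the coordinates of
    indices i0 and i1. *)
Let h : V := delta_mx 0 i0 + delta_mx 0 i1.

Let h_i0 : h 0 i0 = 1.
Proof. by rewrite !mxE !eqxx (negbTE i01) addr0. Qed.

Let h_i1 : h 0 i1 = 1.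
Proof. by rewrite !mxE !eqxx eq_sym (negbTE i01) add0r. Qed.

Let h_other j : j != i0 -> j != i1 -> h 0 j = 0.
Proof. by move=> j0 j1; rewrite !mxE (negbTE j0) (negbTE j1) addr0. Qed.

Let norm_h j : `|h 0 j| <= 1.
Proof.
have [->|j0] := eqVneq j i0; first by rewrite h_i0 normr1.
have [->|j1] := eqVneq j i1; first by rewrite h_i1 normr1.
by rewrite h_other// normr0.
Qed.

Let ball_line p y d s : 0 < d -> ball p (d / 2) y -> `|s| <= d / 2 ->
  ball p d (y + s *: h).
Proof.
move=> d0 py sd; have d2 : 0 < d / 2 by rewrite divr_gt0.
apply/(ball_rowP _ _ d0) => j; rewrite !mxE opprD addrA.
have /(_ j) yj := (ball_rowP _ _ d2).1 py.
rewrite (le_lt_trans (ler_normB _ _))// [ltRHS]splitr; apply: ltr_leD => //.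
rewrite normrM; apply: le_trans sd; rewrite ler_piMr//.
by have := norm_h j; rewrite !mxE.
Qed.

Let nonvanishing p d f :=
  forall y, ball p d y -> y 0 i0 != 0 -> y 0 i1 != 0 -> f y != 0.

Let compact_circle (r : R) : compact [set z : C | `|z| = toC r].
Proof.
apply: (subclosed_compact _ (@compact_disc R r)); last by move=> z /= ->.
rewrite (_ : [set z : C | _] =
    (fun z : C => complex.Re `|z|) @^-1` [set x : R | x = r]).
  apply: closed_comp; last exact: closed_eq.
  by move=> z _; apply: continuous_Re_norm; exact: cvg_id.
have E (z : C) : toC (complex.Re `|z|) = `|z| by rewrite toC_Re// normr_real.
apply/seteqP; split => z H.
  apply: (@toC_inj R); exact: (etrans (E z) H).
exact: (etrans (esym (E z)) (congr1 (@toC R) H)).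
Qed.

(** If f vanishes at p but not at the two points where the line through y in the
    direction h meets uv = 0, then f has no zero on this line, and its inverse
    violates the maximum principle as y tends to p. *)
Let zero_persists f p d : 0 < d -> smooth_on (ball p d) f ->
  p 0 i0 = 0 -> p 0 i1 = 0 -> nonvanishing p d f -> f p = 0 ->
  nbhs p (fun y => y 0 i0 = 0 -> f y = 0 \/ f (y - y 0 i1 *: h) = 0).
Proof.
move=> d0 sf p0 p1 nf fp.
have d20 : 0 < d / 2 by rewrite divr_gt0.
have [r r0 dr] := gt0_toC d20.
have oB : open (ball p d) by exact: ball_open.
have pp : ball p (d / 2) p by exact: ballxx.
pose K := [set z : C | `|z| = toC r].
have Kr : K (toC r) by rewrite /K/= norm_toC gtr0_norm.
have cf y s : ball p (d / 2) y -> `|s| <= d / 2 ->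
    {for y + s *: h, continuous f}.
  by move=> py sd; apply: (smooth_on_continuous sf); exact: ball_line.
have cl (s : C) : {for s, continuous (fun s : C => p + s *: h)}.
  apply: differentiable_continuous; apply: differentiableD.
    exact: differentiable_cst.
  by apply: differentiableZl; exact: ex_diff.
have [||c /[!inE] cK cmin] := @compact_EVT_min _ _
    (fun s : C => complex.Re `|f (p + s *: h)|) K _ (@compact_circle r).
- by exists (toC r).
- apply/continuous_in_subspaceT => s; rewrite inE => sK.
  apply: continuous_Re_norm.
  apply: (@continuous_comp _ _ _ (fun s : C => p + s *: h)); first exact: cl.
  by apply: cf => //; rewrite sK dr.
pose m := `|f (p + c *: h)|.
have m0 : 0 < m.
  have c0 : c != 0 by rewrite -normr_eq0 cK gt_eqF// toC_gt0.
  rewrite normr_gt0; apply: nf.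
  - by apply: ball_line => //; rewrite cK dr.
  - by rewrite mxE p0 mxE h_i0 mulr1 add0r.
  - by rewrite mxE p1 mxE h_i1 mulr1 add0r.
have mK s : K s -> m <= `|f (p + s *: h)|.
  move=> sK; rewrite -(toC_Re (normr_real (f (p + s *: h)))).
  rewrite /m -(toC_Re (normr_real (f (p + c *: h)))) toC_le.
  by apply: cmin; rewrite inE.
have m20 : 0 < m / 2 by rewrite divr_gt0.
have m2m : m / 2 < m by rewrite ltr_pdivrMr// ltr_pMr// ltr1n.
have covK : \forall y \near p, K `<=` (fun s => m / 2 < `|f ((y : V) + s *: h)|).
  have /compact_near_coveringP cov := @compact_circle r.
  apply: (cov V (nbhs p) (fun y s => m / 2 < `|f (y + s *: h)|) _) => s sK.
  have cj : (fun sy : C * V => f (sy.2 + sy.1 *: h)) @ (s, p) --> f (p + s *: h).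
    apply: (@continuous_comp _ _ _ (fun sy : C * V => sy.2 + sy.1 *: h)).
      apply: cvgD; first exact: cvg_snd.
      by apply: cvgZr_tmp; exact: cvg_fst.
    by apply: cf => //; rewrite sK dr.
  have ms : m / 2 < `|f (p + s *: h)| by apply: lt_le_trans (mK _ sK).
  have : \forall sy \near (s, p), `|f (p + s *: h) - f (sy.2 + sy.1 *: h)| < m - m / 2.
    by move/cvgrPdist_lt : cj; apply; rewrite subr_gt0.
  apply: filterS => -[s' y] /= H.
  have := lt_le_trans H (lerB (mK _ sK) (lexx (m / 2))).
  rewrite ltrBrDl => H'; rewrite -(ltrD2r (`|f (p + s *: h) - f (y + s' *: h)|)).
  apply: (lt_le_trans H').
  have T (a b : C) : `|a| <= `|b| + `|a - b|.
    by rewrite -{1}(subrK b a) [leRHS]addrC ler_normD.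
  exact: T.
have fsmall : \forall y \near p, `|f y| < m / 2.
  have := cf p 0 pp; rewrite normr0 scale0r addr0 => /(_ (ltW d20)).
  move/cvgrPdist_lt => /(_ _ m20); apply: filterS => y.
  by rewrite fp sub0r normrN.
have inB : \forall y \near p, ball p (d / 2) y by exact: nbhsx_ballx.
near=> y => y0.
have py : ball p (d / 2) y by near: y.
have yK : K `<=` (fun s => m / 2 < `|f (y + s *: h)|) by near: y.
have ym : `|f y| < m / 2 by near: y.
have [|fy] := eqVneq (f y) 0; first by left.
have [|fy1] := eqVneq (f (y - y 0 i1 *: h)) 0; first by right.
exfalso.
pose phi s := f (y + s *: h).
pose L := [set s : C | ball p d (y + s *: h)].
have oL : open L by exact: (@open_line R n _ y h oB).
have sphi : smooth_on L phi := smooth_on_line y h oB sf.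
pose A := L `&` [set s | phi s != 0].
have oA : open A.
  rewrite openE => s [Ls ps]; apply: filterI; first exact: (open_near oL Ls).
  exact: (near_neq0 (smooth_on_continuous sphi Ls) ps).
have sV : smooth_on A (fun s => (phi s)^-1).
  by apply: smooth_onV => // [s []//|]; apply: smooth_on_sub sphi => s [].
have dA s : `|s| <= toC r -> A s.
  rewrite -dr => sr; have Bs := ball_line d0 py sr; split => //=.
  have [s0|s0] := eqVneq s 0; first by rewrite /phi s0 scale0r addr0.
  have [s1|s1] := eqVneq (y 0 i1 + s) 0.
    have -> : s = - y 0 i1 by apply/eqP; rewrite -addr_eq0 addrC s1.
    by rewrite /phi scaleNr.
  apply: nf => //.
    by rewrite mxE y0 mxE h_i0 mulr1 add0r.
  by rewrite mxE [(s *: h) 0 i1]mxE h_i1 mulr1.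
have circle s : `|s| = toC r -> `|(phi s)^-1| <= (m / 2)^-1.
  move=> sK; have phis : 0 < `|phi s|.
    by rewrite normr_gt0; have [] := dA s; rewrite ?sK.
  rewrite normfV lef_pV2; [|by rewrite posrE|by rewrite posrE].
  by apply: ltW; exact: yK.
have z0 : `|0 : C| <= toC r by rewrite normr0 toC_ge0 ltW.
have := max_modulus oA sV r0 dA circle z0.
rewrite /phi scale0r addr0 normfV.
rewrite lef_pV2; [|by rewrite posrE normr_gt0|by rewrite posrE].
by move=> H; have := le_lt_trans H ym; rewrite ltxx.
Unshelve. all: by end_near. Qed.

Let smooth_row (A : set V) f (B : set V) (Phi : 'I_n -> V -> C) :
  open A -> open B -> smooth_on B f -> (forall j, smooth_on A (Phi j)) ->
  (forall y, A y -> B (\row_j Phi j y)) ->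
  smooth_on A (fun y => f (\row_j Phi j y)).
Proof. exact: smooth_on_comp. Qed.

(** By persistence of zeros, f(0, v, z) f(-v, 0, z) = 0 near p, and one of the two
    factors vanishes identically by the identity theorem. *)
Let dichotomy f p d : 0 < d -> smooth_on (ball p d) f ->
  p 0 i0 = 0 -> p 0 i1 = 0 -> nonvanishing p d f -> f p = 0 ->
  exists2 e, 0 < e <= d &
    (forall y, ball p e y -> y 0 i0 = 0 -> f y = 0) \/
    (forall y, ball p e y -> y 0 i1 = 0 -> f y = 0).
Proof.
move=> d0 sf p0 p1 nf fp.
have /nbhs_ballP[e1 /= e10 zf] := zero_persists d0 sf p0 p1 nf fp.
have [d' d'0 dE] := gt0_toC d0; have [e' e'0 eE] := gt0_toC e10.
pose e := toC (Num.min d' e').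
have e0 : 0 < e by rewrite toC_gt0 lt_min d'0.
have ed : e <= d by rewrite dE toC_le ge_min lexx.
have ee : e <= e1 by rewrite eE toC_le ge_min lexx orbT.
have oB : open (ball p e) by exact: ball_open.
have se : smooth_on (ball p e) f.
  by apply: smooth_on_sub sf; exact: le_ball.
pose FF j (y : V) : C := if j == i0 then 0 else y 0 j.
pose GG j (y : V) : C :=
  if j == i0 then - y 0 i1 else if j == i1 then 0 else y 0 j.
have sFF j : smooth_on (ball p e) (FF j).
  rewrite /FF; case: eqP => _; first exact: smooth_on_cst.
  exact: smooth_on_coord.
have sGG j : smooth_on (ball p e) (GG j).
  rewrite /GG; case: eqP => _.
    have := smooth_onM oB (smooth_on_cst _ (-1 : C)) (smooth_on_coord i1 oB).
    by apply: eq_smooth_on => // y _; rewrite mulN1r.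
  case: eqP => _; first exact: smooth_on_cst.
  exact: smooth_on_coord.
have BF y c : 0 < c -> ball p c y -> ball p c (\row_j FF j y).
  move=> c0 py; apply/(ball_rowP _ _ c0) => j; rewrite mxE /FF.
  case: eqP => [->|_]; first by rewrite p0 subrr normr0.
  exact: ((ball_rowP _ _ c0).1 py).
have BG y c : 0 < c -> ball p c y -> ball p c (\row_j GG j y).
  move=> c0 py; apply/(ball_rowP _ _ c0) => j; rewrite mxE /GG.
  case: eqP => [->|_].
    have := (ball_rowP _ _ c0).1 py i1.
    by rewrite p0 p1 !sub0r opprK normrN.
  case: eqP => [->|_]; first by rewrite p1 subrr normr0.
  exact: ((ball_rowP _ _ c0).1 py).
have sF := smooth_row oB oB se sFF (fun y => BF y e e0).
have sG := smooth_row oB oB se sGG (fun y => BG y e e0).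
have e50 : 0 < e / 5 by rewrite divr_gt0.
have e5e : e / 5 <= e by rewrite ler_pdivrMr// ler_pMr// ler1n.
have FG y : ball p e y -> f (\row_j FF j y) = 0 \/ f (\row_j GG j y) = 0.
  move=> py; have := zf (\row_j FF j y) (le_ball ee (BF _ _ e0 py)).
  rewrite mxE {1}/FF eqxx => /(_ erefl)[|H]; first by left.
  right; rewrite -[RHS]H; congr f; apply/rowP => j; rewrite !mxE.
  have i10 : (i1 == i0) = false by rewrite eq_sym (negbTE i01).
  rewrite /FF /GG i10 !eqxx; case: (eqVneq j i0) => [->|j0].
    by rewrite (negbTE i01) addr0 mulr1 sub0r.
  case: (eqVneq j i1) => [->|j1]; first by rewrite add0r mulr1 subrr.
  by rewrite addr0 mulr0 subr0.
exists (e / 5); first by rewrite e50 (le_trans e5e).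
have [[P pP FP]|noP] := pselect (exists2 P, ball p (e / 5) P & f (\row_j FF j P) != 0).
  right=> y py y1.
  have GP : \forall z \near P, f (\row_j GG j z) = 0.
    have PB : ball p e P by exact: le_ball pP.
    have nz := near_neq0 (smooth_on_continuous sF PB) FP.
    apply: filterS (filterI (open_near oB PB) nz) => z [pz Fz].
    by have [Fz0|//] := FG z pz; rewrite Fz0 eqxx in Fz.
  have G0 := vanish_polydisc e0 sG pP GP.
  pose z : V := \row_j (if j == i0 then 0 else if j == i1 then - y 0 i0 else y 0 j).
  have pz : ball p (e / 5) z.
    apply/(ball_rowP _ _ e50) => j; rewrite mxE.
    have H := (ball_rowP _ _ e50).1 py.
    case: eqP => [->|_]; first by rewrite p0 subrr normr0.
    case: eqP => [->|_]; last exact: H.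
    by have := H i0; rewrite p0 p1 !sub0r opprK normrN.
  rewrite -[RHS](G0 z pz); congr f; apply/rowP => j; rewrite !mxE /GG !mxE.
  case: (eqVneq j i0) => [->|j0].
    by rewrite eq_sym (negbTE i01) eqxx opprK.
  by case: (eqVneq j i1) => [->|].
left=> y py y0; apply/eqP/negPn/negP => fy; apply: noP; exists y => //.
suff -> : \row_j FF j y = y by [].
by apply/rowP => j; rewrite mxE /FF; case: eqP => [->|].
Qed.

(** If f vanishes at p then it vanishes on one of the branches u = 0 and v = 0,
    hence it is divisible by u or by v. This cannot go on forever: the
    restriction of f to the diagonal u = v would vanish to infinite order. *)
Lemma monomial_factorization f p d : 0 < d -> smooth_on (ball p d) f ->
  p 0 i0 = 0 -> p 0 i1 = 0 ->
  (forall y, ball p d y -> y 0 i0 != 0 -> y 0 i1 != 0 -> f y != 0) ->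
  exists (a b : nat) (e : C) (g : V -> C),
    [/\ 0 < e, smooth_on (ball p e) g, g p != 0 &
        forall y, ball p e y -> f y = y 0 i0 ^+ a * y 0 i1 ^+ b * g y].
Proof.
move=> d0 sf p0 p1 nf; apply: contrapT => H.
have step m : exists (a b : nat) (e : C) (g : V -> C),
    [/\ (a + b)%N = m, 0 < e <= d, smooth_on (ball p e) g &
        forall y, ball p e y -> f y = y 0 i0 ^+ a * y 0 i1 ^+ b * g y].
  elim: m => [|m [a [b [e [g [abm /andP[e0 ed] sg E]]]]]].
    exists 0%N, 0%N, d, f; split => //; first by rewrite d0 lexx.
    by move=> y _; rewrite !expr0 !mul1r.
  have gp : g p = 0.
    by apply/eqP/negPn/negP => gp; apply: H; exists a, b, e, g.
  have ng : nonvanishing p e g.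
    move=> y py y0 y1; have := nf y (le_ball ed py) y0 y1.
    by rewrite E// mulf_eq0 negb_or => /andP[].
  have [e1 /andP[e10 e1e] dich] := dichotomy e0 sg p0 p1 ng gp.
  have oB : open (ball p e1) by exact: ball_open.
  have sg1 : smooth_on (ball p e1) g.
    by apply: smooth_on_sub sg; exact: le_ball.
  have e1d : 0 < e1 <= d by rewrite e10 (le_trans e1e).
  case: dich => g0.
    have [g' sg' Eg] := smooth_division oB sg1 g0.
    exists a.+1, b, e1, g'; split => //; first by rewrite addSn abm.
    move=> y py; rewrite E; last exact: (le_ball e1e).
    by rewrite Eg// exprSr -!mulrA; congr (_ * _); rewrite mulrCA.
  have [g' sg' Eg] := smooth_division oB sg1 g0.
  exists a, b.+1, e1, g'; split => //; first by rewrite addnS abm.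
  move=> y py; rewrite E; last exact: (le_ball e1e).
  by rewrite Eg// [y 0 i1 ^+ b.+1]exprSr -!mulrA.
have oB : open (ball p d) by exact: ball_open.
have d20 : 0 < d / 2 by rewrite divr_gt0.
have [r r0 dr] := gt0_toC d20.
pose L := [set s : C | ball p d (p + s *: h)].
have oL : open L by exact: (@open_line R n _ p h oB).
have sphi : smooth_on L (fun s => f (p + s *: h)) := smooth_on_line p h oB sf.
have rL s : `|s| <= toC r -> L s.
  by rewrite -dr => sr; apply: ball_line => //; exact: ballxx.
have line_i0 (s : C) : (p + s *: h) 0 i0 = s.
  by rewrite mxE p0 mxE h_i0 mulr1 add0r.
have line_i1 (s : C) : (p + s *: h) 0 i1 = s.
  by rewrite mxE p1 mxE h_i1 mulr1 add0r.
have flat m : exists2 psi, smooth_on L psi &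
    forall s : C, L s -> f (p + s *: h) = s ^+ m * psi s.
  have [a [b [e [g [abm /andP[e0 ed] sg E]]]]] := step m.
  have oe : open (ball p e) by exact: ball_open.
  exists (fun s => if s == 0 then g p else f (p + s *: h) * (s ^+ m)^-1); last first.
    move=> s Ls; have [->|s0] := eqVneq s 0.
      rewrite E; last by rewrite scale0r addr0; exact: ballxx.
      by rewrite line_i0 line_i1 -exprD abm scale0r addr0.
    by rewrite mulrCA mulfV ?mulr1// expf_neq0.
  pose Le := [set s : C | ball p e (p + s *: h)].
  have oLe : open Le by exact: (@open_line R n _ p h oe).
  have -> : L = Le `|` (L `&` [set s | s != 0]).
    apply/seteqP; split => [s Ls|s [Les|[]]//].
      have [->|s0] := eqVneq s 0; last by right.
      by left; rewrite /Le /= scale0r addr0; exact: ballxx.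
    exact: le_ball Les.
  apply: smooth_onU.
    apply: (eq_smooth_on oLe _ (smooth_on_line p h oe sg)) => s Les.
    have [->|s0] := eqVneq s 0; first by rewrite scale0r addr0.
    by rewrite E// line_i0 line_i1 -exprD abm mulrC mulKf// expf_neq0.
  have oL0 : open (L `&` [set s : C | s != 0]).
    apply: openI => //; rewrite openE => z /= z0.
    exact: (@near_neq0 _ _ (fun z : C => z) z cvg_id z0).
  suff S0 : smooth_on (L `&` [set s : C | s != 0])
      (fun s => f (p + s *: h) * (s ^+ m)^-1).
    by apply: (eq_smooth_on oL0 _ S0) => s [_ /= /negbTE ->].
  apply: smooth_onM => //; first by apply: smooth_on_sub sphi => z [].
  apply: smooth_onV => //.
    by move=> z [_ /= z0]; exact: expf_neq0.
  by apply: smooth_onX => //; exact: smooth_on_id.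
have r20 : 0 < r / 2 by rewrite divr_gt0.
have r2r : r / 2 < r by rewrite ltr_pdivrMr// ltr_pMr// ltr1n.
have nr2 : `|toC (r / 2)| = toC (r / 2) by rewrite norm_toC gtr0_norm.
have : f (p + toC (r / 2) *: h) = 0.
  by apply: (flat_eq0 oL sphi r0 rL flat); rewrite nr2 toC_lt.
apply/eqP; apply: nf; rewrite ?line_i0 ?line_i1 ?gt_eqF ?toC_gt0//.
by apply: rL; rewrite nr2 toC_le ltW.
Qed.

End MonomialFactorization.

(** * Regular functions on manifolds *)

Local Notation inv := Defs.inv.

Lemma near_open_nbhs (T : topologicalType) (x : T) (P : T -> Prop) :
  (\forall y \near x, P y) ->
  exists B : set T, [/\ open B, B x & forall y, B y -> P y].
Proof.
move=> xP; have : nbhs x P by exact: xP.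
by rewrite nbhsE => -[B [oB Bx] BP]; exists B.
Qed.

Section SmoothNear.
Variables (K : numFieldType).
Implicit Types (V W : normedModType K).

Lemma near_eq_smooth_near V W (x : V) (f g : V -> W) :
  (\forall y \near x, f y = g y) -> smooth_near x f -> smooth_near x g.
Proof.
move=> fg [A [oA Ax] sf].
have [B [oB Bx BP]] := near_open_nbhs fg.
exists (A `&` B); first by split; [exact: openI|].
apply: (eq_smooth_on (openI oA oB)) (smooth_on_sub _ sf).
  by move=> y [_ /BP].
by move=> y [].
Qed.

Lemma smooth_near_near V W (x : V) (f : V -> W) :
  smooth_near x f -> \forall y \near x, smooth_near y f.
Proof.
move=> [A [oA Ax] sf]; apply: filterS (open_near oA Ax) => y Ay.
by exists A.
Qed.

Lemma smooth_near_continuous V W (x : V) (f : V -> W) :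
  smooth_near x f -> {for x, continuous f}.
Proof. by move=> [A [oA Ax] sf]; exact: smooth_on_continuous sf Ax. Qed.

Lemma smooth_near_derive V W (x v : V) (f : V -> W) :
  smooth_near x f -> smooth_near x (fun y => 'D_v f y).
Proof. by move=> [A nA sf]; exists A => //; exact: smooth_on_derive. Qed.

Lemma smooth_on_near V W A (f : V -> W) :
  (forall x, A x -> smooth_near x f) -> smooth_on A f.
Proof.
move=> + k; elim: k f => [|k IH] f sf; split => //.
- by move=> x /sf[B [_ Bx] /smooth_on_differentiable]; apply.
- by move=> x /sf[B [_ Bx] /smooth_on_differentiable]; apply.
- by move=> v; apply: IH => x /sf; exact: smooth_near_derive.
Qed.

Lemma smooth_nearP V W (x : V) (f : V -> W) :
  smooth_near x f <->
  exists2 d : K, 0 < d & smooth_on (ball x d) f.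
Proof.
split=> [[A [oA Ax] sf]|[d d0 sf]]; last first.
  by exists (ball x d) => //; split; [exact: ball_open|exact: ballxx].
have /nbhs_ballP[d d0 dA] := open_near oA Ax.
by exists d => //; exact: smooth_on_sub sf.
Qed.

Lemma smooth_near_open V W (f : V -> W) : open [set x | smooth_near x f].
Proof. by rewrite openE => x /= /smooth_near_near. Qed.

Lemma smooth_near_cst V W (x : V) (a : W) : smooth_near x (fun=> a).
Proof.
by exists setT; [split; [exact: openT|]|move=> k; exact: diff_times_cst].
Qed.

Lemma smooth_nearD V W (x : V) (f g : V -> W) :
  smooth_near x f -> smooth_near x g -> smooth_near x (fun y => f y + g y).
Proof.
move=> [A [oA Ax] sf] [B [oB Bx] sg].
exists (A `&` B); first by split; [exact: openI|].
by apply: (smooth_onD (openI oA oB)); [apply: smooth_on_sub sf|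
  apply: smooth_on_sub sg] => y [].
Qed.

Lemma smooth_nearM V (x : V) (f g : V -> K) :
  smooth_near x f -> smooth_near x g -> smooth_near x (fun y => f y * g y).
Proof.
move=> [A [oA Ax] sf] [B [oB Bx] sg].
exists (A `&` B); first by split; [exact: openI|].
by apply: (smooth_onM (openI oA oB)); [apply: smooth_on_sub sf|
  apply: smooth_on_sub sg] => y [].
Qed.

Lemma smooth_nearV V (x : V) (f : V -> K) :
  smooth_near x f -> f x != 0 -> smooth_near x (fun y => (f y)^-1).
Proof.
move=> sf fx; have sx := smooth_near_near sf.
have nz := near_neq0 (smooth_near_continuous sf) fx.
have [B [oB Bx BP]] := near_open_nbhs (filterI sx nz).
exists B => //; apply: (smooth_onV oB) => [y /BP[]//|].
by apply: smooth_on_near => y /BP[].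
Qed.

Lemma smooth_near_coord n (x : 'rV[K]_n) (j : 'I_n) :
  smooth_near x (fun y : 'rV[K]_n => y 0 j).
Proof.
by exists setT; [split; [exact: openT|]|exact: (smooth_on_coord j openT)].
Qed.

Lemma near_forall_ord n (T : Type) (F : set_system T) (P : 'I_n -> T -> Prop) :
  Filter F -> (forall i, \forall x \near F, P i x) ->
  \forall x \near F, forall i, P i x.
Proof. by move=> FF FP; exact: filter_forall. Qed.

Lemma continuous_row V n (Phi : 'I_n -> V -> K) x :
  (forall j, smooth_near x (Phi j)) ->
  {for x, continuous (fun y => \row_j Phi j y)}.
Proof.
move=> sPhi; apply: differentiable_continuous.
apply: (differentiable_row _).1 => j; have [A [_ Ax] sA] := sPhi j.
exact: smooth_on_differentiable sA Ax.
Qed.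

Lemma smooth_near_comp V n (g : 'rV[K]_n -> K) (Phi : 'I_n -> V -> K) x :
  smooth_near (\row_j Phi j x) g -> (forall j, smooth_near x (Phi j)) ->
  smooth_near x (fun y => g (\row_j Phi j y)).
Proof.
move=> sg sPhi; have cPhi := continuous_row sPhi.
have H1 : \forall y \near x, smooth_near (\row_j Phi j y) g.
  exact: (cPhi _ (smooth_near_near sg)).
have H2 : \forall y \near x, forall j, smooth_near y (Phi j).
  by apply: near_forall_ord => j; exact: smooth_near_near.
have [B [oB Bx BP]] := near_open_nbhs (filterI H1 H2).
exists B => //.
apply: (smooth_on_comp oB (smooth_near_open g)).
- by apply: smooth_on_near.
- by move=> j; apply: smooth_on_near => y /BP[_ ]; exact.
- by move=> y /BP[].
Qed.

End SmoothNear.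

Section RegularFunctions.
Variables (K : numFieldType) (n : nat) (X : manifold K n).
Implicit Types (x y : X) (f g : X -> K) (c : coord_system K X n).

Lemma coords_near c x : coords c -> dom c x -> \forall y \near x, dom c y.
Proof. by move=> [oc _ _ _ _] cx; exact: open_near. Qed.

Lemma coords_inv c x : coords c -> dom c x -> inv c (coo c x) = x.
Proof. by move=> [_ _ + _ _]; apply. Qed.

Lemma coords_image c w : coords c -> (coo c @` dom c) w ->
  dom c (inv c w) /\ coo c (inv c w) = w.
Proof. by move=> hc [x cx <-]; rewrite coords_inv. Qed.

Lemma coords_image_near c x : coords c -> dom c x ->
  \forall w \near coo c x, (coo c @` dom c) w.
Proof. by move=> [_ oi _ _ _] cx; apply: open_near => //; exists x. Qed.

Lemma coo_continuous c x : coords c -> dom c x -> {for x, continuous (coo c)}.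
Proof. by move=> [_ _ _ + _] cx => /(_ _ cx)[]. Qed.

Lemma inv_continuous c x : coords c -> dom c x ->
  {for coo c x, continuous (inv c)}.
Proof. by move=> [_ _ _ + _] cx => /(_ _ cx)[]. Qed.

Lemma regP c x f : coords c -> dom c x ->
  (reg x f <-> smooth_near (coo c x) (f \o inv c)).
Proof. by move=> [_ _ _ _ +] cx; exact. Qed.

Lemma near_inv c x (P : X -> Prop) : coords c -> dom c x ->
  (\forall y \near x, P y) -> \forall w \near coo c x, P (inv c w).
Proof.
move=> hc cx xP; have H : \forall y \near inv c (coo c x), P y.
  by rewrite coords_inv.
exact: (inv_continuous hc cx H).
Qed.

Lemma near_coo c x (P : 'rV[K]_n -> Prop) : coords c -> dom c x ->
  (\forall w \near coo c x, P w) -> \forall y \near x, P (coo c y).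
Proof. by move=> hc cx xP; exact: (coo_continuous hc cx). Qed.

Lemma reg_of_smooth c x (F : 'rV[K]_n -> K) : coords c -> dom c x ->
  smooth_near (coo c x) F -> reg x (fun y => F (coo c y)).
Proof.
move=> hc cx sF; apply/(regP _ hc cx).
apply: near_eq_smooth_near sF.
apply: filterS (coords_image_near hc cx) => w wi /=.
by rewrite (coords_image hc wi).2.
Qed.

Lemma reg_crd c x j : coords c -> dom c x -> reg x (fun y => coo c y 0 j).
Proof.
by move=> hc cx; exact: (reg_of_smooth hc cx (smooth_near_coord (coo c x) j)).
Qed.

Lemma near_eq_reg x f g : (\forall y \near x, f y = g y) -> reg x f -> reg x g.
Proof.
move=> fg; have [c hc cx] := m_locally x.
rewrite !(regP _ hc cx); apply: near_eq_smooth_near.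
exact: near_inv fg.
Qed.

Lemma reg_cst x (a : K) : reg x (fun=> a).
Proof.
by have [c hc cx] := m_locally x; apply/(regP _ hc cx); exact: smooth_near_cst.
Qed.

Lemma regD x f g : reg x f -> reg x g -> reg x (fun y => f y + g y).
Proof.
by have [c hc cx] := m_locally x; rewrite !(regP _ hc cx); exact: smooth_nearD.
Qed.

Lemma regM x f g : reg x f -> reg x g -> reg x (fun y => f y * g y).
Proof.
by have [c hc cx] := m_locally x; rewrite !(regP _ hc cx); exact: smooth_nearM.
Qed.

Lemma regX x f k : reg x f -> reg x (fun y => f y ^+ k).
Proof.
move=> rf; elim: k => [|k IH]; first exact: (reg_cst x 1).
by apply: near_eq_reg (regM rf IH); apply: nearW => y; rewrite exprS.
Qed.

Lemma regV x f : reg x f -> f x != 0 -> reg x (fun y => (f y)^-1).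
Proof.
have [c hc cx] := m_locally x; rewrite !(regP _ hc cx) => rf fx.
by apply: (smooth_nearV rf); rewrite /= coords_inv.
Qed.

Lemma reg_near x f : reg x f -> \forall y \near x, reg y f.
Proof.
have [c hc cx] := m_locally x; rewrite (regP _ hc cx) => rf.
apply: filterS (filterI (coords_near hc cx)
  (near_coo hc cx (smooth_near_near rf))) => y [cy].
by move/(regP _ hc cy).
Qed.

Lemma reg_continuous x f : reg x f -> {for x, continuous f}.
Proof.
have [c hc cx] := m_locally x; rewrite (regP _ hc cx) => rf.
have cf : {for x, continuous ((f \o inv c) \o coo c)}.
  apply: continuous_comp; first exact: coo_continuous.
  exact: smooth_near_continuous.
have cf' : (fun y => f (inv c (coo c y))) @ x --> f x.
  by rewrite -[X in _ --> f X](coords_inv hc cx); exact: cf.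
apply: cvg_trans cf'; apply: near_eq_cvg; apply: filterS (coords_near hc cx) => y cy /=.
by rewrite coords_inv.
Qed.

Lemma reg_comp m x (F : 'rV[K]_m -> K) (Phi : 'I_m -> X -> K) :
  smooth_near (\row_j Phi j x) F -> (forall j, reg x (Phi j)) ->
  reg x (fun y => F (\row_j Phi j y)).
Proof.
have [c hc cx] := m_locally x; rewrite (regP _ hc cx) => sF rPhi.
have xE : x = inv c (coo c x) by rewrite coords_inv.
rewrite [in X in smooth_near X]xE in sF.
apply: (smooth_near_comp (Phi := fun j => Phi j \o inv c) sF) => j.
exact/(regP _ hc cx).
Qed.

End RegularFunctions.

(** * Phases *)

Section Phase.
Variable R : realType.
Local Notation C := (Cx R).
Implicit Types z w : C.

Lemma phaseM z w : phase (z * w) = phase z * phase w.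
Proof. by rewrite /phase normrM invfM mulrACA. Qed.

Lemma phase_norm1 z : `|z| = 1 -> phase z = z.
Proof. by rewrite /phase => ->; rewrite divr1. Qed.

Lemma phase1 : phase (1 : C) = 1.
Proof. by rewrite phase_norm1// normr1. Qed.

Lemma norm_phase z : z != 0 -> `|phase z| = 1.
Proof. by move=> z0; rewrite /phase normrM normfV normr_id divff// normr_eq0. Qed.

Lemma phase_pos z : 0 < z -> phase z = 1.
Proof. by move=> z0; rewrite /phase gtr0_norm// divff// gt_eqF. Qed.

Lemma phase_norm z : z = `|z| * phase z.
Proof.
have [->|z0] := eqVneq z 0; first by rewrite normr0 mul0r.
by rewrite /phase mulrC divfK// normr_eq0.
Qed.

Lemma phase_continuous (T : topologicalType) (f : T -> C) x :
  {for x, continuous f} -> f x != 0 -> {for x, continuous (fun y => phase (f y))}.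
Proof.
move=> cf fx; apply: cvgM; first exact: cf.
by apply: cvgV; [rewrite normr_eq0|exact: (cvg_norm cf)].
Qed.

Lemma norm1_neq0 z : `|z| = 1 -> z != 0.
Proof. by move=> z1; rewrite -normr_eq0 z1 oner_neq0. Qed.

(** Divide by the smaller of the two powers and let s tend to 0. *)
Lemma power_unit_unique (phi psi : C -> C) (m k : nat) :
  {for 0, continuous phi} -> {for 0, continuous psi} ->
  phi 0 != 0 -> psi 0 != 0 ->
  (\forall s \near (0 : C), s != 0 -> phi s * s ^+ m = psi s * s ^+ k) ->
  m = k /\ phi 0 = psi 0.
Proof.
wlog mk : phi psi m k / (m <= k)%N.
  move=> W cphi cpsi phi0 psi0 E; case/orP: (leq_total m k) => mk; first exact: W.
  have E' : \forall s \near (0 : C), s != 0 -> psi s * s ^+ k = phi s * s ^+ m.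
    by apply: filterS E => s H s0; rewrite H.
  by have [-> ->] := W psi phi k m mk cpsi cphi psi0 phi0 E'.
move=> cphi cpsi phi0 psi0 E.
have E0 : phi 0 = psi 0 * 0 ^+ (k - m).
  have cX : {for 0, continuous (fun s : C => s ^+ (k - m))}.
    apply: smooth_near_continuous; exists setT; first by split; [exact: openT|].
    exact: (smooth_onX (k - m) openT (smooth_on_id openT)).
  have c2 : {for 0, continuous (fun s => psi s * s ^+ (k - m))}.
    exact: (cvgM cpsi cX).
  apply: (@cvg_unique _ _ (phi @ (0 : C)^') _ _ _ _).
  - exact: norm_hausdorff.
  - exact: (cvg_trans (cvg_app _ (@cvg_within _ _ _ _)) cphi).
  have c3 : (fun s => psi s * s ^+ (k - m)) @ (0 : C)^' --> psi 0 * 0 ^+ (k - m).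
    exact: (cvg_trans (cvg_app _ (@cvg_within _ _ _ _)) c2).
  apply: cvg_trans c3; apply: near_eq_cvg; rewrite near_withinE.
  apply: filterS E => s H s0; have sm : s ^+ m != 0 by rewrite expf_neq0.
  apply: (mulIf sm); rewrite H// -mulrA -exprD subnK//.
have [E1|km] := eqVneq (k - m)%N 0%N.
  split; last by rewrite E0 E1 expr0 mulr1.
  by apply/eqP; rewrite eqn_leq mk -subn_eq0 E1.
by move: phi0; rewrite E0 expr0n (negbTE km) mulr0 eqxx.
Qed.

End Phase.

(** * Log structure at a double point *)

Lemma mul_monomial_form (K : comRingType) (f g p q p' q' e e' r s r' s' : K) :
  f * (p * q) = e * (r * s) -> g * (p' * q') = e' * (r' * s') ->
  f * g * (p * p' * (q * q')) = e * e' * (r * r' * (s * s')).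
Proof.
move=> H H'.
by rewrite (mulrACA p) (mulrACA r) (mulrACA f) (mulrACA e) H H'.
Qed.

Lemma monomial_mul_swap (K : comRingType) (e p q r s : K) :
  e * (p * q * (r * s)) = e * (p * r) * (q * s).
Proof. by rewrite (mulrACA p) [LHS]mulrA. Qed.

Lemma ratio_eq (K : fieldType) (k p q p' q' : K) : q != 0 -> q' != 0 ->
  p * q' = p' * q -> k * p / q = k * p' / q'.
Proof.
by move=> q0 q'0 e; rewrite -!mulrA; congr (_ * _); apply/eqP; rewrite eqr_div// e.
Qed.

Section LogStructure.
Variables (R : realType) (n : nat) (X : manifold (Cx R) n) (D : set X) (x : X).
Implicit Types f g E : X -> Cx R.

Lemma log_monoid_group f : log_monoid D x f -> log_group D x f.
Proof.
move=> mf; exists f, (fun=> 1); split => //.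
  split; first exact: reg_cst.
  by apply: nearW => y _; exact: oner_neq0.
by apply: nearW => y _; rewrite divr1.
Qed.

Lemma unit_log_monoid E : reg x E -> E x != 0 -> log_monoid D x E.
Proof.
move=> rE nE; split => //.
by apply: filterS (near_neq0 (reg_continuous rE) nE).
Qed.

Lemma log_monoidM f g : log_monoid D x f -> log_monoid D x g ->
  log_monoid D x (fun y => f y * g y).
Proof.
move=> [rf nf] [rg ng]; split; first exact: regM.
by apply: filterS (filterI nf ng) => y [fy gy] nD; rewrite mulf_neq0 ?fy ?gy.
Qed.

Lemma log_groupM f g : log_group D x f -> log_group D x g ->
  log_group D x (fun y => f y * g y).
Proof.
move=> [f1 [f2 [m1 m2 e1]]] [g1 [g2 [m3 m4 e2]]].
exists (fun y => f1 y * g1 y), (fun y => f2 y * g2 y).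
split; [exact: log_monoidM|exact: log_monoidM|].
by apply: filterS (filterI e1 e2) => y [fy gy] nD; rewrite fy// gy// invfM mulrACA.
Qed.

Lemma near_eq_log_group f g : log_group D x f ->
  (\forall y \near x, ~ D y -> f y = g y) -> log_group D x g.
Proof.
move=> [f1 [f2 [m1 m2 e1]]] fg; exists f1, f2; split => //.
by apply: filterS (filterI e1 fg) => y [e2 e3] nD; rewrite -e3// e2.
Qed.

End LogStructure.

Section DoublePoint.
Variables (R : realType) (n : nat) (X : manifold (Cx R) n.+2).
Variables (c : coord_system (Cx R) X n.+2) (pi : X -> Cx R).
Hypotheses (hc : coords c)
  (piE : forall x, dom c x -> pi x = crd c 0 x * crd c 1 x).
Local Notation C := (Cx R).
Local Notation i0 := (inord 0 : 'I_n.+2).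
Local Notation i1 := (inord 1 : 'I_n.+2).
Local Notation D := (pi @^-1` [set 0]).
Local Notation u := (crd c 0).
Local Notation v := (crd c 1).
Variable x : X.
Hypotheses (cx : dom c x) (ux : u x = 0) (vx : v x = 0).
Implicit Types (f g E : X -> C) (a b : nat) (rho : C).

Let i01 : i0 != i1.
Proof. by apply/eqP => /(congr1 val); rewrite /= !inordK. Qed.

Let offD y : dom c y -> (~ D y <-> u y != 0 /\ v y != 0).
Proof.
move=> cy; rewrite /= piE//; split=> [H|[u0 v0]].
  by apply/andP; rewrite -negb_or -mulf_eq0; apply/eqP.
by apply/eqP; rewrite mulf_neq0.
Qed.

Lemma log_monoid_factor f : log_monoid D x f ->
  exists E a b, [/\ reg x E, E x != 0 &
    \forall y \near x, f y = E y * (u y ^+ a * v y ^+ b)].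
Proof.
move=> [rf fD]; pose p := coo c x; pose F := f \o inv c.
have sF : smooth_near p F by apply/(regP _ hc cx).
have H1 : \forall w \near p, (~ D (inv c w) -> f (inv c w) != 0) /\
    (coo c @` dom c) w.
  by apply: filterI; [exact: (near_inv hc cx fD)|exact: coords_image_near].
have /smooth_nearP[d1 d10 sd1] := sF.
have /nbhs_ballP[d2 /= d20 d2P] := H1.
have [d1' d1'0 d1E] := gt0_toC d10; have [d2' d2'0 d2E] := gt0_toC d20.
pose d := toC (Num.min d1' d2').
have d0 : 0 < d by rewrite toC_gt0 lt_min d1'0.
have dd1 : d <= d1 by rewrite d1E toC_le ge_min lexx.
have dd2 : d <= d2 by rewrite d2E toC_le ge_min lexx orbT.
have sd : smooth_on (ball p d) F by apply: smooth_on_sub sd1; exact: le_ball.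
have nF y : ball p d y -> y 0 i0 != 0 -> y 0 i1 != 0 -> F y != 0.
  move=> py y0 y1; have [H /(coords_image hc)[cy yE]] := d2P _ (le_ball dd2 py).
  by apply: H; apply/(offD cy); rewrite /crd yE.
have [a [b [e [g [e0 sg gp FE]]]]] :=
  monomial_factorization i01 d0 sd ux vx nF.
have sgp : smooth_near p g by apply/smooth_nearP; exists e.
exists (fun y => g (coo c y)), a, b; split => //.
  exact: reg_of_smooth.
have near_e : \forall y \near x, ball p e (coo c y).
  by apply: near_coo => //; exact: nbhsx_ballx.
apply: filterS (filterI (coords_near hc cx) near_e) => y [cy ye].
by have := FE _ ye; rewrite /F/= coords_inv// => ->; rewrite mulrC.
Qed.

(** Off the divisor, f = E u^a v^b / (u^a' v^b') with a unit E; the denominator is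
    cleared. *)
Definition monomial_form f E a b a' b' :=
  [/\ reg x E, E x != 0 &
    \forall y \near x, ~ D y ->
      f y * (u y ^+ a' * v y ^+ b') = E y * (u y ^+ a * v y ^+ b)].

Let near_offD : \forall y \near x, ~ D y -> u y != 0 /\ v y != 0.
Proof.
by apply: filterS (coords_near hc cx) => y cy; move/(offD cy).
Qed.

Let monomial_neq0 y a b : u y != 0 -> v y != 0 -> u y ^+ a * v y ^+ b != 0.
Proof. by move=> u0 v0; rewrite mulf_neq0// expf_neq0. Qed.

Lemma log_group_form f : log_group D x f ->
  exists E a b a' b', monomial_form f E a b a' b'.
Proof.
move=> [g [h [/log_monoid_factor[E1 [a [b [r1 n1 e1]]]]
  /log_monoid_factor[E2 [a' [b' [r2 n2 e2]]]] fE]]].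
exists (fun y => E1 y / E2 y), a, b, a', b'; split.
- by apply: regM => //; exact: regV.
- by rewrite mulf_neq0// invr_eq0.
have nz := near_neq0 (reg_continuous r2) n2.
apply: filterS (filterI (filterI (filterI e1 e2) (filterI fE nz)) near_offD).
move=> y [[[g1 h2] [fy E20]] uv] nD; have [u0 v0] := uv nD.
rewrite (fy nD) g1 h2 invfM.
have mn := monomial_neq0 a' b' u0 v0.
by rewrite -mulrA divfK// mulrAC.
Qed.

(** Through x, and on v = u^k in coordinates, hence outside the divisor for
    s <> 0. *)
Let curve k (s : C) : X :=
  inv c (coo c x + (s *: delta_mx 0 i0 + s ^+ k *: delta_mx 0 i1)).

Let curve0 k : (0 < k)%N -> curve k 0 = x.
Proof.
by move=> k0; rewrite /curve expr0n eqn0Ngt k0 !scale0r !addr0 coords_inv.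
Qed.

Let curve_continuous k : (0 < k)%N -> {for 0, continuous (curve k)}.
Proof.
move=> k0; pose F (s : C) : 'rV[C]_n.+2 :=
  coo c x + (s *: delta_mx 0 i0 + s ^+ k *: delta_mx 0 i1).
have F0 : F 0 = coo c x.
  by rewrite /F expr0n eqn0Ngt k0 !scale0r !addr0.
apply: (@continuous_comp _ _ _ F); last by rewrite F0; exact: inv_continuous.
apply: differentiable_continuous; apply: differentiableD.
  exact: differentiable_cst.
apply: differentiableD; apply: differentiableZl; first exact: ex_diff.
have sX := smooth_onX k openT (smooth_on_id (R := R) openT).
exact: (smooth_on_differentiable sX I).
Qed.

Let curve_coords k : (0 < k)%N -> \forall s \near (0 : C),
  [/\ u (curve k s) = s, v (curve k s) = s ^+ k & dom c (curve k s)].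
Proof.
move=> k0; pose F (s : C) : 'rV[C]_n.+2 :=
  coo c x + (s *: delta_mx 0 i0 + s ^+ k *: delta_mx 0 i1).
have F0 : F 0 = coo c x.
  by rewrite /F expr0n eqn0Ngt k0 !scale0r !addr0.
have cF : {for 0, continuous F}.
  apply: differentiable_continuous; apply: differentiableD.
    exact: differentiable_cst.
  apply: differentiableD; apply: differentiableZl; first exact: ex_diff.
  have sX := smooth_onX k openT (smooth_on_id (R := R) openT).
  exact: (smooth_on_differentiable sX I).
have H : \forall w \near F 0, (coo c @` dom c) w.
  by rewrite F0; exact: coords_image_near.
have : \forall s \near (0 : C), (coo c @` dom c) (F s) by exact: (cF _ H).
apply: filterS => s /(coords_image hc)[cs sE].
have x0 : coo c x 0 i0 = 0 by exact: ux.
have x1 : coo c x 0 i1 = 0 by exact: vx.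
split; last exact: cs.
  rewrite /crd /curve -/(F s) sE !mxE x0 !eqxx (negbTE i01).
  by rewrite mulr1 mulr0 addr0 add0r.
rewrite /crd /curve -/(F s) sE !mxE x1 !eqxx eq_sym (negbTE i01).
by rewrite mulr1 mulr0 !add0r.
Qed.

Let near_curve k (P : X -> Prop) : (0 < k)%N -> (\forall y \near x, P y) ->
  \forall s \near (0 : C), P (curve k s).
Proof.
move=> k0 xP; have H : \forall y \near curve k 0, P y by rewrite curve0.
exact: (curve_continuous k0 H).
Qed.

(** Along the curve v = u^k the monomial u^a v^b has order a + k b, and the orders
    for k = 1 and k = 2 determine a and b. *)
Lemma unit_monomial_unique E E' a b a' b' :
  reg x E -> E x != 0 -> reg x E' -> E' x != 0 ->
  (\forall y \near x, ~ D y ->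
     E y * (u y ^+ a * v y ^+ b) = E' y * (u y ^+ a' * v y ^+ b')) ->
  [/\ a = a', b = b' & E x = E' x].
Proof.
move=> rE nE rE' nE' EE.
have step k : (0 < k)%N -> (a + k * b = a' + k * b')%N /\ E x = E' x.
  move=> k0; have cE := curve0 k0.
  have cont f : reg x f -> {for 0, continuous (fun s => f (curve k s))}.
    move=> rf; apply: (@continuous_comp _ _ _ (curve k)).
      exact: curve_continuous.
    by rewrite cE; exact: reg_continuous.
  have := @power_unit_unique R (fun s => E (curve k s)) (fun s => E' (curve k s))
    (a + k * b) (a' + k * b') (cont _ rE) (cont _ rE').
  rewrite !cE; apply => //.
  apply: filterS (filterI (curve_coords k0) (near_curve k0 EE)).
  move=> s [[us vs cs] H] s0; have /H : ~ D (curve k s).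
    by apply/(offD cs); rewrite us vs s0; split => //; exact: expf_neq0.
  by rewrite us vs !exprD !exprM.
have [e1 ->] := step 1%N isT; have [e2 _] := step 2%N isT.
have bb : b = b'.
  apply: (@addnI (a + b)%N); rewrite -addnA addnn -mul2n e2.
  by rewrite -[b]mul1n e1 !mul1n -addnA addnn mul2n.
by split => //; apply: (@addIn (1 * b)); rewrite e1 bb.
Qed.

Lemma monomial_form_unique f E a b a' b' F c1 d1 c1' d1' :
  monomial_form f E a b a' b' -> monomial_form f F c1 d1 c1' d1' ->
  [/\ (a + c1' = c1 + a')%N, (b + d1' = d1 + b')%N & E x = F x].
Proof.
move=> [rE nE eE] [rF nF eF]; apply: unit_monomial_unique => //.
apply: filterS (filterI eE eF) => y [e1 e2] nD.
rewrite !exprD !(@monomial_mul_swap C) -(e1 nD) -(e2 nD) -!mulrA; congr (_ * _).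
by rewrite mulrA mulrC -mulrA.
Qed.

Lemma log_monoid_u : log_monoid D x u.
Proof.
split; first exact: reg_crd.
by apply: filterS near_offD => y H /H[].
Qed.

Lemma log_monoid_v : log_monoid D x v.
Proof.
split; first exact: reg_crd.
by apply: filterS near_offD => y H /H[].
Qed.

Lemma log_monoidX f k : log_monoid D x f -> log_monoid D x (fun y => f y ^+ k).
Proof.
move=> mf; elim: k => [|k IH].
  apply: unit_log_monoid; last by rewrite expr0 oner_neq0.
  exact: (reg_cst x 1).
by have := log_monoidM mf IH; congr log_monoid; apply/funext => y; rewrite exprS.
Qed.

Lemma log_monoid_pi : log_monoid D x pi.
Proof.
have [rm nm] := log_monoidM log_monoid_u log_monoid_v.
split.
  apply: near_eq_reg rm; apply: filterS (coords_near hc cx) => y cy.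
  by rewrite -piE.
apply: filterS (coords_near hc cx) => y cy nD; apply/eqP => p0; exact: nD.
Qed.

Lemma log_phaseX h f k : is_log_phase D x h -> log_monoid D x f ->
  h (fun y => f y ^+ k) = h f ^+ k.
Proof.
move=> [_ hM _ hu _] mf; elim: k => [|k IH].
  rewrite expr0 -[RHS](@phase1 R) -(hu (fun=> 1)) ?oner_neq0//.
  exact: reg_cst.
rewrite exprS -IH -hM; [|exact: log_monoid_group|].
  by congr h; apply/funext => y; rewrite exprS.
exact/log_monoid_group/log_monoidX.
Qed.

Lemma log_phase_form h f E a b a' b' : is_log_phase D x h -> log_group D x f ->
  monomial_form f E a b a' b' ->
  h f * (h u ^+ a' * h v ^+ b') = phase (E x) * (h u ^+ a * h v ^+ b).
Proof.
move=> hh gf [rE nE eE]; have [_ hM he hu _] := hh.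
have mono k l : log_monoid D x (fun y => u y ^+ k * v y ^+ l).
  by apply: log_monoidM; apply: log_monoidX;
    [exact: log_monoid_u|exact: log_monoid_v].
have mE := unit_log_monoid D rE nE.
have hmono k l : h (fun y => u y ^+ k * v y ^+ l) = h u ^+ k * h v ^+ l.
  rewrite hM; last 2 first.
  - exact/log_monoid_group/log_monoidX/log_monoid_u.
  - exact/log_monoid_group/log_monoidX/log_monoid_v.
  by rewrite !log_phaseX//; [exact: log_monoid_v|exact: log_monoid_u].
rewrite -!hmono -(hu _ rE nE) -!hM//; try exact: log_monoid_group.
by apply: he => //; apply: log_groupM => //; exact: log_monoid_group.
Qed.

Lemma log_phase_pi h : is_log_phase D x h -> h pi = h u * h v.
Proof.
move=> [_ hM he _ _]; rewrite -hM; last 2 first.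
- exact/log_monoid_group/log_monoid_u.
- exact/log_monoid_group/log_monoid_v.
apply: he; first exact/log_monoid_group/log_monoid_pi.
by apply: filterS (coords_near hc cx) => y cy _; rewrite piE.
Qed.

Lemma log_phase_norm h f : is_log_phase D x h -> log_monoid D x f -> `|h f| = 1.
Proof. by move=> [h1 _ _ _ _] /log_monoid_group/h1. Qed.

(** The sections of M^gp are generated by the units, u and v. *)
Lemma log_phase_eq h h' : is_log_phase D x h -> is_log_phase D x h' ->
  h u = h' u -> h v = h' v -> h = h'.
Proof.
move=> hh hh' hu hv; apply/funext => f.
have [gf|nf] := pselect (log_group D x f); last first.
  by have [_ _ _ _ ->//] := hh; have [_ _ _ _ ->//] := hh'.
have [E [a [b [a' [b' fE]]]]] := log_group_form gf.
have := log_phase_form hh gf fE; rewrite hu hv -(log_phase_form hh' gf fE).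
apply: mulIf; rewrite mulf_neq0// expf_neq0//; apply: norm1_neq0.
  exact: log_phase_norm log_monoid_u.
exact: log_phase_norm log_monoid_v.
Qed.

Lemma monomial_formM f g E a b a' b' F c1 d1 c1' d1' :
  monomial_form f E a b a' b' -> monomial_form g F c1 d1 c1' d1' ->
  monomial_form (fun y => f y * g y) (fun y => E y * F y)
    (a + c1) (b + d1) (a' + c1') (b' + d1').
Proof.
move=> [rE nE eE] [rF nF eF]; split; [exact: regM|by rewrite mulf_neq0|].
apply: filterS (filterI eE eF) => y [e1 e2] nD.
by rewrite !exprD; exact: mul_monomial_form (e1 nD) (e2 nD).
Qed.

(** A section with the form E u^a v^b / (u^a' v^b') is sent to the phase of E(x)
    times rho1^(a-a') rho2^(b-b'); the form is unique up to common factors of the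
    numerator and the denominator. *)
Lemma log_phase_exists rho1 rho2 : `|rho1| = 1 -> `|rho2| = 1 ->
  exists h, [/\ is_log_phase D x h, h u = rho1 & h v = rho2].
Proof.
move=> n1 n2; have r10 := norm1_neq0 n1; have r20 := norm1_neq0 n2.
pose m a b := rho1 ^+ a * rho2 ^+ b.
have m0 a b : m a b != 0 by rewrite mulf_neq0// expf_neq0.
have nm a b : `|m a b| = 1 by rewrite normrM !normrX n1 n2 !expr1n mul1r.
have mD a b a' b' : m (a + a')%N (b + b')%N = m a b * m a' b'.
  by rewrite /m !exprD mulrACA.
pose is_value f z := exists E a b a' b',
  monomial_form f E a b a' b' /\ z = phase (E x) * m a b / m a' b'.
pose h f : C := if `[< log_group D x f >] then xget 0 (is_value f) else 0.
have hE f E a b a' b' : log_group D x f -> monomial_form f E a b a' b' ->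
    h f = phase (E x) * m a b / m a' b'.
  move=> gf fE; rewrite /h asboolT//.
  case: xgetP => [z _ [F [c1 [d1 [c1' [d1' [fF ->]]]]]]|no]; last first.
    by case: (no (phase (E x) * m a b / m a' b')); exists E, a, b, a', b'.
  have [e1 e2 ->] := monomial_form_unique fE fF.
  apply: ratio_eq => //.
  by rewrite -!mD e1 e2.
have formu : monomial_form u (fun=> 1) 1 0 0 0.
  split; [exact: reg_cst|exact: oner_neq0|].
  by apply: nearW => y _; rewrite expr1 !expr0 !mulr1 mul1r.
have formv : monomial_form v (fun=> 1) 0 1 0 0.
  split; [exact: reg_cst|exact: oner_neq0|].
  by apply: nearW => y _; rewrite expr1 !expr0 !mulr1 !mul1r.
exists h; split; first split.
- move=> f gf; have [E [a [b [a' [b' fE]]]]] := log_group_form gf.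
  rewrite (hE _ _ _ _ _ _ gf fE) normrM normfV normrM !nm invr1 !mulr1.
  by apply: norm_phase; have [] := fE.
- move=> f g gf gg; have [E [a [b [a' [b' fE]]]]] := log_group_form gf.
  have [F [c1 [d1 [c1' [d1' gF]]]]] := log_group_form gg.
  rewrite (hE _ _ _ _ _ _ gf fE) (hE _ _ _ _ _ _ gg gF).
  rewrite (hE _ _ _ _ _ _ (log_groupM gf gg) (monomial_formM fE gF)).
  by rewrite phaseM !mD invfM [RHS]mulrACA; congr (_ * _); rewrite mulrACA.
- move=> f g gf fg; have [E [a [b [a' [b' fE]]]]] := log_group_form gf.
  have gg := near_eq_log_group gf fg.
  rewrite (hE _ _ _ _ _ _ gf fE) (hE g E a b a' b')//.
  have [rE nE eE] := fE; split => //.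
  by apply: filterS (filterI eE fg) => y [e2 e3] nD; rewrite -e3// e2.
- move=> f rf nf; rewrite (hE f f 0 0 0 0)%N.
  + by rewrite /m !expr0 mulr1 divr1 mulr1.
  + exact/log_monoid_group/unit_log_monoid.
  + by split => //; apply: nearW.
- by move=> f nf; rewrite /h asboolF.
- rewrite (hE _ _ _ _ _ _ (log_monoid_group log_monoid_u) formu).
  by rewrite phase1 /m !expr0 expr1 !mulr1 divr1 mul1r.
rewrite (hE _ _ _ _ _ _ (log_monoid_group log_monoid_v) formv).
by rewrite phase1 /m !expr0 expr1 !mulr1 divr1 !mul1r.
Qed.

End DoublePoint.

(** * Branches of semistable charts and normal vectors *)

Section Topology.

Lemma within_open_continuous (S T : topologicalType) (A : set S) (f : S -> T) x :
  open A -> {within A, continuous f} -> A x -> {for x, continuous f}.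
Proof.
move=> oA /subspace_continuousP cf Ax B fB.
have := cf x Ax B fB; rewrite /= => H.
by apply: filterS (filterI (open_near oA Ax) H) => y [Ay]; exact.
Qed.

Lemma continuous_coords (K : numFieldType) (T : topologicalType) n
    (F : T -> 'rV[K]_n) x :
  (forall j, {for x, continuous (fun y => F y 0 j)}) -> {for x, continuous F}.
Proof.
move=> cF; apply/cvg_ballP => e e0.
have H : \forall y \near x, forall j, ball (F x 0 j) e (F y 0 j).
  apply: near_forall_ord => j.
  by have /cvg_ballP := cF j; exact.
by apply: filterS H => y Hy; split => // a b; rewrite (ord1 a).
Qed.

Lemma near_neq (K : numFieldType) (T : topologicalType) (f g : T -> K) x :
  {for x, continuous f} -> {for x, continuous g} -> f x != g x ->
  \forall y \near x, f y != g y.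
Proof.
move=> cf cg nz; have cd : {for x, continuous (fun y => f y - g y)}.
  exact: (cvgB cf cg).
have nz' : f x - g x != 0 by rewrite subr_eq0.
by apply: filterS (near_neq0 cd nz') => y; rewrite subr_eq0.
Qed.

End Topology.

Section Chart.
Variables (R : realType) (n : nat) (Y : manifold (Cx R) n.+1) (Q : set Y).
Variable c : semistable_chart Q.
Local Notation C := (Cx R).
Local Notation i0 := (inord 0 : 'I_n.+2).
Local Notation i1 := (inord 1 : 'I_n.+2).
Local Notation cc := (sc_c c).
Local Notation emb := (sc_emb c).
Local Notation ret := (sc_ret c).
Local Notation u := (@sc_u R n Y Q c).
Local Notation v := (@sc_v R n Y Q c).
Local Notation rV := 'rV[C]_n.+2.
Local Notation inv := Defs.inv.
Local Notation normal_space := Defs.normal_space.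
Implicit Types (q y : Y) (x : sc_tot c) (w : rV) (f a : Y -> C).

Lemma coord01 : i0 != i1.
Proof. by apply/eqP => /(congr1 val); rewrite /= !inordK. Qed.

Definition drop_u w : rV := \row_j if j == i0 then 0 else w 0 j.

Lemma drop_u_id w : w 0 i0 = 0 -> drop_u w = w.
Proof.
by move=> w0; apply/rowP => j; rewrite mxE; case: eqP => // ->.
Qed.

Lemma smooth_drop_u w j : smooth_near w (fun w => if j == i0 then 0 else w 0 j).
Proof.
by case: eqP => _; [exact: smooth_near_cst|exact: smooth_near_coord].
Qed.

Lemma drop_u_continuous w : {for w, continuous drop_u}.
Proof. by apply: continuous_row => j; exact: smooth_drop_u. Qed.

Lemma emb_dom y : sc_B c y -> dom cc (emb y).
Proof. by move/sc_emb_branch => []. Qed.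

Lemma u_emb y : sc_B c y -> u (emb y) = 0.
Proof. by move/sc_emb_branch => []. Qed.

Lemma drop_u_emb y : sc_B c y -> drop_u (coo cc (emb y)) = coo cc (emb y).
Proof. by move=> By; apply: drop_u_id; exact: u_emb. Qed.

Lemma emb_continuous y : sc_B c y -> {for y, continuous emb}.
Proof.
exact: within_open_continuous (@sc_B_open _ _ _ _ c) (@sc_emb_cont _ _ _ _ c).
Qed.

Lemma B_near y : sc_B c y -> \forall y' \near y, sc_B c y'.
Proof. by move=> By; exact: open_near (@sc_B_open _ _ _ _ c) By. Qed.

Lemma reg_emb y (g : sc_tot c -> C) : sc_B c y -> reg (emb y) g ->
  reg y (g \o emb).
Proof.
by move=> By rg; apply/(sc_emb_reg _ By); exists g => //; apply: nearW.
Qed.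

(** sc_ret is only meaningful on the branch u = 0; preceded by the projection along
    u, it gives a retraction of a neighbourhood onto the branch. *)
Definition branch w : Y := ret (inv cc (drop_u w)).

Definition branch_dom w := (coo cc @` dom cc) (drop_u w).

Lemma branch_dom_near w : branch_dom w -> \forall w' \near w, branch_dom w'.
Proof.
move=> bw; have [_ oi _ _ _] := sc_coords c.
exact: (drop_u_continuous (open_near oi bw)).
Qed.

Lemma branchP w : branch_dom w ->
  [/\ sc_B c (branch w), dom cc (emb (branch w)) &
      coo cc (emb (branch w)) = drop_u w].
Proof.
move=> bw; have [iw wE] := coords_image (sc_coords c) bw.
have u0 : u (inv cc (drop_u w)) = 0.
  by rewrite /sc_u /crd wE mxE eqxx.
have [Bw eE] := sc_retK iw u0.
by rewrite /branch eE.
Qed.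

Lemma branch_continuous w : branch_dom w -> {for w, continuous branch}.
Proof.
move=> bw; have [iw wE] := coords_image (sc_coords c) bw.
have u0 w' : branch_dom w' -> u (inv cc (drop_u w')) = 0.
  by move=> /(coords_image (sc_coords c))[_ E]; rewrite /sc_u /crd E mxE eqxx.
have /subspace_continuousP cr := @sc_ret_cont _ _ _ _ c.
move=> B rB; have := cr _ (conj iw (u0 _ bw)) B rB.
rewrite /= => H.
have cF : {for w, continuous (inv cc \o drop_u)}.
  apply: continuous_comp; first exact: drop_u_continuous.
  by rewrite -wE; exact: (inv_continuous (sc_coords c)).
have H2 : \forall w' \near w,
    (dom cc `&` [set x | crd cc 0 x = 0]) (inv cc (drop_u w')) ->
    B (branch w').
  exact: (cF _ H).
apply: filterS (filterI H2 (branch_dom_near bw)) => w' [Bw' bw']; apply: Bw'.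
split; first by have [] := coords_image (sc_coords c) bw'.
exact: u0.
Qed.

Lemma branch_emb y : sc_B c y ->
  branch_dom (coo cc (emb y)) /\ branch (coo cc (emb y)) = y.
Proof.
move=> By; have dy := emb_dom By.
rewrite /branch_dom /branch drop_u_emb//; split; first by exists (emb y).
by rewrite coords_inv ?sc_embK//; exact: sc_coords.
Qed.

(** Locally f is the restriction of a regular function g of the chart, and
    f \o branch is g after the projection along u. *)
Lemma smooth_branch w f : branch_dom w -> reg (branch w) f ->
  smooth_near w (f \o branch).
Proof.
move=> bw; have [Bw dw wE] := branchP bw.
move=> /(sc_emb_reg _ Bw)[g rg fg].
have /(regP _ (sc_coords c) dw) := rg; rewrite wE => sg.
have sG : smooth_near w (fun w => (g \o inv cc) (drop_u w)).
  apply: (smooth_near_comp (Phi := fun j w => if j == i0 then 0 else w 0 j)) => //.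
  exact: smooth_drop_u.
apply: near_eq_smooth_near sG.
have H : \forall w' \near w, f (branch w') = g (emb (branch w')).
  exact: (branch_continuous bw fg).
apply: filterS (filterI H (branch_dom_near bw)) => w' [/= -> bw'].
have [_ dw' wE'] := branchP bw'.
by rewrite -wE' coords_inv//; exact: sc_coords.
Qed.

Lemma reg_branch x f : dom cc x -> branch_dom (coo cc x) ->
  reg (branch (coo cc x)) f -> reg x (fun x => f (branch (coo cc x))).
Proof.
move=> dx bx rf.
exact: (reg_of_smooth (F := f \o branch) (sc_coords c) dx (smooth_branch bx rf)).
Qed.

(** A local equation of Q in the branch. *)
Definition eqn : Y -> C := v \o emb.

Lemma eqn_ideal y : sc_B c y -> ideal_at Q y eqn.
Proof.
move=> By; split; first by apply: reg_emb => //; apply: (reg_crd _ (sc_coords c)); exact: emb_dom.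
by apply: filterS (B_near By) => z Bz /(sc_emb_Q Bz).
Qed.

Lemma eqn0 q : sc_V c q -> eqn q = 0.
Proof. by move=> [Bq Qq]; exact/(sc_emb_Q Bq). Qed.

Lemma eqn_branch w : branch_dom w -> eqn (branch w) = w 0 i1.
Proof.
move=> bw; have [_ _ wE] := branchP bw.
by rewrite /eqn /= /sc_v /crd wE mxE eq_sym (negbTE coord01).
Qed.

(** The extension of f by the retraction vanishes on v = 0, hence it is divisible
    by the coordinate v. *)
Lemma ideal_generator q f : sc_V c q -> ideal_at Q q f ->
  exists2 a, reg q a & \forall y \near q, f y = a y * eqn y.
Proof.
move=> [Bq Qq] [rf f0]; pose p := coo cc (emb q).
have [bp pE] := branch_emb Bq; have dq := emb_dom Bq.
have sF : smooth_near p (f \o branch) by apply: smooth_branch; rewrite ?pE.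
have /smooth_nearP[d1 d10 sd1] := sF.
have fq : \forall w \near p, Q (branch w) -> f (branch w) = 0.
  have f0p : \forall y \near branch p, Q y -> f y = 0 by rewrite pE.
  exact: (branch_continuous bp f0p).
have fbq : \forall w \near p, (Q (branch w) -> f (branch w) = 0) /\ branch_dom w.
  exact: filterI fq (branch_dom_near bp).
have /nbhs_ballP[d2 /= d20 d2P] := fbq.
have [d1' d1'0 d1E] := gt0_toC d10; have [d2' d2'0 d2E] := gt0_toC d20.
pose d := toC (Num.min d1' d2').
have d0 : 0 < d by rewrite toC_gt0 lt_min d1'0.
have dd1 : d <= d1 by rewrite d1E toC_le ge_min lexx.
have dd2 : d <= d2 by rewrite d2E toC_le ge_min lexx orbT.
have sd : smooth_on (ball p d) (f \o branch).
  by apply: smooth_on_sub sd1; exact: le_ball.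
have vd w : ball p d w -> w 0 i1 = 0 -> (f \o branch) w = 0.
  move=> pw w1; have [H bw] := d2P _ (le_ball dd2 pw).
  apply: H; have [Bw _ _] := branchP bw.
  by apply/(sc_emb_Q Bw); have := eqn_branch bw; rewrite w1.
have oB : open (ball p d) by exact: ball_open.
have [g sg gE] := @smooth_division R _ i1 (ball p d) oB (f \o branch) sd vd.
have sgp : smooth_near p g by apply/smooth_nearP; exists d.
exists (fun y => g (coo cc (emb y))).
  by apply: (reg_emb (g := g \o coo cc) Bq); exact: (reg_of_smooth (sc_coords c)).
have H : \forall y \near q, ball p d (coo cc (emb y)).
  have H0 : \forall x \near emb q, ball p d (coo cc x).
    by apply: (near_coo (sc_coords c) dq); exact: nbhsx_ballx.
  exact: (emb_continuous Bq H0).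
apply: filterS (filterI H (B_near Bq)) => y [/gE + By].
by rewrite /= (branch_emb By).2 => ->; rewrite mulrC.
Qed.

(** Q is nowhere dense in the branch: follow the curve v = s from q. *)
Lemma eqn_cancel q (a a' : Y -> C) : sc_V c q ->
  {for q, continuous a} -> {for q, continuous a'} ->
  (\forall y \near q, a y * eqn y = a' y * eqn y) -> a q = a' q.
Proof.
move=> [Bq Qq] ca ca' H; pose p := coo cc (emb q).
have [bp pE] := branch_emb Bq.
pose l (s : C) : rV := p + s *: delta_mx 0 i1.
have l0 : l 0 = p by rewrite /l scale0r addr0.
have cl : {for 0, continuous l}.
  apply: differentiable_continuous; apply: differentiableD.
    exact: differentiable_cst.
  by apply: differentiableZl; exact: ex_diff.
have cb : {for 0, continuous (branch \o l)}.
  by apply: continuous_comp => //; rewrite l0; exact: branch_continuous.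
have b0 : (branch \o l) 0 = q by rewrite /= l0.
have N1 : \forall s \near (0 : C), branch_dom (l s).
  have N0 : \forall w \near l 0, branch_dom w by rewrite l0; exact: branch_dom_near.
  exact: (cl _ N0).
apply/eqP; apply/negP => /negP nz.
have nzq := near_neq ca ca' nz.
have N2 : \forall s \near (0 : C), a (branch (l s)) != a' (branch (l s)) /\
    a (branch (l s)) * eqn (branch (l s)) = a' (branch (l s)) * eqn (branch (l s)).
  have N3 : \forall y \near (branch \o l) 0,
      a y != a' y /\ a y * eqn y = a' y * eqn y by rewrite b0; exact: filterI.
  exact: (cb _ N3).
have N : \forall s \near (0 : C), branch_dom (l s) /\
    (a (branch (l s)) != a' (branch (l s)) /\
     a (branch (l s)) * eqn (branch (l s)) = a' (branch (l s)) * eqn (branch (l s))).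
  exact: filterI N1 N2.
have /nbhs_ballP[e /= e0 eP] := N.
have e20 : 0 < e / 2 by exact: divr_gt0.
have be : ball (0 : C) e (e / 2).
  rewrite -ball_normE /= sub0r normrN gtr0_norm// ltr_pdivrMr//.
  by rewrite ltr_pMr// ltr1n.
have [bl [n0 E]] := eP _ be.
have vE : eqn (branch (l (e / 2))) = e / 2.
  rewrite eqn_branch// !mxE !eqxx mulr1.
  have -> : p 0 i1 = 0 by have := eqn0 (conj Bq Qq).
  by rewrite add0r.
have ve : eqn (branch (l (e / 2))) != 0 by rewrite vE gt_eqF.
by case/eqP: n0; exact: (mulIf ve E).
Qed.

Section NormalSpace.
Variable q : Y.
Hypothesis Vq : sc_V c q.
Let Bq : sc_B c q := Vq.1.

Lemma normal_generator nu f a : normal_space Q q nu -> reg q a ->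
  (\forall y \near q, f y = a y * eqn y) -> nu f = a q * nu eqn.
Proof.
move=> [_ nM nE _] ra fa; have Ie := eqn_ideal Bq.
rewrite -nM//; apply/esym/nE.
  split; first by apply: regM => //; have [] := Ie.
  by have [_] := Ie; apply: filterS => y H /H ->; rewrite mulr0.
by apply: filterS fa => y ->.
Qed.

Lemma normal_eq nu nu' : normal_space Q q nu -> normal_space Q q nu' ->
  nu eqn = nu' eqn -> nu = nu'.
Proof.
move=> N N' E; apply/funext => f.
have [If|nf] := pselect (ideal_at Q q f); last first.
  by have [_ _ _ ->//] := N; have [_ _ _ ->//] := N'.
have [a ra fa] := ideal_generator Vq If.
by rewrite (normal_generator N ra fa) (normal_generator N' ra fa) E.
Qed.

Lemma normal_neq0 nu : normal_space Q q nu ->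
  (exists f, nu f != 0) <-> nu eqn != 0.
Proof.
move=> N; split=> [[f nf]|ne]; last by exists eqn.
have If : ideal_at Q q f.
  by apply: contrapT => no; move: nf; have [_ _ _ ->//] := N; rewrite eqxx.
have [a ra fa] := ideal_generator Vq If.
by move: nf; rewrite (normal_generator N ra fa) mulf_eq0 negb_or => /andP[].
Qed.

(** The vector sends a v to a(q) k; this is well defined since v is not a zero
    divisor. *)
Lemma normal_exists k : exists2 nu, normal_space Q q nu & nu eqn = k.
Proof.
pose is_value f z := exists a, [/\ reg q a,
  \forall y \near q, f y = a y * eqn y & z = a q * k].
pose nu f : C := if `[< ideal_at Q q f >] then xget 0 (is_value f) else 0.
have nuE f a : ideal_at Q q f -> reg q a ->
    (\forall y \near q, f y = a y * eqn y) -> nu f = a q * k.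
  move=> If ra fa; rewrite /nu asboolT//.
  case: xgetP => [z _ [b [rb fb ->]]|no]; last first.
    by case: (no (a q * k)); exists a.
  congr (_ * _); apply: eqn_cancel => //; try exact: reg_continuous.
  by apply: filterS (filterI fa fb) => y [<-].
have Ie := eqn_ideal Bq.
have e1 : \forall y \near q, eqn y = 1 * eqn y by apply: nearW => y; rewrite mul1r.
exists nu; last by rewrite (nuE _ (fun=> 1) Ie (reg_cst _ _) e1) mul1r.
split.
- move=> f g If Ig; have [a ra fa] := ideal_generator Vq If.
  have [b rb gb] := ideal_generator Vq Ig.
  rewrite (nuE _ _ If ra fa) (nuE _ _ Ig rb gb) -mulrDl.
  apply: (nuE _ (fun y => a y + b y)); [|exact: regD|].
    split; first by apply: regD; [case: If|case: Ig].
    by apply: filterS (filterI If.2 Ig.2) => y [H1 H2] Qy; rewrite H1// H2// addr0.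
  by apply: filterS (filterI fa gb) => y [-> ->]; rewrite mulrDl.
- move=> a f ra If; have [b rb fb] := ideal_generator Vq If.
  rewrite (nuE _ _ If rb fb) mulrA.
  apply: (nuE _ (fun y => a y * b y)); [|exact: regM|].
    split; first by apply: regM => //; case: If.
    by apply: filterS If.2 => y H Qy; rewrite H// mulr0.
  by apply: filterS fb => y ->; rewrite mulrA.
- move=> f g If fg; have [a ra fa] := ideal_generator Vq If.
  rewrite (nuE _ _ If ra fa); apply/esym/nuE => //.
    split; first by apply: near_eq_reg fg _; case: If.
    by apply: filterS (filterI fg If.2) => y [<-].
  by apply: filterS (filterI fg fa) => y [<-].
- by move=> f nf; rewrite /nu asboolF.
Qed.

End NormalSpace.

End Chart.

(** * Circle fibres and transition maps of charts *)

Arguments sc_u {R n Y Q} c x.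
Arguments sc_v {R n Y Q} c x.

Section PhaseTorsor.
Variables (R : realType) (n : nat) (Y : manifold (Cx R) n.+1) (Q : set Y).
Variables (theta : R) (c : semistable_chart Q).
Local Notation C := (Cx R).
Local Notation D := (sc_pi c @^-1` [set 0]).
Local Notation P := (sc_bundle theta c).
Implicit Types (q : Y) (p : sc_kn c).

Lemma norm_expi : `|expi theta| = 1 :> C.
Proof. by rewrite /expi normc_def /= cos2Dsin2 sqrtr1. Qed.

Lemma kn_eq p p' : kn_pt p = kn_pt p' -> kn_h p = kn_h p' -> p = p'.
Proof.
case: p p' => [x h xh] [x' h' xh'] /= e1 e2; rewrite -e1 -e2 in xh' *.
by congr KN; exact: Prop_irrelevance.
Qed.

Lemma emb_uv q : sc_V c q ->
  [/\ dom (sc_c c) (sc_emb c q), crd (sc_c c) 0 (sc_emb c q) = 0 &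
      crd (sc_c c) 1 (sc_emb c q) = 0].
Proof. by move=> Vq; have [Bq _] := Vq; split; [exact: emb_dom|exact: u_emb|exact: eqn0]. Qed.

Lemma bset_pt p : bset P p ->
  sc_V c (sc_ret c (kn_pt p)) /\ sc_emb c (sc_ret c (kn_pt p)) = kn_pt p.
Proof. by move=> [[q Vq <-] _]; rewrite sc_embK//; case: Vq. Qed.

Lemma bset_uv p : bset P p ->
  [/\ `|kn_h p (sc_u c)| = 1, `|kn_h p (sc_v c)| = 1 &
      kn_h p (sc_u c) * kn_h p (sc_v c) = expi theta].
Proof.
move=> [[q Vq qE] <-]; have [d0 u0 v0] := emb_uv Vq; rewrite qE in d0 u0 v0.
have hp := kn_phase p.
split; first exact: (log_phase_norm hp (log_monoid_u (sc_coords c) (@sc_t _ _ _ _ c) d0)).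
  exact: (log_phase_norm hp (log_monoid_v (sc_coords c) (@sc_t _ _ _ _ c) d0)).
by rewrite (log_phase_pi (sc_coords c) (@sc_t _ _ _ _ c) d0 hp).
Qed.

Lemma bset_eq p p' : bset P p -> bset P p' -> kn_pt p = kn_pt p' ->
  kn_h p (sc_v c) = kn_h p' (sc_v c) -> p = p'.
Proof.
move=> Pp Pp' e ev; apply: kn_eq => //.
have [q Vq qE] := Pp.1; have [d0 u0 v0] := emb_uv Vq; rewrite qE in d0 u0 v0.
have hp' := kn_phase p'; rewrite -e in hp'.
apply: (log_phase_eq (sc_coords c) (@sc_t _ _ _ _ c) d0 u0 v0 (kn_phase p) hp') => //.
have [_ n1 E1] := bset_uv Pp; have [_ _ E2] := bset_uv Pp'.
by apply: (mulIf (norm1_neq0 n1)); rewrite [RHS]mulrC E1 ev mulrC E2.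
Qed.

Lemma bset_exists q (rho : C) : sc_V c q -> `|rho| = 1 ->
  exists p, [/\ bset P p, kn_pt p = sc_emb c q & kn_h p (sc_v c) = rho].
Proof.
move=> Vq r1; have [d0 u0 v0] := emb_uv Vq.
have n2 : `|expi theta / rho| = 1 :> C by rewrite normrM normfV norm_expi r1 divr1.
have [h [hh hu hv]] :=
  log_phase_exists (sc_coords c) (@sc_t _ _ _ _ c) d0 u0 v0 n2 r1.
exists (KN hh); split => //; split; first by exists q.
rewrite /= (log_phase_pi (sc_coords c) (@sc_t _ _ _ _ c) d0 hh) hu hv divfK//.
exact: norm1_neq0.
Qed.

Lemma act_bset k p : `|k| = 1 -> bset P p ->
  [/\ bset P (sc_act k p), kn_pt (sc_act k p) = kn_pt p &
      kn_h (sc_act k p) (sc_v c) = k * kn_h p (sc_v c)].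
Proof.
move=> k1 Pp; have [Vq qE] := bset_pt Pp; have [_ n1 E] := bset_uv Pp.
have nk : `|k * kn_h p (sc_v c)| = 1 by rewrite normrM k1 n1 mulr1.
have [p1 [P1 p1E p1v]] := bset_exists Vq nk; have [_ _ E1] := bset_uv P1.
have k0 := norm1_neq0 k1; have v0 := norm1_neq0 n1.
rewrite /sc_act; case: xgetP => [p2 _ [e1 e2 e3]|no]; last first.
  case: (no p1); split; [by rewrite p1E|  |by []].
  apply: (mulIf (mulf_neq0 k0 v0)); rewrite -[X in _ * X = _]p1v E1.
  by rewrite mulrACA mulVf// mul1r E.
split => //; split; first by rewrite e1; case: Pp.
have [q Vq' qE'] := Pp.1; have [d0 _ _] := emb_uv Vq'; rewrite qE' -e1 in d0.
rewrite (log_phase_pi (sc_coords c) (@sc_t _ _ _ _ c) d0 (kn_phase p2)).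
by rewrite e2 e3 mulrACA mulVf// mul1r E.
Qed.

End PhaseTorsor.

Section Transition.
Variables (R : realType) (n : nat) (Y : manifold (Cx R) n.+1) (Q : set Y).
Local Notation C := (Cx R).
Local Notation i0 := (inord 0 : 'I_n.+2).
Local Notation i1 := (inord 1 : 'I_n.+2).
Local Notation inv := Defs.inv.
Implicit Types (c : semistable_chart Q) (q y : Y) (a : Y -> C).

(** Both local equations generate the ideal of Q. *)
Lemma transition_exists c c' q : sc_V c q -> sc_V c' q -> exists a,
  [/\ reg q a, a q != 0 & \forall y \near q, eqn c' y = a y * eqn c y].
Proof.
move=> Vq Vq'.
have [a ra Ea] := ideal_generator Vq (eqn_ideal Vq'.1).
have [b rb Eb] := ideal_generator Vq' (eqn_ideal Vq.1).
exists a; split => //.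
have : b q * a q = 1.
  apply: (eqn_cancel Vq (a := fun y => b y * a y) (a' := fun=> 1)).
  - exact: (reg_continuous (regM rb ra)).
  - exact: (reg_continuous (reg_cst q 1)).
  apply: filterS (filterI Ea Eb) => y [e1 e2].
  by rewrite -mulrA -e1 -e2 mul1r.
by move=> ba; apply/eqP => a0; move: ba; rewrite a0 mulr0 => /eqP; rewrite eq_sym oner_eq0.
Qed.

Definition foot c (x : sc_tot c) : Y := branch c (coo (sc_c c) x).

Definition foot_dom c (x : sc_tot c) : Prop :=
  dom (sc_c c) x /\ branch_dom c (coo (sc_c c) x).

(** Coordinates in c' of the local isomorphism that extends the identity of the
    branch. If the local equations of Q satisfy v' = a v, then u is divided by a,
    so that u'v' = uv. *)
Definition trans_row c c' a (x : sc_tot c) : 'rV[C]_n.+2 :=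
  \row_j if j == i0 then sc_u c x / a (foot x)
         else coo (sc_c c') (sc_emb c' (foot x)) 0 j.

Definition trans c c' a (x : sc_tot c) : sc_tot c' :=
  inv (sc_c c') (trans_row c' a x).

Definition trans_dom c c' a (x : sc_tot c) : Prop :=
  [/\ foot_dom x, sc_B c' (foot x), reg (foot x) a /\ a (foot x) != 0,
      eqn c' (foot x) = a (foot x) * eqn c (foot x) &
      (coo (sc_c c') @` dom (sc_c c')) (trans_row c' a x)].

Section Properties.
Variables (c c' : semistable_chart Q) (a : Y -> C) (x : sc_tot c).
Hypothesis tx : trans_dom c' a x.

Lemma trans_coo : dom (sc_c c') (trans c' a x) /\
  coo (sc_c c') (trans c' a x) = trans_row c' a x.
Proof. by have [_ _ _ _ H] := tx; exact: coords_image (sc_coords c') H. Qed.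

Lemma drop_trans_row :
  drop_u (trans_row c' a x) = coo (sc_c c') (sc_emb c' (foot x)).
Proof.
have [_ B' _ _ _] := tx.
apply/rowP => j; rewrite !mxE; case: eqP => [->|//].
by have := u_emb B'.
Qed.

Lemma foot_trans : foot_dom (trans c' a x) /\ foot (trans c' a x) = foot x.
Proof.
have [_ B' _ _ _] := tx; have [dx xE] := trans_coo.
have [bd bE] := branch_emb B'.
have E w : drop_u w = coo (sc_c c') (sc_emb c' (foot x)) ->
    branch_dom c' w /\ branch c' w = foot x.
  move=> wE; rewrite /branch_dom /branch wE -[X in branch c' X = _]/(_) in bd bE *.
  by move: bd bE; rewrite /branch_dom /branch (drop_u_emb B').
have [e1 e2] := E _ drop_trans_row.
by split; [split => //; rewrite xE|rewrite /foot xE].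
Qed.

Lemma trans_u : sc_u c' (trans c' a x) = sc_u c x / a (foot x).
Proof. by rewrite /sc_u /crd trans_coo.2 mxE eqxx. Qed.

Lemma trans_v : sc_v c' (trans c' a x) = a (foot x) * sc_v c x.
Proof.
have [[dx bx] _ _ E _] := tx.
rewrite {1}/sc_v /crd trans_coo.2 mxE eq_sym (negbTE (coord01 n)).
transitivity (eqn c' (foot x)); first by [].
by rewrite E; congr (_ * _); rewrite /foot eqn_branch.
Qed.

Lemma trans_pi : sc_pi c' (trans c' a x) = sc_pi c x.
Proof.
have [[dx _] _ [_ a0] _ _] := tx.
rewrite (sc_t trans_coo.1) (sc_t dx).
have := trans_u; have := trans_v; rewrite /sc_u /sc_v => -> ->.
by rewrite mulrA divfK.
Qed.

Let reg_trans_row j : reg x (fun z => trans_row c' a z 0 j).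
Proof.
have [[dx bx] B' [ra a0] _ _] := tx.
have [e|ne] := eqVneq j i0.
  have r : reg x (fun z => sc_u c z * (a (foot z))^-1).
    apply: regM; first exact: (reg_crd _ (sc_coords c) dx).
    by apply: (regV (f := fun z => a (foot z))) => //; exact: reg_branch.
  by apply: near_eq_reg r; apply: nearW => y; rewrite mxE e eqxx.
have r : reg x (fun z => coo (sc_c c') (sc_emb c' (foot z)) 0 j).
  apply: (reg_branch (f := fun b => coo (sc_c c') (sc_emb c' b) 0 j) dx bx).
  apply: (reg_emb (g := fun z => coo (sc_c c') z 0 j) B').
  by apply: (reg_crd _ (sc_coords c')); exact: emb_dom.
by apply: near_eq_reg r; apply: nearW => y; rewrite mxE (negbTE ne).
Qed.

Lemma trans_regular : {for x, continuous (trans c' a)} /\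
  forall g, reg (trans c' a x) g -> reg x (g \o trans c' a).
Proof.
have [dx xE] := trans_coo.
have cr : {for x, continuous (trans_row c' a)}.
  by apply: continuous_coords => j; exact: reg_continuous.
split.
  apply: (@continuous_comp _ _ _ (trans_row c' a) (inv (sc_c c'))) => //.
  by rewrite -xE; exact: (inv_continuous (sc_coords c') dx).
move=> g /(regP _ (sc_coords c') dx); rewrite xE => sg.
have rE z : trans_row c' a z = \row_j trans_row c' a z 0 j.
  by apply/rowP => j; rewrite [RHS]mxE.
rewrite rE in sg.
apply: near_eq_reg (reg_comp (Phi := fun j z => trans_row c' a z 0 j) sg reg_trans_row).
by apply: nearW => y; rewrite -rE.
Qed.

Lemma transK : trans c (fun y => (a y)^-1) (trans c' a x) = x.
Proof.
have [[dx bx] _ [_ a0] _ _] := tx; have [_ ftE] := foot_trans.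
rewrite /trans -/(trans c' a x) -[RHS](coords_inv (sc_coords c) dx).
congr (inv _ _); apply/rowP => j; rewrite mxE ftE trans_u invrK divfK//.
case: eqP => [->//|/eqP ne].
by have [_ _ ->] := branchP bx; rewrite mxE (negbTE ne).
Qed.

End Properties.

Lemma foot_emb c y : sc_B c y -> foot_dom (sc_emb c y) /\ foot (sc_emb c y) = y.
Proof.
move=> By; have [e1 e2] := branch_emb By.
by split => //; split => //; exact: emb_dom.
Qed.

Lemma trans_row_emb c c' a y : sc_B c y -> sc_B c' y ->
  trans_row c' a (sc_emb c y) = coo (sc_c c') (sc_emb c' y).
Proof.
move=> By By'; apply/rowP => j; rewrite mxE (foot_emb By).2 u_emb// mul0r.
by case: eqP => // ->; rewrite -(u_emb By').
Qed.

Lemma trans_emb c c' a y : sc_B c y -> sc_B c' y ->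
  trans c' a (sc_emb c y) = sc_emb c' y.
Proof.
move=> By By'; rewrite /trans trans_row_emb// coords_inv//.
  exact: sc_coords.
exact: emb_dom.
Qed.

Lemma near_foot c q (S : Y -> Prop) : sc_B c q -> (\forall y \near q, S y) ->
  \forall x \near sc_emb c q, foot_dom x /\ S (foot x).
Proof.
move=> Bq Sq; have [[dx bx] fE] := foot_emb Bq.
have cf : {for sc_emb c q, continuous (@foot c)}.
  apply: continuous_comp; first exact: (coo_continuous (sc_coords c) dx).
  exact: branch_continuous.
have H1 : \forall x \near sc_emb c q, S (foot x).
  by apply: cf; rewrite fE.
have H2 : \forall x \near sc_emb c q, branch_dom c (coo (sc_c c) x).
  exact: (near_coo (sc_coords c) dx (branch_dom_near bx)).
by apply: filterS (filterI (coords_near (sc_coords c) dx) (filterI H2 H1)) => x [? []].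
Qed.

Lemma trans_dom_near c c' a q : sc_V c q -> sc_V c' q -> reg q a -> a q != 0 ->
  (\forall y \near q, eqn c' y = a y * eqn c y) ->
  \forall x \near sc_emb c q, trans_dom c' a x.
Proof.
move=> [Bq Qq] [Bq' _] ra a0 Ea; have [[dx bx] fE] := foot_emb Bq.
have H : \forall y \near q, [/\ sc_B c' y, reg y a, a y != 0 &
    eqn c' y = a y * eqn c y].
  by apply: filterS (filterI (filterI (B_near Bq') (reg_near ra)) (filterI
    (near_neq0 (reg_continuous ra) a0) Ea)) => y [[? ?] [? ?]].
have cr : {for sc_emb c q, continuous (trans_row (c := c) c' a)}.
  apply: continuous_coords => j.
  have [e|ne] := eqVneq j i0.
    have r : reg (sc_emb c q) (fun z => sc_u c z * (a (foot z))^-1).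
      apply: regM; first exact: (reg_crd _ (sc_coords c) dx).
      by apply: (regV (f := fun z => a (foot z))); rewrite ?fE//;
        apply: reg_branch => //; rewrite -/(foot _) fE.
    apply: reg_continuous; apply: near_eq_reg r.
    by apply: nearW => y; rewrite mxE e eqxx.
  have r : reg (sc_emb c q) (fun z => coo (sc_c c') (sc_emb c' (foot z)) 0 j).
    apply: (reg_branch (f := fun b => coo (sc_c c') (sc_emb c' b) 0 j) dx bx).
    rewrite -/(foot _) fE.
    apply: (reg_emb (g := fun z => coo (sc_c c') z 0 j) Bq').
    by apply: (reg_crd _ (sc_coords c')); exact: emb_dom.
  apply: reg_continuous; apply: near_eq_reg r.
  by apply: nearW => y; rewrite mxE (negbTE ne).
have H2 : \forall x \near sc_emb c q,
    (coo (sc_c c') @` dom (sc_c c')) (trans_row c' a x).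
  apply: cr; rewrite trans_row_emb//.
  by apply: (coords_image_near (sc_coords c')); exact: emb_dom.
by apply: filterS (filterI (near_foot Bq H) H2) => x [[? [? ? ? ?]] ?].
Qed.

End Transition.

(** * Canonical identifications of phases *)

Section Pullback.
Variables (R : realType) (n m : nat) (X : manifold (Cx R) n).
Variables (X' : manifold (Cx R) m) (D : set X) (D' : set X') (om : X -> X') (x : X).
Local Notation C := (Cx R).
Hypothesis com : {for x, continuous om}.
Hypothesis rom : forall g, reg (om x) g -> reg x (g \o om).
Hypothesis Dom : \forall y \near x, D y <-> D' (om y).
Implicit Types (f g : X' -> C) (h : (X -> C) -> C).

Let near_om (S : X' -> Prop) :
  (\forall z \near om x, S z) -> \forall y \near x, S (om y).
Proof. by move=> H; exact: (com H). Qed.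

Lemma log_monoid_pullback f : log_monoid D' (om x) f -> log_monoid D x (f \o om).
Proof.
move=> [rf nf]; split; first exact: rom.
by apply: filterS (filterI (near_om nf) Dom) => y [H E] nD; apply: H => /E.
Qed.

Lemma log_group_pullback f : log_group D' (om x) f -> log_group D x (f \o om).
Proof.
move=> [g [h [mg mh fE]]]; exists (g \o om), (h \o om).
split; [exact: log_monoid_pullback|exact: log_monoid_pullback|].
by apply: filterS (filterI (near_om fE) Dom) => y [H E] nD; apply: H => /E.
Qed.

(** Composition of h with the pullback by om, which is only defined on the log
    group at om x. *)
Definition push_phase h f : C :=
  if `[< log_group D' (om x) f >] then h (f \o om) else 0.

Lemma push_phaseE h f : log_group D' (om x) f -> push_phase h f = h (f \o om).
Proof. by move=> gf; rewrite /push_phase asboolT. Qed.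

Lemma push_log_phase h : is_log_phase D x h -> is_log_phase D' (om x) (push_phase h).
Proof.
move=> [h1 hM he hu h0]; split.
- by move=> f gf; rewrite push_phaseE// h1//; exact: log_group_pullback.
- move=> f g gf gg; rewrite !push_phaseE//; last exact: log_groupM.
  by rewrite -hM//; exact: log_group_pullback.
- move=> f g gf fg; have gg : log_group D' (om x) g.
    have [f1 [f2 [m1 m2 e1]]] := gf; exists f1, f2; split => //.
    by apply: filterS (filterI e1 fg) => y [e2 e3] nD; rewrite -e3// e2.
  rewrite !push_phaseE//; apply: he; first exact: log_group_pullback.
  by apply: filterS (filterI (near_om fg) Dom) => y [H E] nD; apply: H => /E.
- move=> f rf nf; have gf := log_monoid_group (unit_log_monoid D' rf nf).
  rewrite push_phaseE//; apply: hu => //; exact: rom.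
- by move=> f nf; rewrite /push_phase asboolF.
Qed.

End Pullback.

Section Identification.
Variables (R : realType) (n : nat) (Y : manifold (Cx R) n.+1) (Q : set Y).
Variable theta : R.
Variables (c c' : semistable_chart Q).
Local Notation C := (Cx R).
Local Notation D := (sc_pi c @^-1` [set 0]).
Local Notation D' := (sc_pi c' @^-1` [set 0]).
Local Notation hc := (sc_coords c).
Local Notation hc' := (sc_coords c').
Local Notation pE := (@sc_t R n Y Q c).
Local Notation pE' := (@sc_t R n Y Q c').
Implicit Types (q y : Y) (a : Y -> C) (p : sc_kn c).

(** The pullback of v' is E u^k v^l for a unit E, and its restriction to the branch
    u = 0 is the local equation a v of Q. Hence k = 0, l = 1 and E = a at q, so that
    the phase of v' is the phase of a(q) times that of v. *)
Lemma identified_circle p (p' : sc_kn c') : kn_identified p p' ->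
  exists q, [/\ sc_V c q, sc_V c' q, kn_pt p = sc_emb c q,
    kn_pt p' = sc_emb c' q &
    forall a, reg q a -> (\forall y \near q, eqn c' y = a y * eqn c y) ->
      kn_h p' (sc_v c') = phase (a q) * kn_h p (sc_v c)].
Proof.
move=> [q [ O [ O' [ om [ om' H]]]]].
have [[Vq Vq' e e'] [[ oO Ox] nO' rO _] [ omK _] [ omp omE] hE] := H.
exists q; split => // a ra Ea.
have [Bq _] := Vq; have [Bq' _] := Vq'.
have [d0 u0 v0] := emb_uv Vq; have [d0' u0' v0'] := emb_uv Vq'.
rewrite e in Ox; have [com rom] := rO _ Ox.
have omx : om (sc_emb c q) = sc_emb c' q by exact: (nbhs_singleton omE).
have Dom : \forall y \near sc_emb c q, D y <-> D' (om y).
  by apply: filterS (open_near oO Ox) => y Oy; rewrite /preimage /= omp.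
have mv' : log_monoid D' (om (sc_emb c q)) (sc_v c').
  by rewrite omx; exact: (log_monoid_v hc' pE' d0').
have [E [k [l [rE nE EE]]]] :=
  log_monoid_factor hc pE d0 u0 v0 (log_monoid_pullback com rom Dom mv').
have cE : {for q, continuous (fun y => E (sc_emb c y))}.
  exact: (reg_continuous (reg_emb Bq rE)).
have EB : \forall y \near q,
    a y * eqn c y = E (sc_emb c y) * (0 ^+ k * eqn c y ^+ l).
  have H1 : \forall y \near q, (sc_v c' \o om) (sc_emb c y) =
      E (sc_emb c y) * (sc_u c (sc_emb c y) ^+ k * sc_v c (sc_emb c y) ^+ l).
    exact: (emb_continuous Bq EE).
  apply: filterS (filterI (filterI H1 (B_near Bq)) (filterI omE Ea)).
  move=> y [[E1 By] [E2 E3]].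
  by rewrite -E3 -(u_emb By) -E1 /= E2.
have a0 : a q != 0.
  have [b [rb b0 Eb]] := transition_exists Vq Vq'.
  have <- // : b q = a q.
  apply: (eqn_cancel Vq (reg_continuous rb) (reg_continuous ra)).
  by apply: filterS (filterI Ea Eb) => y [-> ->].
have k0 : k = 0%N.
  case: k {EE} EB => // k EB; case/eqP: a0.
  apply: (eqn_cancel Vq (reg_continuous ra) (a' := fun=> 0)).
    exact: (reg_continuous (reg_cst q 0)).
  by apply: filterS EB => y ->; rewrite expr0n mul0r mulr0 mul0r.
rewrite k0 in EB EE.
have l1 : l = 1%N /\ a q = E (sc_emb c q).
  case: l {EE} EB => [|l] EB.
    have := nbhs_singleton EB; rewrite (eqn0 Vq) mulr0 !expr0 !mulr1 => E0.
    by move: nE; rewrite -E0 eqxx.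
  have aE : a q = E (sc_emb c q) * eqn c q ^+ l.
    apply: (eqn_cancel Vq (reg_continuous ra)
      (a' := fun y => E (sc_emb c y) * eqn c y ^+ l)).
      apply: (cvgM cE); exact: (reg_continuous (regX l (eqn_ideal Bq).1)).
    by apply: filterS EB => y ->; rewrite expr0 mul1r exprSr mulrA.
  case: l {EB} aE => [|l] aE; first by split => //; rewrite aE expr0 mulr1.
  by case/eqP: a0; rewrite aE (eqn0 Vq) expr0n mulr0.
have [l1E ->] := l1.
have hp : is_log_phase D (sc_emb c q) (kn_h p) by rewrite -e; exact: kn_phase.
have gv : log_group D (sc_emb c q) (sc_v c).
  exact: (log_monoid_group (log_monoid_v hc pE d0)).
have gE : log_group D (sc_emb c q) E.
  exact: (log_monoid_group (unit_log_monoid D rE nE)).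
rewrite hE; last first.
  by rewrite e' -omx; exact: (log_monoid_group mv').
have [_ hM he hu _] := hp.
rewrite -(hu _ rE nE) -hM//; apply: he.
  by apply: (log_group_pullback com rom Dom); exact: (log_monoid_group mv').
by apply: filterS EE => y -> _; rewrite l1E expr0 mul1r expr1.
Qed.

(** The isomorphism trans over the disc moves the phase of p to one with the same
    values as that of p' on v' and on the parameter t, hence on u'. *)
Lemma circle_identified q a p (p' : sc_kn c') :
  bset (sc_bundle theta c) p -> bset (sc_bundle theta c') p' ->
  sc_V c q -> sc_V c' q -> kn_pt p = sc_emb c q -> kn_pt p' = sc_emb c' q ->
  reg q a -> a q != 0 -> (\forall y \near q, eqn c' y = a y * eqn c y) ->
  kn_h p' (sc_v c') = phase (a q) * kn_h p (sc_v c) ->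
  kn_identified p p'.
Proof.
move=> Pp Pp' Vq Vq' e e' ra a0 Ea hv.
have [Bq _] := Vq; have [Bq' _] := Vq'.
have [d0 u0 v0] := emb_uv Vq; have [d0' u0' v0'] := emb_uv Vq'.
pose b y := (a y)^-1; pose x := sc_emb c q; pose x' := sc_emb c' q.
have rb : reg q b by exact: regV.
have b0 : b q != 0 by rewrite invr_eq0.
have Eb : \forall y \near q, eqn c y = b y * eqn c' y.
  apply: filterS (filterI Ea (near_neq0 (reg_continuous ra) a0)) => y [-> ay].
  by rewrite /b mulKf.
have [ O1 [ oO1 O1x tO1]] := near_open_nbhs (trans_dom_near Vq Vq' ra a0 Ea).
have [ O1' [ oO1' O1x' tO1']] := near_open_nbhs (trans_dom_near Vq' Vq rb b0 Eb).
pose om := @trans _ _ _ _ c c' a; pose om' := @trans _ _ _ _ c' c b.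
have omK z : O1 z -> om' (om z) = z by move/tO1/transK.
have om'K z : O1' z -> om (om' z) = z.
  move=> /tO1'/transK; rewrite (_ : (fun y => (b y)^-1) = a) //.
  by apply/funext => y; rewrite /b invrK.
pose O := O1 `&` om @^-1` O1'; pose O' := O1' `&` om' @^-1` O1.
have omx : om x = x' by exact: trans_emb.
have omx' : om' x' = x by exact: trans_emb.
have oO : open O.
  rewrite openE => z [Oz O'z]; apply: filterI; first exact: open_near.
  exact: ((trans_regular (tO1 _ Oz)).1 _ (open_near oO1' O'z)).
have oO' : open O'.
  rewrite openE => z [Oz O'z]; apply: filterI; first exact: open_near.
  exact: ((trans_regular (tO1' _ Oz)).1 _ (open_near oO1 O'z)).
have Ox : O x by split => //; rewrite /preimage /= omx.
have Ox' : O' x' by split => //; rewrite /preimage /= omx'.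
exists q, O, O', om, om'; split.
- by [].
- split; [by rewrite e|by rewrite e'| |].
    by move=> z [Oz _]; exact: trans_regular (tO1 _ Oz).
  by move=> z [Oz _]; exact: trans_regular (tO1' _ Oz).
- split=> z [Oz O'z].
    by split; [split => //; rewrite /preimage /= omK|exact: omK].
  by split; [split => //; rewrite /preimage /= om'K|exact: om'K].
- split=> [z [Oz _]|]; first exact: trans_pi (tO1 _ Oz).
  by apply: filterS (filterI (B_near Bq) (B_near Bq')) => y [By By']; exact: trans_emb.
have [com rom] := trans_regular (tO1 _ O1x).
have Dom : \forall y \near x, D y <-> D' (om y).
  apply: filterS (open_near oO1 O1x) => y Oy.
  by rewrite /preimage /= (trans_pi (tO1 _ Oy)).
have hp : is_log_phase D x (kn_h p) by rewrite /x -e; exact: kn_phase.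
have hp' : is_log_phase D' x' (kn_h p') by rewrite /x' -e'; exact: kn_phase.
have hpp : is_log_phase D' (om x) (push_phase D' om x (kn_h p)).
  exact: (push_log_phase com rom Dom hp).
rewrite omx in hpp.
have mu : log_monoid D x (sc_u c) by exact: (log_monoid_u hc pE d0).
have mv : log_monoid D x (sc_v c) by exact: (log_monoid_v hc pE d0).
have mu' : log_monoid D' (om x) (sc_u c').
  by rewrite omx; exact: (log_monoid_u hc' pE' d0').
have mv' : log_monoid D' (om x) (sc_v c').
  by rewrite omx; exact: (log_monoid_v hc' pE' d0').
have fx : foot x = q by have [] := foot_emb Bq.
have raf : reg x (fun z => a (foot z)).
  have [[dx bx] _ _ _ _] := tO1 _ O1x.
  by apply: reg_branch => //; rewrite -/(foot x) fx.
have af0 : a (foot x) != 0 by rewrite fx.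
have ga : log_group D x (fun z => a (foot z)).
  exact: (log_monoid_group (unit_log_monoid D raf af0)).
have [_ hM he hu _] := hp.
have pv : push_phase D' om x (kn_h p) (sc_v c') = kn_h p' (sc_v c').
  rewrite push_phaseE; last exact: log_monoid_group.
  rewrite hv -{1}fx -(hu _ raf af0) -hM//; last exact: log_monoid_group.
  apply: he; first by apply: (log_group_pullback com rom Dom); exact: log_monoid_group.
  by apply: filterS (open_near oO1 O1x) => y Oy _; exact: trans_v (tO1 _ Oy).
rewrite -(_ : push_phase D' om x (kn_h p) = kn_h p').
  by move=> f; rewrite e' => gf; rewrite push_phaseE// omx.
have nv' : kn_h p' (sc_v c') != 0.
  by apply: norm1_neq0; have [] := bset_uv Pp'.
apply: (log_phase_eq hc' pE' d0' u0' v0' hpp hp') => //.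
apply: (mulIf nv').
have [_ _ E2] := bset_uv Pp'.
rewrite -[X in _ = X]/(kn_h p' (sc_u c') * kn_h p' (sc_v c')) E2 -pv.
rewrite -(log_phase_pi hc' pE' d0' hpp).
have mp : log_monoid D' (om x) (sc_pi c').
  by rewrite omx; exact: (log_monoid_pi hc' pE' d0').
rewrite push_phaseE; last exact: log_monoid_group.
have [_ <-] := Pp; apply: he.
  by apply: (log_group_pullback com rom Dom); exact: log_monoid_group.
by apply: filterS (open_near oO1 O1x) => y Oy _; exact: trans_pi (tO1 _ Oy).
Qed.

End Identification.

(** * Subbases, and charts of a semistable family *)

Definition generated_topology (T : Type) (I : choiceType) (D : set I)
    (b : I -> set T) : set (set T) :=
  [set \bigcup_(S in E) S | E in subset^~ (finI_from D b)].

Section SubbaseTopology.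
Variables (T : topologicalType) (I : choiceType) (D : set I) (b : I -> set T).
Hypothesis openP : forall A : set T,
  open A <-> generated_topology D b A.

Lemma subbase_open i : D i -> open (b i).
Proof.
move=> Di; apply/openP; exists [set b i]; last by rewrite bigcup_set1.
by move=> _ ->; exact: finI_from1.
Qed.

Lemma subbase_cvg (F : set_system T) x : Filter F ->
  (forall i, D i -> b i x -> F (b i)) -> F --> x.
Proof.
move=> FF H A; rewrite nbhsE => -[B [/openP[E sE <-]] [S ES Sx] BA].
apply: filterS BA _; apply: filterS (_ : F S); first by move=> y Sy; exists S.
have [J sJ SE] := sE _ ES; rewrite -SE; rewrite -SE in Sx.
have /= := @filter_bigI T I J b F FF.
by apply => i iJ; apply: H; [have := sJ _ iJ; rewrite inE|exact: Sx].
Qed.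

End SubbaseTopology.

Section Spaces.
Variables (R : realType) (n : nat).

Section KN.
Variables (X : manifold (Cx R) n) (D : set X).

Lemma kn_openP (A : set (kn D)) :
  open A <-> generated_topology (kn_index D) (@kn_subbase R n X D) A.
Proof. by []. Qed.

End KN.

Section NV.
Variables (Y : manifold (Cx R) n) (Q : set Y).

Lemma nvec_openP (A : set (nvec Q)) :
  open A <-> generated_topology (nvec_index Q) (@nvec_subbase R n Y Q) A.
Proof. by []. Qed.

End NV.
End Spaces.

Section ChartExistence.
Variables (R : realType) (n : nat) (Y : manifold (Cx R) n.+1) (Q : set Y).
Variables (X : manifold (Cx R) n.+2) (p : X -> Cx R) (j : Y -> X).
Local Notation C := (Cx R).

Lemma chart_of_embedding (c : coord_system C X n.+2) q :
  flat_to_disc p -> closed_embedding j -> coords c -> dom c (j q) ->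
  (forall x, dom c x -> [/\ p x = crd c 0 x * crd c 1 x,
     range j x <-> crd c 0 x = 0 &
     forall y, x = j y -> (Q y <-> crd c 1 x = 0)]) ->
  Q q -> exists k : semistable_chart Q, sc_V k q.
Proof.
move=> fp [ij cj clj regj] hc cq cE Qq.
pose ret x := xget q [set y | j y = x].
have retK y : ret (j y) = y.
  by apply: ij; rewrite /ret; case: xgetP => // no; case: (no y).
have oB : open (j @^-1` dom c).
  by apply: open_comp => [y _|]; [exact: cj|case: hc].
have retE x : dom c x -> crd c 0 x = 0 -> (j @^-1` dom c) (ret x) /\ j (ret x) = x.
  move=> cx x0; have [_ + _] := cE _ cx => /iffRL/(_ x0)[y _ yx]; rewrite -yx retK; split => //.
  by rewrite /preimage /= yx.
have embE y : (j @^-1` dom c) y -> dom c (j y) /\ crd c 0 (j y) = 0.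
  by move=> cy; split => //; have [_ H _] := cE _ cy; apply/H; exists y.
have ec : {within j @^-1` dom c, continuous j}.
  by apply: continuous_subspaceT.
have rc : {within dom c `&` [set x | crd c 0 x = 0], continuous ret}.
  apply/subspace_continuousP => x [cx x0] U Ux.
  have [_ jE] := retE _ cx x0; rewrite nbhsE in Ux; have [B [oB' Bx] BU] := Ux.
  have cl : closed (j @` ~` B) by apply: clj; exact: open_closedC.
  have nx : (~` (j @` ~` B)) x.
    by move=> [y nBy yx]; apply: nBy; rewrite -(retK y) yx.
  rewrite /=; apply: filterS (open_near (closed_openC cl) nx) => z nz [cz z0].
  apply: BU; apply: contrapT => nB; apply: nz; exists (ret z) => //.
  by have [] := retE _ cz z0.
have er y f : (j @^-1` dom c) y -> (reg y f <-> exists2 g, reg (j y) g &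
    \forall y' \near y, f y' = g (j y')) by move=> _; exact: regj.
have eQ y : (j @^-1` dom c) y -> (Q y <-> crd c 1 (j y) = 0).
  by move=> cy; have [_ _] := cE _ cy; apply.
have ptE x : dom c x -> p x = crd c 0 x * crd c 1 x by move=> /cE[].
exists (@SemistableChart R n Y Q X p fp c hc ptE (j @^-1` dom c) oB j ret
  (fun y _ => retK y) retE embE ec rc er eQ).
by split.
Qed.

End ChartExistence.

Lemma family_charts (R : realType) (T1 T2 : twistor_blowup R)
    (phi : tb_Y T1 -> tb_Y T2) (X : manifold (Cx R) 4) (p : X -> Cx R)
    (j1 : tb_Y T1 -> X) (j2 : tb_Y T2 -> X) :
  semistable_family phi p j1 j2 -> forall q, tb_Q T1 q ->
  exists c : semistable_chart (tb_Q T1), sc_V c q.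
Proof.
move=> [fp [e1 _] [_ j12] H _] q Qq; have [c [hc cq cE]] := H q Qq.
apply: (chart_of_embedding fp e1 hc cq) => // x cx.
have [pE r1 r2] := cE _ cx; split => // y xE; rewrite -r2.
split=> [Qy|[y2 _ y2E]]; last by have := j12 y y2; rewrite -xE y2E => -[/(_ erefl)[]].
by exists (phi y) => //; rewrite xE; apply/esym/j12.
Qed.

(** * Bundles with fibre coordinates *)

Section Trivializations.
Variables (R : realType) (X : topologicalType).
Local Notation C := (Cx R).
Implicit Types (P : bundle R X) (V A : set X).

Lemma within_sub (T : Type) (F : set_system T) (A B : set T) : Filter F ->
  A `<=` B -> within A F --> within B F.
Proof.
move=> FF AB W H; have H' : F (fun x => B x -> W x) by exact: H.
by apply: (filterS _ H') => y By /AB.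
Qed.

Lemma near_within_self (T : topologicalType) (A : set T) (x : T) :
  \forall y \near within A (nbhs x), A y.
Proof. exact: withinT. Qed.

(** A fibre coordinate of the bundle over V; the last condition says that it
    determines, with the projection, the topology of the total space. *)
Definition fibre_coord P V (eta : btot P -> C) : Prop :=
  [/\ forall p, bset P p -> V (bproj P p) ->
        [/\ bgrp P (eta p), bproj P @ within (bset P) (nbhs p) --> bproj P p &
            eta @ within (bset P) (nbhs p) --> eta p],
      forall p p', bset P p -> bset P p' -> V (bproj P p) ->
        bproj P p = bproj P p' -> eta p = eta p' -> p = p',
      forall q k, V q -> bgrp P k ->
        exists p, [/\ bset P p, bproj P p = q & eta p = k],
      forall k p, bgrp P k -> bset P p -> V (bproj P p) ->
        [/\ bset P (bact P k p), bproj P (bact P k p) = bproj P p &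
            eta (bact P k p) = k * eta p] &
      forall (T : Type) (F : set_system T) (g : T -> btot P) p, Filter F ->
        bset P p -> V (bproj P p) -> (\forall t \near F, bset P (g t)) ->
        bproj P (g t) @[t --> F] --> bproj P p ->
        eta (g t) @[t --> F] --> eta p -> g @ F --> p].

Definition rel_open A V : Prop := exists2 U, open U & V = A `&` U.

Lemma rel_open_near A V x : rel_open A V -> V x ->
  \forall y \near x, A y -> V y.
Proof.
move=> [U oU ->] [Ax Ux]; apply: filterS (open_near oU Ux) => y Uy Ay.
by split.
Qed.

Lemma within_cvg_near (T S : topologicalType) (D : set T) (f : T -> S) x
    (N : S -> Prop) :
  f @ within D (nbhs x) --> f x -> (\forall y \near f x, N y) ->
  \forall y \near x, D y -> N (f y).
Proof. by move=> cf Nx; exact: (cf _ Nx). Qed.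

Lemma fibre_coord_restrict P V (eta : btot P -> C) : @fibre_coord P V eta ->
  @fibre_coord (restrict_bundle P V) V eta.
Proof.
move=> [e1 e2 e3 e4 e5]; split.
- move=> p [Pp Vp] _; have [g c1 c2] := e1 _ Pp Vp.
  have W : within (bset P `&` bproj P @^-1` V) (nbhs p) --> within (bset P) (nbhs p).
    by apply: within_sub => y [].
  by split=> //; [apply: cvg_trans c1|apply: cvg_trans c2]; exact: cvg_app.
- by move=> p p' [Pp Vp] [Pp' Vp'] _; exact: e2.
- move=> q k Vq Gk; have [p [Pp pE ee]] := e3 _ _ Vq Gk.
  by exists p; split => //; split => //; rewrite /preimage /= pE.
- move=> k p Gk [Pp Vp] _; have [a1 a2 a3] := e4 _ _ Gk Pp Vp.
  by split => //; split => //; rewrite /preimage /= a2.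
- move=> T F g p FF [Pp Vp] _ gP gp ge; apply: (e5 _ F g p FF Pp Vp _ gp ge).
  by apply: filterS gP => t [].
Qed.

(** Continuity into a total space can be tested on the projection and on a fibre
    coordinate, for F as for its inverse. *)
Lemma coord_bundle_iso A P P' (F : btot P -> btot P') (p0 : btot P) :
  bgrp P = bgrp P' ->
  (forall p, bset P p -> A (bproj P p)) ->
  (forall p, bset P' p -> A (bproj P' p)) ->
  (forall p, bset P p -> bset P' (F p) /\ bproj P' (F p) = bproj P p) ->
  (forall x, A x -> exists V eta eta', [/\ V x, rel_open A V,
     @fibre_coord P V eta, @fibre_coord P' V eta' &
     forall p, bset P p -> V (bproj P p) -> eta' (F p) = eta p]) ->
  bundle_iso F.
Proof.
move=> G PA PA' FP loc.
have injF p1 p2 : bset P p1 -> bset P p2 -> F p1 = F p2 -> p1 = p2.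
  move=> P1 P2 E; have [V [eta [eta' [Vx _ [_ inj _ _ _] _ E']]]] := loc _ (PA _ P1).
  have pE : bproj P p1 = bproj P p2.
    by rewrite -(FP _ P1).2 E (FP _ P2).2.
  by apply: inj => //; rewrite -E'// E E'// -pE.
have surjF p' : bset P' p' -> exists2 p, bset P p & F p = p'.
  move=> Pp'; have := loc _ (PA' _ Pp').
  move=> [V [eta [eta' [Vx _ [_ _ ex _ _] [c1 inj _ _ _] E]]]].
  have [g' _ _] := c1 _ Pp' Vx; rewrite -G in g'.
  have [p [Pp pE ep]] := ex _ _ Vx g'.
  have Vp : V (bproj P p) by rewrite pE.
  exists p => //; have [PF FE] := FP _ Pp.
  apply: inj => //; first by rewrite FE pE.
    by rewrite FE pE.
  by rewrite E.
pose I p' := xget p0 [set p | bset P p /\ F p = p'].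
have IP p' : bset P' p' -> bset P (I p') /\ F (I p') = p'.
  by move=> /surjF[p Pp pE]; rewrite /I; case: xgetP => // /(_ p)[].
have IK p : bset P p -> I (F p) = p.
  by move=> Pp; have [PF _] := FP _ Pp; have [PI IE] := IP _ PF; exact: injF.
split => //.
- split=> [p Pp|p1 p2|p' /surjF[p Pp <-]]; first by have [] := FP _ Pp.
    by rewrite !inE => P1 P2; exact: injF.
  by exists p.
- split.
    apply/subspace_continuousP => p Pp.
    have [V [eta [eta' [Vx oV [c1 _ _ _ _] [_ _ _ _ crit] E]]]] := loc _ (PA _ Pp).
    have [PF FE] := FP _ Pp; have [_ cp ce] := c1 _ Pp Vx.
    have nV : \forall y \near p, bset P y -> V (bproj P y).
      have H : \forall y \near p, bset P y -> A (bproj P y) -> V (bproj P y).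
        exact: (within_cvg_near cp (rel_open_near oV Vx)).
      by apply: filterS H => y H Py; apply: H => //; exact: PA.
    have VF : V (bproj P' (F p)) by rewrite FE.
    apply: (crit _ (within (bset P) (nbhs p)) F (F p) _ PF VF).
    + by apply: (filterS _ (near_within_self (bset P) p)) => y Py; exact: (FP _ Py).1.
    + rewrite FE; apply: cvg_trans cp; apply: near_eq_cvg.
      by apply: (filterS _ (near_within_self (bset P) p)) => y Py; rewrite (FP _ Py).2.
    rewrite (E _ Pp Vx); apply: cvg_trans ce; apply: near_eq_cvg.
    have nV' : \forall y \near within (bset P) (nbhs p), bset P y /\ V (bproj P y).
      by apply: filterS nV => y Vy Py; split => //; exact: Vy.
    by apply: (filterS _ nV') => y [Py Vy]; rewrite E.
  exists I; split => //; apply/subspace_continuousP => p' Pp'.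
  have := loc _ (PA' _ Pp').
  move=> [V [eta [eta' [Vx oV [_ _ _ _ crit] [c1 _ _ _ _] E]]]].
  have [_ cp ce] := c1 _ Pp' Vx; have [PI IE] := IP _ Pp'.
  have pI y : bset P' y -> bproj P (I y) = bproj P' y.
    by move=> /IP[Py Ey]; rewrite -(FP _ Py).2 Ey.
  have nV : \forall y \near p', bset P' y -> V (bproj P' y).
    have H : \forall y \near p', bset P' y -> A (bproj P' y) -> V (bproj P' y).
      exact: (within_cvg_near cp (rel_open_near oV Vx)).
    by apply: filterS H => y H Py; apply: H => //; exact: PA'.
  have eI y : bset P' y -> V (bproj P' y) -> eta (I y) = eta' y.
    by move=> Py Vy; have [PIy IEy] := IP _ Py; rewrite -E// ?IEy// pI.
  have VI : V (bproj P (I p')) by rewrite pI.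
  apply: (crit _ (within (bset P') (nbhs p')) I (I p') _ PI VI).
  + by apply: (filterS _ (near_within_self (bset P') p')) => y Py; exact: (IP _ Py).1.
  + rewrite pI//; apply: cvg_trans cp; apply: near_eq_cvg.
    by apply: (filterS _ (near_within_self (bset P') p')) => y Py; rewrite pI.
  rewrite eI//; apply: cvg_trans ce; apply: near_eq_cvg.
  have nV' : \forall y \near within (bset P') (nbhs p'), bset P' y /\ V (bproj P' y).
    by apply: filterS nV => y Vy Py; split => //; exact: Vy.
  by apply: (filterS _ nV') => y [Py Vy]; rewrite eI.
- by move=> p /FP[].
move=> k p Gk Pp.
have [V [eta [eta' [Vx oV [c1 _ _ ac _] [_ inj _ ac' _] E]]]] := loc _ (PA _ Pp).
have [Pk kE ek] := ac _ _ Gk Pp Vx; have [PF FE] := FP _ Pp.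
have Gk' : bgrp P' k by rewrite -G.
have VF : V (bproj P' (F p)) by rewrite FE.
have [Pk' kE' ek'] := ac' _ _ Gk' PF VF.
have [PFk FkE] := FP _ Pk.
have Vk : V (bproj P (bact P k p)) by rewrite kE.
by apply: inj => //; rewrite ?FkE// ?kE ?kE' ?FE// ek' !E.
Qed.

(** As V is open in A, the bundles P and restrict_bundle P V have the same topology
    near the points over V; transport the coordinate by the inverse of psi. *)
Lemma fibre_coord_iso A P1 P V (psi : btot P1 -> btot P) eta : rel_open A V ->
  principal_bundle A P -> @bundle_iso _ _ P1 (restrict_bundle P V) psi ->
  @fibre_coord P1 V eta -> exists2 eta', @fibre_coord P V eta' &
    forall x, bset P1 x -> eta' (psi x) = eta x.
Proof.
move=> oV [[cp PA] _ _ _ _] [G [Pm _ Ps] [cpsi [I [cI IK]]] pp pa] [e1 e2 e3 e4 e5].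
move/subspace_continuousP in cp; move/subspace_continuousP in cpsi.
move/subspace_continuousP in cI.
have sur p : bset P p -> V (bproj P p) -> exists2 x, bset P1 x & psi x = p.
  by move=> Pp Vp; have [x Px xE] := Ps p (conj Pp Vp); exists x.
have im x : bset P1 x -> [/\ bset P (psi x), V (bproj P1 x) & bproj P (psi x) = bproj P1 x].
  by move=> Px; have [P2 Vx] := Pm _ Px; have /= E := pp _ Px;
    split => //; rewrite -E.
have IP p : bset P p -> V (bproj P p) -> [/\ bset P1 (I p), psi (I p) = p &
    bproj P1 (I p) = bproj P p].
  move=> Pp Vp; have [x Px xE] := sur _ Pp Vp; rewrite -xE IK//.
  by have [_ _ ->] := im _ Px.
have nV p : bset P p -> V (bproj P p) -> \forall y \near p, bset P y -> V (bproj P y).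
  move=> Pp Vp.
  have H : \forall y \near p, bset P y -> A (bproj P y) -> V (bproj P y).
    exact: (within_cvg_near (cp _ Pp) (rel_open_near oV Vp)).
  by apply: filterS H => y H Py; apply: H => //; exact: PA.
exists (eta \o I); last by move=> x Px; rewrite /= IK.
split.
- move=> p Pp Vp; have [PI pE IE] := IP _ Pp Vp.
  have VI : V (bproj P1 (I p)) by rewrite IE.
  have [g1 _ c2] := e1 _ PI VI; split; [by rewrite -[bgrp P]G|exact: cp|].
  move=> W /(c2) /= H; have := cI p (conj Pp Vp) _ H; rewrite /= => H2.
  have H3 : \forall y \near p, (bset P y /\ V (bproj P y)) ->
      bset P1 (I y) -> W (eta (I y)) by exact: H2.
  apply: filterS (filterI H3 (nV _ Pp Vp)) => y [H4 Vy] Py.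
  by apply: H4; [split => //; exact: Vy|have [] := IP _ Py (Vy Py)].
- move=> p p' Pp Pp' Vp E ee; have Vp' : V (bproj P p') by rewrite -E.
  have [PI pE IE] := IP _ Pp Vp; have [PI' pE' IE'] := IP _ Pp' Vp'.
  by rewrite -pE -pE'; congr psi; apply: e2 => //; rewrite IE// IE'.
- move=> q k Vq Gk; rewrite -[bgrp P]G in Gk.
  have [x [Px xE ek]] := e3 _ _ Vq Gk; have [P2 _ E] := im _ Px.
  by exists (psi x); split; rewrite ?E//= IK.
- move=> k p Gk Pp Vp; rewrite -[bgrp P]G in Gk.
  have [PI pE IE] := IP _ Pp Vp.
  have VI : V (bproj P1 (I p)) by rewrite IE.
  have [a1 a2 a3] := e4 _ _ Gk PI VI; have /= E := pa _ _ Gk PI.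
  have [P2 _ E2] := im _ a1; rewrite -[in bact P k p]pE -E; split => //.
    by rewrite E2 a2 IE.
  by rewrite /= IK.
move=> T F g p FF Pp Vp gP gp ge; have [PI pE IE] := IP _ Pp Vp.
have gV : \forall t \near F, bset P (g t) /\ V (bproj P (g t)).
  have H : \forall t \near F, A (bproj P (g t)) -> V (bproj P (g t)).
    exact: (gp _ (rel_open_near oV Vp)).
  by apply: filterS (filterI H gP) => t [H1 Pt]; split => //; apply: H1; exact: PA.
have cIg : (I \o g) @ F --> I p.
  have VI : V (bproj P1 (I p)) by rewrite IE.
  apply: (e5 _ F (I \o g) (I p) FF PI VI).
    by apply: filterS gV => t [P2 V2]; have [] := IP _ P2 V2.
    rewrite IE; apply: cvg_trans gp; apply: near_eq_cvg.
    by apply: filterS gV => t [P2 V2]; have [_ _ ->] := IP _ P2 V2.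
  exact: ge.
move=> W; rewrite -{1}pE => H.
have H1 : \forall y \near I p, bset P1 y -> W (psi y) by exact: (cpsi _ PI _ H).
have H2 : \forall t \near F, bset P1 (I (g t)) -> W (psi (I (g t))) by exact: (cIg _ H1).
apply: filterS (filterI gV H2) => t [[P2 V2] H3].
by have [P3 E3 _] := IP _ P2 V2; rewrite /= -E3; exact: H3.
Qed.

(** The points with fibre coordinate 1 form a continuous local section. *)
Lemma fibre_coord_principal A P :
  (forall p, bset P p -> A (bproj P p)) ->
  (forall k, bgrp P k -> k != 0) -> bgrp P 1 ->
  (forall k k', bgrp P k -> bgrp P k' -> bgrp P (k * k')) ->
  (forall k, bgrp P k -> bgrp P k^-1) ->
  (forall x, A x -> exists V eta, [/\ V x, rel_open A V & @fibre_coord P V eta]) ->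
  principal_bundle A P.
Proof.
move=> PA G0 G1 GM GV loc; split.
- split => //; apply/subspace_continuousP => p Pp.
  have [V [eta [Vp _ [c _ _ _ _]]]] := loc _ (PA _ Pp).
  by have [] := c _ Pp Vp.
- move=> k p Gk Pp; have [V [eta [Vp _ [_ _ _ ac _]]]] := loc _ (PA _ Pp).
  by have [] := ac _ _ Gk Pp Vp.
- move=> p Pp; have [V [eta [Vp _ [_ inj _ ac _]]]] := loc _ (PA _ Pp).
  have [a1 a2 a3] := ac _ _ G1 Pp Vp.
  split; first by apply: inj; rewrite ?a2// a3 mul1r.
  move=> k k' Gk Gk'; have [b1 b2 b3] := ac _ _ Gk' Pp Vp.
  have Vb : V (bproj P (bact P k' p)) by rewrite b2.
  have [d1 d2 d3] := ac _ _ Gk b1 Vb.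
  have [m1 m2 m3] := ac _ _ (GM _ _ Gk Gk') Pp Vp.
  by apply: inj; rewrite ?d2 ?b2 ?m2// d3 b3 m3 mulrA.
- move=> k p Gk Pp E; have [V [eta [Vp _ [c _ _ ac _]]]] := loc _ (PA _ Pp).
  have [_ _ a3] := ac _ _ Gk Pp Vp; have [/G0 e0 _ _] := c _ Pp Vp.
  by apply: (mulIf e0); rewrite mul1r -a3 E.
move=> x Ax; have [V [eta [Vx [U oU VE] [c inj ex ac crit]]]] := loc _ Ax.
have AUV y : A y -> U y -> V y by move=> Ay Uy; rewrite VE.
have [px _] := ex _ _ Vx G1.
pose s y := xget px [set p | [/\ bset P p, bproj P p = y & eta p = 1]].
have sP y : V y -> [/\ bset P (s y), bproj P (s y) = y & eta (s y) = 1].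
  by move=> Vy; rewrite /s; case: xgetP => // no; have [p /no] := ex _ _ Vy G1.
exists U, s, eta; split.
- by split => //; move: Vx; rewrite VE => -[].
- by move=> y Ay Uy; have [] := sP _ (AUV _ Ay Uy).
- move=> p Pp Up; have Vp := AUV _ (PA _ Pp) Up; have [g1 _ _] := c _ Pp Vp.
  split => //; have [S1 S2 S3] := sP _ Vp.
  have Vs : V (bproj P (s (bproj P p))) by rewrite S2.
  have [a1 a2 a3] := ac _ _ g1 S1 Vs.
  by apply: inj => //; rewrite ?a2 ?S2// a3 S3 mulr1.
- apply/subspace_continuousP => p [Pp Up]; have Vp := AUV _ (PA _ Pp) Up.
  have [_ _ c2] := c _ Pp Vp; apply: cvg_trans c2; apply: cvg_app.
  by apply: within_sub => y [].
apply/subspace_continuousP => -[y k] [/= Ay Uy Gk]; have Vy := AUV _ Ay Uy.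
have act y' k' : A y' -> U y' -> bgrp P k' -> [/\ bset P (bact P k' (s y')),
    bproj P (bact P k' (s y')) = y' & eta (bact P k' (s y')) = k'].
  move=> Ay' Uy' Gk'; have [S1 S2 S3] := sP _ (AUV _ Ay' Uy').
  have Vs : V (bproj P (s y')) by rewrite S2; exact: AUV.
  by have [a1 a2 a3] := ac _ _ Gk' S1 Vs; rewrite a2 S2 a3 S3 mulr1.
have [b1 b2 b3] := act _ _ Ay Uy Gk.
set W := [set yk : X * C | _].
have nW : \forall yk \near within W (nbhs (y, k)), W yk.
  exact: near_within_self.
have FW : Filter (within W (nbhs (y, k))) by exact: within_filter.
apply: (crit _ _ (fun yk : X * C => bact P yk.2 (s yk.1)) _ FW b1).
- by rewrite b2.
- by apply: filterS nW => -[y' k'] [/= A1 A2 A3]; have [] := act _ _ A1 A2 A3.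
- rewrite b2; apply: (@cvg_trans _ (fst @ within W (nbhs (y, k)))).
    apply: near_eq_cvg; apply: filterS nW => -[y' k'] [/= A1 A2 A3].
    by have [_ ->] := act _ _ A1 A2 A3.
  apply: cvg_trans (cvg_app _ (@cvg_within _ _ _ _)) _; exact: cvg_fst.
rewrite b3; apply: (@cvg_trans _ (snd @ within W (nbhs (y, k)))).
  apply: near_eq_cvg; apply: filterS nW => -[y' k'] [/= A1 A2 A3].
  by have [_ _ ->] := act _ _ A1 A2 A3.
apply: cvg_trans (cvg_app _ (@cvg_within _ _ _ _)) _; exact: cvg_snd.
Qed.

End Trivializations.

(** * Topology of the log space of a chart *)

Lemma cvg_pow (K : numFieldType) (T : Type) (F : set_system T) (f : T -> K) k (l : K) :
  Filter F -> f @ F --> l -> f t ^+ k @[t --> F] --> l ^+ k.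
Proof.
move=> FF fl; elim: k => [|k IH].
  rewrite expr0; under eq_fun do rewrite expr0; exact: cvg_cst.
rewrite exprS; under eq_fun do rewrite exprS; exact: (cvgM fl IH).
Qed.

Lemma cvg_monomial (K : numFieldType) (T : Type) (F : set_system T)
    (f g : T -> K) (e a b : K) k l k' l' : Filter F -> e != 0 -> b != 0 ->
  f @ F --> a -> g @ F --> b ->
  f t * ((e / g t) ^+ k * g t ^+ l) / ((e / g t) ^+ k' * g t ^+ l') @[t --> F] -->
  a * ((e / b) ^+ k * b ^+ l) / ((e / b) ^+ k' * b ^+ l').
Proof.
move=> FF e0 b0 fa gb.
have ce : (fun=> e) @ F --> e by exact: cvg_cst.
have cu : e / g t @[t --> F] --> e / b by exact: (cvgM ce (cvgV b0 gb)).
have nz : (e / b) ^+ k' * b ^+ l' != 0.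
  by rewrite mulf_neq0 ?expf_neq0// mulf_neq0 ?invr_eq0.
exact: (cvgM (cvgM fa (cvgM (cvg_pow FF cu) (cvg_pow FF gb)))
  (cvgV nz (cvgM (cvg_pow FF cu) (cvg_pow FF gb)))).
Qed.

Section LogSpace.
Variables (R : realType) (n : nat) (X : manifold (Cx R) n) (D : set X).
Local Notation C := (Cx R).

Lemma kn_pt_continuous (p : kn D) : {for p, continuous (@kn_pt R n X D)}.
Proof.
move=> U; rewrite nbhsE => -[B [oB Bp] BU].
have Di : kn_index D (B, fun=> 1, setT).
  split => //=; last exact: openT.
  move=> x _; apply: log_monoid_group; apply: unit_log_monoid; first exact: reg_cst.
  exact: oner_neq0.
apply: filterS (open_near (subbase_open (@kn_openP R n X D) Di) _); last by [].
by move=> y [/= By _]; exact: BU.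
Qed.

Lemma kn_h_continuous (O : set X) f (p : kn D) : open O ->
  (forall x, O x -> log_group D x f) -> O (kn_pt p) ->
  {for p, continuous (fun p : kn D => kn_h p f)}.
Proof.
move=> oO Of Op U; rewrite nbhsE => -[B [oB Bp] BU].
have Di : kn_index D (O, f, B) by split.
apply: filterS (open_near (subbase_open (@kn_openP R n X D) Di) _); last by [].
by move=> y [/= _ By]; exact: BU.
Qed.

End LogSpace.

Lemma monomial_form_near (R : realType) (n : nat) (X : manifold (Cx R) n.+2)
    (c : coord_system (Cx R) X n.+2) (pi : X -> Cx R) x f E k l k' l' :
  monomial_form c pi x f E k l k' l' ->
  \forall y \near x, monomial_form c pi y f E k l k' l'.
Proof.
move=> [rE nE fE]; have [B [oB Bx BP]] := near_open_nbhs fE.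
apply: filterS (filterI (filterI (reg_near rE)
  (near_neq0 (reg_continuous rE) nE)) (open_near oB Bx)) => y [[ry ny] By].
by split => //; apply: filterS (open_near oB By).
Qed.

Section ChartBundle.
Variables (R : realType) (n : nat) (Y : manifold (Cx R) n.+1) (Q : set Y).
Variables (theta : R) (c : semistable_chart Q).
Local Notation C := (Cx R).
Local Notation D := (sc_pi c @^-1` [set 0]).
Local Notation P := (sc_bundle theta c).
Local Notation hc := (sc_coords c).
Local Notation pE := (@sc_t R n Y Q c).
Implicit Types (q : Y) (p : sc_kn c).

Lemma chart_rel_open : rel_open Q (sc_V c).
Proof. by exists (sc_B c); [exact: sc_B_open|rewrite setIC]. Qed.

Lemma chart_log_group x : dom (sc_c c) x -> log_group D x (sc_v c).
Proof. by move=> dx; exact: (log_monoid_group (log_monoid_v hc pE dx)). Qed.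

Lemma bset_dom p : bset P p -> dom (sc_c c) (kn_pt p).
Proof. by move=> Pp; have [Vq <-] := bset_pt Pp; have [] := emb_uv Vq. Qed.

Lemma kn_proj_continuous p : bset P p -> bproj P @ within (bset P) (nbhs p) --> bproj P p.
Proof.
move=> Pp; have [[Bq Qq] qE] := bset_pt Pp; have [[d b] fE] := foot_emb Bq.
have E p1 : bset P p1 -> foot (kn_pt p1) = bproj P p1.
  by move=> P1; have [[B1 _] e] := bset_pt P1; rewrite -{1}e (foot_emb B1).2.
rewrite qE in d b.
have cf : {for p, continuous (fun p => foot (kn_pt p))}.
  apply: (@continuous_comp _ _ _ (@kn_pt _ _ _ D) (@foot _ _ _ _ c)).
    exact: kn_pt_continuous.
  apply: continuous_comp; first exact: (coo_continuous hc d).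
  exact: branch_continuous.
have cf' : (fun p => foot (kn_pt p)) @ within (bset P) (nbhs p) --> bproj P p.
  rewrite -(E _ Pp); apply: cvg_trans cf.
  exact: (cvg_app _ (@cvg_within _ _ _ _)).
apply: cvg_trans cf'; apply: near_eq_cvg.
by apply: (filterS _ (near_within_self (bset P) p)) => y Py; rewrite E.
Qed.

(** The value of a phase on a section f is, by the monomial form of f at p, a
    continuous function of the base point and of the value on v. *)
Lemma kn_cvg (T : Type) (F : set_system T) (g : T -> sc_kn c) p : Filter F ->
  bset P p -> (\forall t \near F, bset P (g t)) ->
  bproj P (g t) @[t --> F] --> bproj P p ->
  kn_h (g t) (sc_v c) @[t --> F] --> kn_h p (sc_v c) -> g @ F --> p.
Proof.
move=> FF Pp gP gp ge; have [[Bq Qq] qE] := bset_pt Pp.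
have gx : (fun t => kn_pt (g t)) @ F --> kn_pt p.
  have ce : {for bproj P p, continuous (sc_emb c)} by exact: emb_continuous.
  have H : (fun t => sc_emb c (bproj P (g t))) @ F --> sc_emb c (bproj P p).
    by move=> N HN; exact: (gp _ (ce _ HN)).
  rewrite qE in H.
  apply: cvg_trans H; apply: near_eq_cvg.
  by apply: filterS gP => t Pt; have [_ ->] := bset_pt Pt.
apply: (subbase_cvg (@kn_openP R _ _ D)) => -[[ O f] W] [/= oO Of oW] [/= Op Wp].
have [d0 u0 v0] := emb_uv (conj Bq Qq); rewrite qE in d0 u0 v0.
have [E [k [l [k' [l' fE]]]]] := log_group_form hc pE d0 u0 v0 (Of _ Op).
pose val x rho : C := phase (E x) * ((expi theta / rho) ^+ k * rho ^+ l) /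
  ((expi theta / rho) ^+ k' * rho ^+ l').
have valE p1 : bset P p1 -> O (kn_pt p1) ->
    monomial_form (sc_c c) (sc_pi c) (kn_pt p1) f E k l k' l' ->
    kn_h p1 f = val (kn_pt p1) (kn_h p1 (sc_v c)).
  move=> P1 O1 form; have [n1 n2 e] := bset_uv P1.
  have nv := norm1_neq0 n2; have nu := norm1_neq0 n1.
  have uE : kn_h p1 (sc_u c) = expi theta / kn_h p1 (sc_v c).
    by rewrite -e mulfK.
  have := log_phase_form hc pE (bset_dom P1) (kn_phase p1) (Of _ O1) form.
  rewrite -/(sc_u c) -/(sc_v c) /val -uE => <-.
  by rewrite mulfK// mulf_neq0// expf_neq0.
have near_form : \forall x \near kn_pt p,
    O x /\ monomial_form (sc_c c) (sc_pi c) x f E k l k' l'.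
  by apply: filterI; [exact: open_near|exact: monomial_form_near].
have near_t : \forall t \near F, kn_h (g t) f = val (kn_pt (g t)) (kn_h (g t) (sc_v c)).
  have H : \forall t \near F, O (kn_pt (g t)) /\
      monomial_form (sc_c c) (sc_pi c) (kn_pt (g t)) f E k l k' l'.
    exact: (gx _ near_form).
  by apply: filterS (filterI H gP) => t [[ Ot ft] Pt]; exact: valE.
have [rE nE _] := fE; have [_ n2 _] := bset_uv Pp; have nv := norm1_neq0 n2.
have cE : phase (E (kn_pt (g t))) @[t --> F] --> phase (E (kn_pt p)).
  have cp : phase (E x) @[x --> kn_pt p] --> phase (E (kn_pt p)).
    exact: (phase_continuous (reg_continuous rE) nE).
  by move=> N HN; exact: (gx _ (cp _ HN)).
have e0 : expi theta != 0 :> C by exact: norm1_neq0 (norm_expi theta).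
have cval : val (kn_pt (g t)) (kn_h (g t) (sc_v c)) @[t --> F] -->
    val (kn_pt p) (kn_h p (sc_v c)) by 
  exact: (@cvg_monomial C T F (fun t => phase (E (kn_pt (g t))))
    (fun t => kn_h (g t) (sc_v c)) (expi theta) _ _ k l k' l' FF e0 nv cE ge).
have nW : \forall z \near val (kn_pt p) (kn_h p (sc_v c)), W z.
  by apply: open_near => //; rewrite -valE.
have H1 : \forall t \near F, W (val (kn_pt (g t)) (kn_h (g t) (sc_v c))).
  exact: (cval _ nW).
have H2 : \forall t \near F, O (kn_pt (g t)) by exact: (gx _ (open_near oO Op)).
apply: filterS (filterI H2 (filterI H1 near_t)) => t [ Ot [Wt et]].
by split; rewrite //= et.
Qed.

Lemma chart_fibre_coord :
  @fibre_coord R Y P (sc_V c) (fun p : sc_kn c => kn_h p (sc_v c)).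
Proof.
split.
- move=> p Pp Vp; split; [by have [] := bset_uv Pp|exact: kn_proj_continuous|].
  have [oD _ _ _ _] := hc.
  apply: cvg_trans (kn_h_continuous oD chart_log_group (bset_dom Pp)).
  exact: (cvg_app _ (@cvg_within _ _ _ _)).
- move=> p p' Pp Pp' Vp E e.
  have [_ e1] := bset_pt Pp; have [_ e2] := bset_pt Pp'.
  by apply: (bset_eq Pp Pp' _ e); rewrite -e1 -e2; congr sc_emb.
- move=> q k Vq k1; have [p [Pp e1 e2]] := bset_exists theta Vq k1.
  by exists p; split => //=; rewrite e1 sc_embK//; case: Vq.
- move=> k p k1 Pp _; have [P2 e1 e2] := act_bset k1 Pp.
  by split => //=; rewrite e1.
by move=> T F g p FF Pp Vp gP gp ge; exact: kn_cvg.
Qed.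

End ChartBundle.

(** * Normal vectors and hermitian metrics *)

(** |f - b| <= |f^2 - b^2| / b. *)
Lemma cvg_sqrt (K : numFieldType) (T : Type) (F : set_system T) (f : T -> K) (b : K) :
  Filter F -> 0 < b -> (\forall t \near F, 0 <= f t) ->
  f t ^+ 2 @[t --> F] --> b ^+ 2 -> f @ F --> b.
Proof.
move=> FF b0 f0 f2; apply/cvgrPdist_lt => e e0.
have /cvgrPdist_lt/(_ (b * e)) H := f2.
have H' := H (mulr_gt0 b0 e0).
apply: filterS (filterI f0 H') => t [ft Ht].
have bf : 0 < b + f t by exact: ltr_pwDl.
rewrite -(ltr_pM2l b0); apply: le_lt_trans Ht.
rewrite subr_sqr normrM mulrC ler_wpM2l// ger0_norm ?(ltW bf)//.
by rewrite lerDl.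
Qed.

Lemma cvg_inv (K : numFieldType) (T : Type) (F : set_system T) (f : T -> K) (a : K) :
  Filter F -> a != 0 -> f @ F --> a -> (f t)^-1 @[t --> F] --> a^-1.
Proof. by move=> FF a0 fa; exact: cvgV. Qed.

Lemma mul_conj_scale (K : numClosedFieldType) (k a : K) :
  a^* = a -> k * (k * a)^* = `|k| ^+ 2 * a.
Proof.
move=> aE; have kaE : (k * a)^* = k^* * a^* by exact: rmorphM.
by rewrite normCK -mulrA kaE aE.
Qed.

Section NormalVectors.
Variables (R : realType) (n : nat) (Y : manifold (Cx R) n.+1) (Q : set Y).
Local Notation C := (Cx R).
Local Notation normal_space := Defs.normal_space.
Implicit Types (v w : nvec Q) (q : Y) (c : semistable_chart Q) (k : C).

Lemma nvec_eq v w : nv_pt v = nv_pt w -> nv_fun v = nv_fun w -> v = w.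
Proof.
case: v w => [x h Qx xh] [x' h' Qx' xh'] /= e1 e2; rewrite -e1 -e2 in Qx' xh' *.
by congr NVec; exact: Prop_irrelevance.
Qed.

Lemma nv_pt_continuous v : {for v, continuous (@nv_pt R n.+1 Y Q)}.
Proof.
move=> U; rewrite nbhsE => -[B [oB Bp] BU].
have Di : nvec_index Q (B, fun=> 0, setT).
  split => //=; last exact: openT.
  by move=> x _; split; [exact: reg_cst|exact: nearW].
apply: filterS (open_near (subbase_open (@nvec_openP R n.+1 Y Q) Di) _); last by [].
by move=> y [/= By _]; exact: BU.
Qed.

Lemma nv_fun_continuous (O : set Y) f v : open O ->
  (forall x, O x -> ideal_at Q x f) -> O (nv_pt v) ->
  {for v, continuous (fun v => nv_fun v f)}.
Proof.
move=> oO Of Op U; rewrite nbhsE => -[B [oB Bp] BU].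
have Di : nvec_index Q (O, f, B) by split.
apply: filterS (open_near (subbase_open (@nvec_openP R n.+1 Y Q) Di) _); last by [].
by move=> y [/= _ By]; exact: BU.
Qed.

Lemma nv_eqn_continuous c v : sc_V c (nv_pt v) ->
  {for v, continuous (fun v => nv_fun v (eqn c))}.
Proof.
move=> [Bv _]; apply: (nv_fun_continuous (@sc_B_open _ _ _ _ c)) => // x.
exact: eqn_ideal.
Qed.

Lemma ideal_generator_near c q f : sc_V c q -> ideal_at Q q f ->
  exists a, [/\ reg q a, f q = 0 & \forall y \near q, [/\ sc_B c y, reg y a &
    \forall z \near y, f z = a z * eqn c z]].
Proof.
move=> Vq If; have [a ra fa] := ideal_generator Vq If.
exists a; split => //.
  by rewrite (nbhs_singleton fa) (eqn0 Vq) mulr0.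
have [B [oB Bq BP]] := near_open_nbhs fa.
apply: filterS (filterI (filterI (B_near Vq.1) (reg_near ra)) (open_near oB Bq)).
move=> y [[By ry] Sy]; split => //.
exact: filterS BP (open_near oB Sy).
Qed.

Lemma nvec_cvg c (T : Type) (F : set_system T) (g : T -> nvec Q) v : Filter F ->
  sc_V c (nv_pt v) -> nv_pt (g t) @[t --> F] --> nv_pt v ->
  nv_fun (g t) (eqn c) @[t --> F] --> nv_fun v (eqn c) -> g @ F --> v.
Proof.
move=> FF Vv gp ge.
apply: (subbase_cvg (@nvec_openP R n.+1 Y Q)) => -[[ O f] W] [/= oO Of oW] [/= Op Wp].
have [a [ra _ Ha]] := ideal_generator_near Vv (Of _ Op).
have [_ _ fa] := nbhs_singleton Ha.
have vE : nv_fun v f = a (nv_pt v) * nv_fun v (eqn c).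
  exact: (normal_generator Vv (nv_normal v) ra fa).
have near_t : \forall t \near F,
    nv_fun (g t) f = a (nv_pt (g t)) * nv_fun (g t) (eqn c).
  have H : \forall t \near F, [/\ sc_B c (nv_pt (g t)), reg (nv_pt (g t)) a &
    \forall z \near nv_pt (g t), f z = a z * eqn c z] by exact: (gp _ Ha).
  apply: filterS H => t [Bt rt ft].
  exact: (normal_generator (conj Bt (nv_mem (g t))) (nv_normal (g t)) rt ft).
have ca : a (nv_pt (g t)) @[t --> F] --> a (nv_pt v).
  by move=> N HN; exact: (gp _ (reg_continuous ra HN)).
have cf : a (nv_pt (g t)) * nv_fun (g t) (eqn c) @[t --> F] --> nv_fun v f.
  by rewrite vE; exact: (cvgM ca ge).
have H1 : \forall t \near F, W (a (nv_pt (g t)) * nv_fun (g t) (eqn c)).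
  exact: (cf _ (open_near oW Wp)).
have H2 : \forall t \near F, O (nv_pt (g t)) by exact: (gp _ (open_near oO Op)).
apply: filterS (filterI H2 (filterI H1 near_t)) => t [ Ot [Wt et]].
by split; rewrite //= et.
Qed.

Lemma nvec_coord_inj c v w : sc_V c (nv_pt v) -> nv_pt v = nv_pt w ->
  nv_fun v (eqn c) = nv_fun w (eqn c) -> v = w.
Proof.
move=> Vv e ef; apply: nvec_eq => //.
have Nw := nv_normal w; rewrite -e in Nw.
exact: (normal_eq Vv (nv_normal v) Nw).
Qed.

Lemma nvec_exists c q k : sc_V c q ->
  exists2 v : nvec Q, nv_pt v = q & nv_fun v (eqn c) = k.
Proof.
move=> Vq; have [nu N nuE] := normal_exists Vq k.
by exists (NVec Vq.2 N).
Qed.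

Lemma nvec_neq0 c v : sc_V c (nv_pt v) ->
  (exists f, nv_fun v f != 0) <-> nv_fun v (eqn c) != 0.
Proof. by move=> Vv; exact: (normal_neq0 Vv (nv_normal v)). Qed.

Section Metric.
Variable h : Y -> ((Y -> C) -> C) -> ((Y -> C) -> C) -> C.
Hypothesis hh : hermitian_metric Q h.
Local Notation sqnorm v := (h (nv_pt v) (nv_fun v) (nv_fun v)).

Lemma normal0 q : normal_space Q q (fun=> 0).
Proof.
by split => // [f g _ _|a f _ _]; rewrite ?addr0 ?mulr0.
Qed.

Lemma metric_scale k v : sqnorm (nv_scale k v) = `|k| ^+ 2 * sqnorm v.
Proof.
have [lin sym _ _] := hh; have Qv := nv_mem v; have Nv := nv_normal v.
have Nk := normal_spaceZ k Nv; have N0 := normal0 (nv_pt v).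
have h0 om : normal_space Q (nv_pt v) om -> h (nv_pt v) (fun=> 0) om = 0.
  move=> No; have := lin (nv_pt v) 1 _ _ om Qv N0 N0 No.
  rewrite (_ : (fun=> 1 * 0 + 0) = fun=> 0); last first.
    by apply/funext => f; rewrite mulr0 addr0.
  by rewrite mul1r => /eqP; rewrite -subr_eq subrr eq_sym => /eqP.
have hZ om : normal_space Q (nv_pt v) om ->
    h (nv_pt v) (fun f => k * nv_fun v f) om = k * h (nv_pt v) (nv_fun v) om.
  move=> No; rewrite -[RHS]addr0 -(h0 _ No) -(lin _ _ _ _ _ Qv Nv N0 No).
  by congr h; apply/funext => f; rewrite addr0.
rewrite /= hZ// (sym _ _ _ Qv Nk Nv) hZ//; apply: mul_conj_scale.
by rewrite -(sym _ _ _ Qv Nv Nv).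
Qed.

Lemma sqnorm_gt0 v : (exists f, nv_fun v f != 0) -> 0 < sqnorm v.
Proof. by have [_ _ pos _] := hh; apply: pos; [exact: nv_mem|exact: nv_normal]. Qed.

Lemma unit_neq0 v : sqnorm v = 1 -> exists f, nv_fun v f != 0.
Proof.
move=> v1; apply: contrapT => no.
have v0 : v = nv_scale 0 v.
  apply: nvec_eq => //; apply/funext => f /=; rewrite mul0r.
  by apply/eqP; apply: contrapT => /negP nf; apply: no; exists f.
move: v1; rewrite v0 metric_scale normr0 expr0n mul0r => /eqP.
by rewrite eq_sym oner_eq0.
Qed.

Lemma metric_continuous v : {for v, continuous (fun v => sqnorm v)}.
Proof. by have [_ _ _ +] := hh; exact. Qed.

(** The modulus of the value at v of a unit vector is a continuous function of its
    base point: its square is 1 / h(s, s) for the normal vector s with s(v) = 1. *)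
Lemma circle_fibre_coord c : @fibre_coord R Y (circle_normal_bundle Q h) (sc_V c)
  (fun v => phase (nv_fun v (eqn c))).
Proof.
have nz v : sqnorm v = 1 -> sc_V c (nv_pt v) -> nv_fun v (eqn c) != 0.
  by move=> /unit_neq0 v0 Vv; exact/(nvec_neq0 Vv).
split.
- move=> v Pv Vv; have v0 := nz _ Pv Vv; split; first exact: norm_phase.
    apply: cvg_trans (nv_pt_continuous (v := v)).
    exact: (cvg_app _ (@cvg_within _ _ _ _)).
  apply: cvg_trans (phase_continuous (nv_eqn_continuous Vv) v0).
  exact: (cvg_app _ (@cvg_within _ _ _ _)).
- move=> v w Pv Pw Vv e ep; have v0 := nz _ Pv Vv.
  pose r := `|nv_fun w (eqn c)| / `|nv_fun v (eqn c)|.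
  have wE : w = nv_scale r v.
    apply/esym/(nvec_coord_inj (c := c)) => //=.
    rewrite [X in r * X]phase_norm ep mulrA /r divfK ?normr_eq0//.
    by rewrite -phase_norm.
  have r1 : `|r| = 1.
    have := Pw; rewrite /= wE => E; have := metric_scale r v.
    rewrite E [sqnorm v]Pv mulr1 => /esym/eqP.
    by rewrite sqrp_eq1// => /eqP.
  have r0 : 0 <= r by rewrite divr_ge0.
  rewrite wE -(ger0_norm r0) r1; apply: nvec_eq => //=.
  by apply/funext => f; rewrite mul1r.
- move=> q k Vq k1; have k0 := norm1_neq0 k1.
  have [v vq vE] := nvec_exists k Vq.
  have Vv : sc_V c (nv_pt v) by rewrite vq.
  have v0 : exists f, nv_fun v f != 0 by apply/(nvec_neq0 Vv); rewrite vE.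
  have s0 := sqnorm_gt0 v0.
  have r0 : 0 < (sqrtC (sqnorm v))^-1 by rewrite invr_gt0 sqrtC_gt0.
  exists (nv_scale (sqrtC (sqnorm v))^-1 v); split => //=.
    have := metric_scale (sqrtC (sqnorm v))^-1 v => /= ->.
    by rewrite gtr0_norm// exprVn sqrtCK mulVf// gt_eqF.
  by rewrite vE phaseM phase_pos// mul1r phase_norm1.
- move=> k v k1 Pv Vv; split => //.
    by have /= -> := metric_scale k v; rewrite k1 expr1n mul1r.
  by rewrite /= phaseM (phase_norm1 k1).
move=> T F g v FF Pv Vv gP gp ge; have v0 := nz _ Pv Vv.
pose s q := xget v [set w | nv_pt w = q /\ nv_fun w (eqn c) = 1].
have sP q : sc_V c q -> nv_pt (s q) = q /\ nv_fun (s q) (eqn c) = 1.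
  move=> Vq; rewrite /s; case: xgetP => [//|no].
  by have [w wq wE] := nvec_exists 1 Vq; case: (no w).
have gV : \forall t \near F, sc_V c (nv_pt (g t)).
  have H : \forall t \near F, sc_B c (nv_pt (g t)) by exact: (gp _ (B_near Vv.1)).
  by apply: filterS H => t Bt; split => //; exact: nv_mem.
have normE w : sqnorm w = 1 -> sc_V c (nv_pt w) ->
    `|nv_fun w (eqn c)| ^+ 2 = (sqnorm (s (nv_pt w)))^-1.
  move=> w1 Vw; have [sq s1] := sP _ Vw.
  have wE : w = nv_scale (nv_fun w (eqn c)) (s (nv_pt w)).
    by apply: (nvec_coord_inj (c := c)); rewrite //= s1 mulr1.
  have := metric_scale (nv_fun w (eqn c)) (s (nv_pt w)); rewrite -wE w1 => E.
  have s0 : sqnorm (s (nv_pt w)) != 0.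
    by apply/eqP => s0; move: E; rewrite s0 mulr0 => /eqP; rewrite oner_eq0.
  by apply: (mulIf s0); rewrite -E mulVf.
have [sv sv1] := sP _ Vv.
have Vs : sc_V c (nv_pt (s (nv_pt v))) by rewrite sv.
have cs : (fun t => s (nv_pt (g t))) @ F --> s (nv_pt v).
  apply: (nvec_cvg FF Vs).
    rewrite sv; apply: cvg_trans gp; apply: near_eq_cvg.
    by apply: filterS gV => t Vt; have [->] := sP _ Vt.
  rewrite sv1; apply: (@cvg_trans _ ((fun=> 1 : C) @ F)); last exact: cvg_cst.
  by apply: near_eq_cvg; apply: filterS gV => t Vt; have [_ ->] := sP _ Vt.
have cq : sqnorm (s (nv_pt (g t))) @[t --> F] --> sqnorm (s (nv_pt v)).
  by move=> N HN; exact: (cs _ (metric_continuous HN)).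
have s0 : sqnorm (s (nv_pt v)) != 0.
  apply: lt0r_neq0; apply: sqnorm_gt0; apply/(nvec_neq0 Vs).
  by rewrite sv1 oner_neq0.
have c2 : `|nv_fun (g t) (eqn c)| ^+ 2 @[t --> F] --> `|nv_fun v (eqn c)| ^+ 2.
  have cV : (sqnorm (s (nv_pt (g t))))^-1 @[t --> F] --> (sqnorm (s (nv_pt v)))^-1.
    exact: (cvg_inv FF s0 cq).
  rewrite (normE v Pv Vv) => N HN.
  have H : \forall t \near F, N (sqnorm (s (nv_pt (g t))))^-1 by exact: (cV _ HN).
  apply: filterS (filterI (filterI gV gP) H) => t [[Vt Pt] Nt].
  by rewrite /= (normE (g t) Pt Vt).
have c1 : `|nv_fun (g t) (eqn c)| @[t --> F] --> `|nv_fun v (eqn c)|.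
  by apply: cvg_sqrt c2; [rewrite normr_gt0|exact: nearW].
apply: (nvec_cvg FF Vv gp); rewrite [X in _ --> X]phase_norm.
have c3 : `|nv_fun (g t) (eqn c)| * phase (nv_fun (g t) (eqn c)) @[t --> F] -->
    `|nv_fun v (eqn c)| * phase (nv_fun v (eqn c)) by exact: (cvgM c1 ge).
move=> N HN; have H : \forall t \near F,
    N (`|nv_fun (g t) (eqn c)| * phase (nv_fun (g t) (eqn c))) by exact: (c3 _ HN).
by apply: filterS H => t; rewrite -phase_norm.
Qed.

End Metric.
End NormalVectors.

(** * The bundle of normal directions *)

(** The bundle of oriented normal directions, the quotient of the nonzero normal
    vectors by the positive reals: a nonzero vector nu at q is represented by q and
    by the function f |-> nu f / |nu f|. *)
Definition direction (R : realType) (n : nat) (Y : manifold (Cx R) n)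
  (Q : set Y) : Type := (Y * ((Y -> Cx R) -> Cx R))%type.

Section Directions.
Variables (R : realType) (n : nat) (Y : manifold (Cx R) n.+1) (Q : set Y).
Local Notation C := (Cx R).
Local Notation normal_space := Defs.normal_space.
Local Notation dir := (direction Q).

HB.instance Definition _ := gen_eqMixin dir.
HB.instance Definition _ := gen_choiceMixin dir.

(** That f generates the ideal of Q at q, in terms of the dual vectors. *)
Definition local_equation (q : Y) (f : Y -> C) : Prop :=
  ideal_at Q q f /\
  forall nu, normal_space Q q nu -> (exists g, nu g != 0) -> nu f != 0.

(** Phases of normal vectors are only continuous away from zero: the topology is
    defined by the values on local equations. *)
Definition dir_index : set (set Y * (Y -> C) * set C) :=
  [set t | [/\ open t.1.1, forall x, t.1.1 x -> Q x -> local_equation x t.1.2 &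
             open t.2]].

Definition dir_subbase (t : set Y * (Y -> C) * set C) : set dir :=
  [set d : dir | t.1.1 d.1 /\ t.2 (d.2 t.1.2)].

HB.instance Definition _ := @isSubBaseTopological.Build dir _ dir_index dir_subbase.

Lemma dir_openP (A : set dir) : open A <-> generated_topology dir_index dir_subbase A.
Proof. by []. Qed.

Definition is_direction (d : dir) : Prop :=
  Q d.1 /\ exists nu, [/\ normal_space Q d.1 nu, exists f, nu f != 0 &
                          d.2 = (fun f => phase (nu f))].

Definition direction_bundle : bundle R Y :=
  Bundle (@unit_circle R) [set d : dir | is_direction d] (fun d : dir => d.1)
    (fun k d => (d.1, fun f => k * d.2 f) : dir).

Implicit Types (c : semistable_chart Q) (d : dir).

Lemma eqn_local_equation c q : sc_V c q -> local_equation q (eqn c).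
Proof.
by move=> Vq; split=> [|nu N]; [exact: eqn_ideal Vq.1|exact: (normal_neq0 Vq N).1].
Qed.

Lemma direction_generator c d f a : is_direction d -> sc_V c d.1 -> reg d.1 a ->
  (\forall y \near d.1, f y = a y * eqn c y) ->
  d.2 f = phase (a d.1) * d.2 (eqn c).
Proof.
move=> [_ [nu [N _ ->]]] Vd ra fa.
by rewrite (normal_generator Vd N ra fa) phaseM.
Qed.

Lemma direction_norm c d : is_direction d -> sc_V c d.1 -> `|d.2 (eqn c)| = 1.
Proof.
move=> [_ [nu [N nz ->]]] Vd; apply: norm_phase.
exact/(normal_neq0 Vd N).
Qed.

Lemma direction_continuous c d : is_direction d -> sc_V c d.1 ->
  {for d, continuous (fun d : dir => d.1 : Y)} /\
  {for d, continuous (fun d : dir => d.2 (eqn c))}.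
Proof.
move=> Pd [Bd Qd].
have oe x : sc_B c x -> Q x -> local_equation x (eqn c).
  by move=> Bx Qx; exact: eqn_local_equation.
split=> U; rewrite nbhsE => -[B [oB Bp] BU].
  have Di : dir_index (B `&` sc_B c, eqn c, setT).
    split => /=; [|by move=> x []; auto|exact: openT].
    by apply: openI => //; exact: sc_B_open.
  apply: filterS (open_near (subbase_open dir_openP Di) _); last by [].
  by move=> y [[/= By _] _]; exact: BU.
have Di : dir_index (sc_B c, eqn c, B) by split => //; exact: sc_B_open.
apply: filterS (open_near (subbase_open dir_openP Di) _); last by [].
by move=> y [_ /= By]; exact: BU.
Qed.

Lemma direction_fibre_coord c : @fibre_coord R Y direction_bundle (sc_V c)
  (fun d : dir => d.2 (eqn c)).
Proof.
split.
- move=> d Pd Vd; have [c1 c2] := direction_continuous Pd Vd.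
  split; first exact: (direction_norm Pd Vd).
    by apply: cvg_trans c1; exact: (cvg_app _ (@cvg_within _ _ _ _)).
  by apply: cvg_trans c2; exact: (cvg_app _ (@cvg_within _ _ _ _)).
- move=> [q h] [q' h'] Pd Pd' /= Vd qE; rewrite -qE in Pd' *; move=> ee.
  congr (_, _); apply/funext => f.
  have [If|nf] := pselect (ideal_at Q q f).
    have [a ra fa] := ideal_generator Vd If.
    have := direction_generator Pd Vd ra fa; rewrite /= => ->.
    by have := direction_generator Pd' Vd ra fa; rewrite /= => ->; rewrite ee.
  have [_ [nu [[_ _ _ n0] _ /= ->]]] := Pd.
  by have [_ [nu' [[_ _ _ n0'] _ /= ->]]] := Pd'; rewrite n0// n0'.
- move=> q k Vq k1; have [nu N nuE] := normal_exists Vq k.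
  exists ((q, fun f => phase (nu f)) : dir); split => //=; last first.
    by rewrite nuE phase_norm1.
  split; first exact: Vq.2.
  by exists nu; split => //; exists (eqn c); rewrite nuE norm1_neq0.
- move=> k d k1 [Qd [nu [N nz dE]]] Vd; split => //; split => //.
  exists (fun f => k * nu f); split => /=.
  + exact: normal_spaceZ.
  + by have [f nf] := nz; exists f; rewrite mulf_neq0// norm1_neq0.
  by apply/funext => f; rewrite dE phaseM (phase_norm1 k1).
move=> T F g d FF Pd Vd gP gp ge.
apply: (subbase_cvg dir_openP) => -[[ O f] W] [/= oO Of oW] [/= Op Wp].
have [If gen] := Of _ Op Vd.2.
have [a [ra _ Ha]] := ideal_generator_near Vd If.
have [_ _ fa] := nbhs_singleton Ha.
have dE : d.2 f = phase (a d.1) * d.2 (eqn c).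
  exact: (direction_generator Pd Vd ra fa).
have a0 : a d.1 != 0.
  have [_ [nu [N nz _]]] := Pd; have := gen _ N nz.
  by rewrite (normal_generator Vd N ra fa) mulf_eq0 negb_or => /andP[].
have near_t : \forall t \near F, (g t).2 f = phase (a (g t).1) * (g t).2 (eqn c).
  have H : \forall t \near F, [/\ sc_B c (g t).1, reg (g t).1 a &
    \forall z \near (g t).1, f z = a z * eqn c z] by exact: (gp _ Ha).
  apply: filterS (filterI gP H) => t [Pt [Bt rt ft]].
  have [Qt _] := Pt.
  exact: (direction_generator Pt (conj Bt Qt) rt ft).
have ca : phase (a (g t).1) @[t --> F] --> phase (a d.1).
  have cp : phase (a x) @[x --> d.1] --> phase (a d.1).
    exact: (phase_continuous (reg_continuous ra) a0).
  by move=> N HN; exact: (gp _ (cp _ HN)).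
have cf : phase (a (g t).1) * (g t).2 (eqn c) @[t --> F] --> d.2 f.
  by rewrite dE; exact: (cvgM ca ge).
have H1 : \forall t \near F, W (phase (a (g t).1) * (g t).2 (eqn c)).
  exact: (cf _ (open_near oW Wp)).
have H2 : \forall t \near F, O (g t).1 by exact: (gp _ (open_near oO Op)).
apply: filterS (filterI H2 (filterI H1 near_t)) => t [ Ot [Wt et]].
by split; rewrite //= et.
Qed.

End Directions.

Section Adapted.
Variables (R : realType) (n : nat) (Y : manifold (Cx R) n.+1) (Q : set Y).
Local Notation C := (Cx R).
Implicit Types (c : semistable_chart Q) (P : bundle R Y).

(** The transition rule is that of the phases of the values of a normal vector on
    the local equations of Q. *)
Definition adapted P (eta : forall c, btot P -> C) : Prop :=
  [/\ bgrp P = @unit_circle R, forall p, bset P p -> Q (bproj P p),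
      forall c, @fibre_coord R Y P (sc_V c) (eta c) &
      forall c c' p a, bset P p -> sc_V c (bproj P p) -> sc_V c' (bproj P p) ->
        reg (bproj P p) a ->
        (\forall y \near bproj P p, eqn c' y = a y * eqn c y) ->
        eta c' p = phase (a (bproj P p)) * eta c p].

Lemma direction_adapted :
  @adapted (direction_bundle Q) (fun c (d : direction Q) => d.2 (eqn c)).
Proof.
split => //; first by move=> d [].
- exact: direction_fibre_coord.
- by move=> c c' d a Pd Vd Vd' ra Ea; exact: (direction_generator Pd Vd ra Ea).
Qed.

Lemma circle_adapted h : hermitian_metric Q h ->
  @adapted (circle_normal_bundle Q h) (fun c v => phase (nv_fun v (eqn c))).
Proof.
move=> hh; split => //; first by move=> v _; exact: nv_mem.
- exact: circle_fibre_coord.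
- move=> c c' v a Pv Vv Vv' ra Ea.
  by rewrite (normal_generator Vv (nv_normal v) ra Ea) phaseM.
Qed.

Hypothesis charts : forall q, Q q -> exists c, sc_V c q.

Lemma adapted_principal P eta : @adapted P eta -> principal_bundle Q P.
Proof.
move=> [G PQ co _]; apply: fibre_coord_principal => //.
- by move=> k; rewrite G => k1; exact: norm1_neq0.
- by rewrite G /unit_circle /= normr1.
- by move=> k k'; rewrite G /unit_circle /= normrM => -> ->; rewrite mulr1.
- by move=> k; rewrite G /unit_circle /= normfV => ->; rewrite invr1.
by move=> q /charts[c Vq]; exists (sc_V c), (eta c); split => //; exact: chart_rel_open.
Qed.

Definition preserves_coords P P' (eta : forall c, btot P -> C)
    (eta' : forall c, btot P' -> C) (F : btot P -> btot P') : Prop :=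
  forall p, bset P p -> [/\ bset P' (F p), bproj P' (F p) = bproj P p &
    forall c, sc_V c (bproj P p) -> eta' c (F p) = eta c p].

Lemma preserves_iso P P' eta eta' (F : btot P -> btot P') :
  @adapted P eta -> @adapted P' eta' -> btot P -> preserves_coords eta eta' F ->
  bundle_iso F.
Proof.
move=> [G PQ co _] [G' PQ' co' _] p0 FP; apply: (coord_bundle_iso p0) PQ PQ' _ _.
- by rewrite G.
- by move=> p /FP[].
move=> q /charts[c Vq]; exists (sc_V c), (eta c), (eta' c); split => //.
  exact: chart_rel_open.
by move=> p /FP[_ _ H] Vp; exact: H.
Qed.

(** The two coordinates change by the same factor from c to c'. *)
Lemma coord_change P P' eta eta' c c' p p' : @adapted P eta -> @adapted P' eta' ->
  bset P p -> bset P' p' -> bproj P p = bproj P' p' -> sc_V c (bproj P p) ->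
  sc_V c' (bproj P p) -> eta' c p' = eta c p -> eta' c' p' = eta c' p.
Proof.
move=> [_ _ _ tr] [_ _ _ tr'] Pp Pp' pE Vc Vc' E.
have [a [ra a0 Ea]] := transition_exists Vc Vc'.
rewrite (tr c c' p a)// (tr' c c' p' a) -?pE//.
by rewrite E.
Qed.

Lemma preserves_exists P P' eta eta' : @adapted P eta -> @adapted P' eta' ->
  btot P' -> exists F : btot P -> btot P', preserves_coords eta eta' F.
Proof.
move=> A A' p0; have [G PQ co tr] := A; have [G' PQ' co' tr'] := A'.
exists (fun p => xget p0 [set p' | [/\ bset P' p', bproj P' p' = bproj P p &
  forall c, sc_V c (bproj P p) -> eta' c p' = eta c p]]).
move=> p Pp; case: xgetP => [//|no].
have [c Vc] := charts (PQ _ Pp); have [e1 _ _ _ _] := co c.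
have [_ _ ex _ _] := co' c; have [g1 _ _] := e1 _ Pp Vc.
rewrite G -G' in g1; have [p' [Pp' pE ee]] := ex _ _ Vc g1.
case: (no p'); split => // c' Vc'.
exact: (coord_change A A' Pp Pp' (esym pE) Vc Vc' ee).
Qed.

Lemma preserves_unique P P' eta' (F F' : btot P -> btot P') :
  (forall p, bset P p -> Q (bproj P p)) -> @adapted P' eta' ->
  (forall p, bset P p -> [/\ bset P' (F p), bproj P' (F p) = bproj P p, 
     bset P' (F' p), bproj P' (F' p) = bproj P p &
     exists2 c, sc_V c (bproj P p) & eta' c (F p) = eta' c (F' p)]) ->
  forall p, bset P p -> F p = F' p.
Proof.
move=> PQ [_ _ co' _] FF p Pp; have [P1 e1 P2 e2 [c Vc E]] := FF p Pp.
have [_ inj _ _ _] := co' c.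
by apply: inj; rewrite ?e1.
Qed.

End Adapted.

(** * Gluing and the isomorphism with normal circles *)

Section Gluing.
Variables (R : realType) (n : nat) (Y : manifold (Cx R) n.+1) (Q : set Y).
Variable theta : R.
Local Notation C := (Cx R).
Implicit Types (c : semistable_chart Q) (P : bundle R Y).

(** An isomorphism of bundles has an inverse defined on the whole total space, so
    that total spaces must not be empty. A flat function is not locally constant;
    at a point off its zero set, the phases of the values of functions form a point
    of the log space. *)
Lemma kn_inhabited c : inhabited (sc_kn c).
Proof.
have [rp _ fl] := @sc_flat _ _ _ _ c; pose D := sc_pi c @^-1` [set 0].
have [x px] : exists x, sc_pi c x != 0.
  apply: contrapT => no; have p0 x : sc_pi c x = 0.
    by apply/eqP; apply: contrapT => /negP px; apply: no; exists x.
  have := fl (Defs.inv (sc_c c) 0) (fun=> 1) (reg_cst _ 1).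
  have H : \forall y \near Defs.inv (sc_c c) 0,
      (sc_pi c y - sc_pi c (Defs.inv (sc_c c) 0)) * 1 = 0 :> C.
    by apply: nearW => y; rewrite !p0 subr0 mul0r.
  by move=> /(_ H)/nbhs_singleton/eqP; rewrite oner_eq0.
have nD : ~ D x by move=> /eqP; apply/negP.
have nz f : log_monoid D x f -> f x != 0 by move=> [_ /nbhs_singleton]; exact.
have gz f : log_group D x f -> f x != 0.
  move=> [g [k [/nz g0 /nz k0 /nbhs_singleton fE]]].
  by rewrite fE// mulf_neq0// invr_eq0.
pose h f : C := if `[< log_group D x f >] then phase (f x) else 0.
have hE f : log_group D x f -> h f = phase (f x) by move=> gf; rewrite /h asboolT.
suff hh : is_log_phase D x h by exact: inhabits (KN hh).
split.
- by move=> f gf; rewrite hE// norm_phase// gz.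
- by move=> f g gf gg; rewrite !hE ?phaseM//; exact: log_groupM.
- move=> f g gf fg; have gg := near_eq_log_group gf fg.
  by rewrite !hE// (nbhs_singleton fg).
- by move=> f rf f0; rewrite hE//; exact: log_monoid_group (unit_log_monoid D rf f0).
- by move=> f ngf; rewrite /h asboolF.
Qed.

Lemma gluing_surj P (psi : forall c, btot (sc_bundle theta c) -> btot P) c p :
  is_gluing psi -> bset P p -> sc_V c (bproj P p) ->
  exists2 x, bset (sc_bundle theta c) x & psi c x = p.
Proof.
move=> [_ iso _] Pp Vp; have [_ [_ _ sur] _ _ _] := iso c.
by have [x Px xE] := sur p (conj Pp Vp); exists x.
Qed.

Lemma gluing_im P (psi : forall c, btot (sc_bundle theta c) -> btot P) c x :
  is_gluing psi -> bset (sc_bundle theta c) x ->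
  [/\ bset P (psi c x), sc_V c (bproj P (psi c x)) &
      bproj P (psi c x) = bproj (sc_bundle theta c) x].
Proof.
move=> [_ iso _] Px; have [_ [im _ _] _ pr _] := iso c.
by have [P1 V1] := im _ Px; split => //; exact: (pr _ Px).
Qed.

(** The circle coordinates h(v) of the charts, transported to P by the psi c. *)
Lemma gluing_adapted P (psi : forall c, btot (sc_bundle theta c) -> btot P) :
  (exists c : semistable_chart Q, True) -> is_gluing psi ->
  exists eta, @adapted R n Y Q P eta /\
    forall c x, bset (sc_bundle theta c) x -> eta c (psi c x) = kn_h x (sc_v c).
Proof.
move=> [c0 _] gl; have [pr iso glue] := gl.
have ex c : exists eta : btot P -> C, @fibre_coord R Y P (sc_V c) eta /\
    forall x, bset (sc_bundle theta c) x -> eta (psi c x) = kn_h x (sc_v c).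
  have [eta e1 e2] := fibre_coord_iso (chart_rel_open c) pr (iso c)
    (chart_fibre_coord theta c).
  by exists eta.
have [eta etaP] := choice ex; exists eta; split; last by move=> c; have [] := etaP c.
split.
- by have [<-] := iso c0.
- by have [[_ PQ] _ _ _ _] := pr.
- by move=> c; have [] := etaP c.
move=> c c' p a Pp Vp Vp' ra Ea.
have [x Px xE] := gluing_surj gl Pp Vp; have [x' Px' xE'] := gluing_surj gl Pp Vp'.
have [_ e1] := etaP c; have [_ e2] := etaP c'.
have id : kn_identified x x' by apply/glue => //; rewrite xE.
have [q [[Bq _] _ qE _ H]] := identified_circle id.
have [_ _ pE] := gluing_im gl Px.
have qp : q = bproj P p by rewrite -xE pE /= qE sc_embK.
rewrite -qp in ra Ea *.
have -> : eta c' p = kn_h x' (sc_v c') by rewrite -xE' e2.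
have -> : eta c p = kn_h x (sc_v c) by rewrite -xE e1.
exact: H.
Qed.

Hypothesis charts : forall q, Q q -> exists c, sc_V c q.

(** psi c sends a point of the log space to the point of P with the same
    coordinate; since the coordinates of P change like h(v) under the canonical
    identifications, the psi c identify exactly these points. *)
Lemma adapted_gluing P eta : @adapted R n Y Q P eta -> btot P ->
  exists psi : forall c, btot (sc_bundle theta c) -> btot P, is_gluing psi /\
    forall c x, bset (sc_bundle theta c) x -> eta c (psi c x) = kn_h x (sc_v c).
Proof.
move=> A p0; have [G PQ co tr] := A.
pose psi c (x : btot (sc_bundle theta c)) : btot P :=
  xget p0 [set p | [/\ bset P p, bproj P p = bproj (sc_bundle theta c) x &
                       eta c p = kn_h x (sc_v c)]].
have psiP c (x : btot (sc_bundle theta c)) : bset (sc_bundle theta c) x ->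
    [/\ bset P (psi c x), bproj P (psi c x) = bproj (sc_bundle theta c) x &
        eta c (psi c x) = kn_h x (sc_v c)].
  move=> Px; rewrite /psi; case: xgetP => [//|no].
  have [_ _ ex _ _] := co c; have [Vx _] := bset_pt Px.
  have [_ n1 _] := bset_uv Px.
  have Gk : bgrp P (kn_h x (sc_v c)) by rewrite G.
  by have [p pP] := ex _ _ Vx Gk; case: (no p).
exists psi; split; last by move=> c x /psiP[].
have PV c x : bset (sc_bundle theta c) x -> sc_V c (bproj (sc_bundle theta c) x).
  by move=> Px; have [] := bset_pt Px.
split.
- exact: (adapted_principal charts A).
- move=> c; have [k0] := kn_inhabited c.
  apply: (@coord_bundle_iso R Y (sc_V c) (sc_bundle theta c) _ _ k0) => //.
  + by move=> x; exact: PV.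
  + by move=> p [].
  + move=> x Px; have [P1 E1 _] := psiP _ _ Px; split => //; split => //.
    by rewrite /preimage /= E1; exact: PV.
  move=> q Vq; exists (sc_V c), (fun x : sc_kn c => kn_h x (sc_v c)), (eta c).
  split => //.
  + by exists setT; [exact: openT|rewrite setIT].
  + exact: chart_fibre_coord.
  + exact: fibre_coord_restrict.
  + by move=> x Px _; have [] := psiP _ _ Px.
move=> c c' x x' Px Px'; have [P1 E1 e1] := psiP _ _ Px.
have [P2 E2 e2] := psiP _ _ Px'; have Vx := PV _ _ Px; have Vx' := PV _ _ Px'.
split=> [E|id].
  have qE : bproj (sc_bundle theta c) x = bproj (sc_bundle theta c') x'.
    by rewrite -E1 E E2.
  set q := bproj (sc_bundle theta c) x in qE Vx.
  rewrite -qE in Vx'; have [a [ra a0 Ea]] := transition_exists Vx Vx'.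
  apply: (circle_identified Px Px' Vx Vx' _ _ ra a0 Ea).
  + by have [_ <-] := bset_pt Px.
  + by have [_ <-] := bset_pt Px'; rewrite qE.
  rewrite -e2 -E -e1; have := tr c c' (psi c x) a P1; rewrite E1; exact.
have [q [Vq Vq' qE qE' H]] := identified_circle id.
have pE : bproj (sc_bundle theta c) x = q by rewrite /= qE sc_embK//; case: Vq.
have pE' : bproj (sc_bundle theta c') x' = q by rewrite /= qE' sc_embK//; case: Vq'.
have [a [ra a0 Ea]] := transition_exists Vq Vq'.
have [_ inj _ _ _] := co c'.
apply: inj => //; rewrite ?E1 ?E2 ?pE ?pE'//.
rewrite e2 (H a)// -e1; have := tr c c' (psi c x) a P1; rewrite E1 pE; exact.
Qed.

(** Both bundles have coordinates that restrict to h(v) on the charts, and a map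
    that is compatible with the charts has to preserve them. *)
Lemma gluing_map P P' (psi : forall c, btot (sc_bundle theta c) -> btot P)
    (psi' : forall c, btot (sc_bundle theta c) -> btot P') :
  (exists q, Q q) -> is_gluing psi -> is_gluing psi' ->
  exists F : btot P -> btot P', [/\ bundle_iso F,
    forall c x, bset (sc_bundle theta c) x -> F (psi c x) = psi' c x &
    forall F' : btot P -> btot P', bundle_iso F' ->
      (forall c x, bset (sc_bundle theta c) x -> F' (psi c x) = psi' c x) ->
      forall y, bset P y -> F' y = F y].
Proof.
move=> [q0 Qq0] gl gl'; have [c0 _] := charts Qq0.
have ex : exists c : semistable_chart Q, True by exists c0.
have [k0] := kn_inhabited c0.
have [eta [A E]] := gluing_adapted ex gl; have [eta' [A' E']] := gluing_adapted ex gl'.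
have [F FP] := preserves_exists charts A A' (psi' c0 k0).
have FE c x : bset (sc_bundle theta c) x -> F (psi c x) = psi' c x.
  move=> Px; have [P1 V1 e1] := gluing_im gl Px.
  have [P2 V2 e2] := gluing_im gl' Px; have [P3 e3 H] := FP _ P1.
  have [_ _ co' _] := A'; have [_ inj _ _ _] := co' c.
  by apply: inj => //; [rewrite e3|rewrite e3 e1 e2|rewrite H// E// E'].
exists F; split => //.
  exact: (preserves_iso charts A A' (psi c0 k0) FP).
move=> F' _ FE' y Py; have [_ PQ _ _] := A; have [c Vc] := charts (PQ _ Py).
by have [x Px <-] := gluing_surj gl Py Vc; rewrite FE' // FE.
Qed.

Lemma canonical_preserves P psi h Phi eta :
  @is_gluing _ _ _ Q theta P psi -> @canonical_iso _ _ _ Q theta P psi h Phi ->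
  (forall c x, bset (sc_bundle theta c) x -> eta c (psi c x) = kn_h x (sc_v c)) ->
  @preserves_coords _ _ _ Q P (circle_normal_bundle Q h) eta
    (fun c v => phase (nv_fun v (eqn c))) Phi.
Proof.
move=> gl [[_ [im _ _] _ pr _] ph] E p Pp; split; [exact: im|exact: pr|].
move=> c Vc; have [x Px <-] := gluing_surj gl Pp Vc.
by rewrite E// -(ph c x Px).
Qed.

Lemma canonical_exists P psi h : (exists q, Q q) ->
  @is_gluing _ _ _ Q theta P psi -> hermitian_metric Q h ->
  exists Phi : btot P -> nvec Q, canonical_iso psi h Phi /\
    (forall Phi' : btot P -> nvec Q, canonical_iso psi h Phi' ->
       forall y, bset P y -> Phi' y = Phi y).
Proof.
move=> [q0 Qq0] gl hh; have [c0 V0] := charts Qq0.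
have ex : exists c : semistable_chart Q, True by exists c0.
have [k0] := kn_inhabited c0; have [v0 _ _] := nvec_exists 0 V0.
have [eta [A E]] := gluing_adapted ex gl.
have A' := circle_adapted hh.
have [Phi PhiP] := preserves_exists charts A A' v0.
exists Phi; split.
  split; first exact: (preserves_iso charts A A' (psi c0 k0) PhiP).
  move=> c x Px; have [P1 V1 _] := gluing_im gl Px; have [_ _ H] := PhiP _ P1.
  by rewrite -(E c x Px) -(H c V1).
move=> Phi' can; have PhiP' := canonical_preserves gl can E.
have [_ PQ _ _] := A.
apply: (preserves_unique PQ A') => p Pp.
have [e1 e2 e3] := PhiP' _ Pp; have [d1 d2 d3] := PhiP _ Pp.
split => //; have [c Vc] := charts (PQ _ Pp); exists c => //.
by rewrite e3// d3.
Qed.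

End Gluing.

(** * Isotopy *)

Lemma cvg_combination (K : numFieldType) (T : Type) (F : set_system T)
    (f g f' g' : T -> K) (a b a' b' : K) : Filter F -> f @ F --> a -> g @ F --> b ->
  f' @ F --> a' -> g' @ F --> b' ->
  f t * g t + f' t * g' t @[t --> F] --> a * b + a' * b'.
Proof. by move=> FF fa gb fa' gb'; exact: (cvgD (cvgM fa gb) (cvgM fa' gb')). Qed.

Lemma combination_linear (K : comRingType) (a b k x y x' y' : K) :
  a * (k * x + y) + b * (k * x' + y') = k * (a * x + b * x') + (a * y + b * y').
Proof. by rewrite !mulrDr addrACA !(mulrCA _ k). Qed.

Lemma combination_conj (K : numClosedFieldType) (a b x y : K) : 0 <= a -> 0 <= b ->
  a * x^* + b * y^* = (a * x + b * y)^*.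
Proof.
move=> a0 b0; have E : (a * x + b * y)^* = (a * x)^* + (b * y)^* by exact: rmorphD.
have Ea : (a * x)^* = a^* * x^* by exact: rmorphM.
have Eb : (b * y)^* = b^* * y^* by exact: rmorphM.
by rewrite E Ea Eb (geC0_conj a0) (geC0_conj b0).
Qed.

Section Isotopy.
Variables (R : realType) (n : nat) (Y : manifold (Cx R) n.+1) (Q : set Y).
Variable theta : R.
Local Notation C := (Cx R).
Implicit Types (c : semistable_chart Q) (P : bundle R Y).
Local Notation metric := (Y -> ((Y -> C) -> C) -> ((Y -> C) -> C) -> C).

Definition combine_metrics (a b : C) (h0 h1 : metric) : metric :=
  fun q nu mu => a * h0 q nu mu + b * h1 q nu mu.

Lemma combine_hermitian a b h0 h1 : 0 <= a -> 0 <= b -> 0 < a + b ->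
  hermitian_metric Q h0 -> hermitian_metric Q h1 ->
  hermitian_metric Q (combine_metrics a b h0 h1).
Proof.
move=> a0 b0 ab hh0 hh1.
have [l0 s0 p0 c0] := hh0; have [l1 s1 p1 c1] := hh1; split.
- move=> q k nu mu om Qq N M O; rewrite /combine_metrics l0// l1//.
  exact: combination_linear.
- move=> q nu mu Qq N M; rewrite /combine_metrics (s0 q nu mu)// (s1 q nu mu)//.
  exact: combination_conj.
- move=> q nu Qq N nz; have H0 := p0 q nu Qq N nz; have H1 := p1 q nu Qq N nz.
  rewrite /combine_metrics; have [a1|an] := eqVneq a 0.
    rewrite a1 add0r in ab; rewrite a1 mul0r add0r; exact: mulr_gt0.
  have a1 : 0 < a by rewrite lt_def an.
  by apply: ltr_pwDl; [exact: mulr_gt0|apply: mulr_ge0 => //; exact: ltW].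
move=> v; have ca : (fun=> a) @ nbhs v --> a by exact: cvg_cst.
have cb : (fun=> b) @ nbhs v --> b by exact: cvg_cst.
exact: (cvg_combination (nbhs_filter v) ca (c0 v) cb (c1 v)).
Qed.

(** Rescale Phi0 to unit length for the metric (1 - s) h0 + s h1. At s = 1 this is
    Phi1, as both have the same phases. *)
Lemma canonical_isotopic P psi h0 h1 Phi0 Phi1 :
  (forall q, Q q -> exists c, sc_V c q) -> (exists q, Q q) ->
  @is_gluing _ _ _ Q theta P psi -> hermitian_metric Q h0 -> hermitian_metric Q h1 ->
  canonical_iso psi h0 Phi0 -> canonical_iso psi h1 Phi1 ->
  isotopic h0 h1 Phi0 Phi1.
Proof.
move=> charts [q0 Qq0] gl hh0 hh1 can0 can1; have [cq V0] := charts _ Qq0.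
have ex : exists c : semistable_chart Q, True by exists cq.
have [k0] := kn_inhabited cq.
have [eta [A E]] := gluing_adapted ex gl; have [_ PQ co _] := A.
have C0 := canonical_preserves gl can0 E; have C1 := canonical_preserves gl can1 E.
pose hs (s : R) := combine_metrics (toC (1 - s)) (toC s) h0 h1.
have hhs s : 0 <= s <= 1 -> hermitian_metric Q (hs s).
  move=> /andP[s0 s1]; apply: combine_hermitian => //.
  - by rewrite toC_ge0 subr_ge0.
  - by rewrite toC_ge0.
  by rewrite -toCD subrK toC_gt0 ltr01.
pose N s (v : nvec Q) := hs s (nv_pt v) (nv_fun v) (nv_fun v).
have nz p : bset P p -> exists f, nv_fun (Phi0 p) f != 0.
  by move=> /C0[/(unit_neq0 hh0)].
have N0 s p : 0 <= s <= 1 -> bset P p -> 0 < N s (Phi0 p).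
  by move=> /hhs hh Pp; exact: (sqnorm_gt0 hh (nz _ Pp)).
pose H (sp : R * btot P) := nv_scale (sqrtC (N sp.1 (Phi0 sp.2)))^-1 (Phi0 sp.2).
have HP s p : 0 <= s <= 1 -> bset P p -> [/\ N s (H (s, p)) = 1,
    nv_pt (H (s, p)) = bproj P p & forall c, sc_V c (bproj P p) ->
      phase (nv_fun (H (s, p)) (eqn c)) = eta c p].
  move=> s01 Pp; have Nsp := N0 _ _ s01 Pp; have [u0 e0 ph0] := C0 _ Pp.
  have r0 : 0 < (sqrtC (N s (Phi0 p)))^-1 by rewrite invr_gt0 sqrtC_gt0.
  split => //; last first.
    by move=> c Vc; rewrite /H /= phaseM (phase_pos r0) mul1r ph0.
  have E2 := metric_scale (hhs s s01) (sqrtC (N s (Phi0 p)))^-1 (Phi0 p).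
  rewrite /N /H /= in E2 *; rewrite E2 (gtr0_norm r0).
  by rewrite exprVn sqrtCK mulVf// gt_eqF.
exists H; split.
- apply/subspace_continuousP => -[s p] [/= s01 Pp].
  have [c Vc] := charts _ (PQ _ Pp).
  set W := [set sp : R * btot P | _].
  have FW : Filter (within W (nbhs (s, p))) by exact: within_filter.
  have nW : \forall sp \near within W (nbhs (s, p)), W sp.
    exact: near_within_self.
  have [_ e0 _] := C0 _ Pp; have [_ eH _] := HP _ _ s01 Pp.
  have cfst : fst @ within W (nbhs (s, p)) --> s.
    by apply: cvg_trans (cvg_app _ (@cvg_within _ _ _ _)) _; exact: cvg_fst.
  have [[_ _ [cPhi _] _ _] _] := can0.
  move/subspace_continuousP in cPhi.
  have cP : (fun sp : R * btot P => Phi0 sp.2) @ within W (nbhs (s, p)) --> Phi0 p.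
    move=> U /(cPhi _ Pp) HU.
    have HU' : \forall p' \near p, bset P p' -> U (Phi0 p') by exact: HU.
    have c2 : snd @ nbhs (s, p) --> p by exact: cvg_snd.
    have H2 : \forall sp \near (s, p), bset P sp.2 -> U (Phi0 sp.2).
      exact: (c2 _ HU').
    by apply: filterS H2 => sp Hsp [_ Psp]; exact: Hsp.
  have V0p : sc_V c (nv_pt (Phi0 p)) by rewrite -e0 in Vc.
  have VH : sc_V c (nv_pt (H (s, p))) by rewrite eH.
  have cpt : nv_pt (Phi0 sp.2) @[sp --> within W (nbhs (s, p))] --> nv_pt (Phi0 p).
    by move=> U HU; exact: (cP _ (nv_pt_continuous HU)).
  have cfun : nv_fun (Phi0 sp.2) (eqn c) @[sp --> within W (nbhs (s, p))] -->
      nv_fun (Phi0 p) (eqn c).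
    by move=> U HU; exact: (cP _ (nv_eqn_continuous V0p HU)).
  have cT (f : R * btot P -> R) r : f @ within W (nbhs (s, p)) --> r ->
      toC (f sp) @[sp --> within W (nbhs (s, p))] --> toC r.
    by move=> fr U HU; exact: (fr _ (continuous_toC HU)).
  have cN : N sp.1 (Phi0 sp.2) @[sp --> within W (nbhs (s, p))] --> N s (Phi0 p).
    apply: (cvg_combination FW).
    + by apply: cT; apply: cvgB => //; exact: cvg_cst.
    + by move=> U HU; exact: (cP _ (metric_continuous hh0 HU)).
    + exact: cT.
    + by move=> U HU; exact: (cP _ (metric_continuous hh1 HU)).
  have Nsp := N0 _ _ s01 Pp.
  have cS : sqrtC (N sp.1 (Phi0 sp.2)) @[sp --> within W (nbhs (s, p))] -->
      sqrtC (N s (Phi0 p)).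
    apply: (cvg_sqrt FW); first by rewrite sqrtC_gt0.
      by apply: filterS nW => sp [s01' Pp']; rewrite sqrtC_ge0 ltW// N0.
    rewrite sqrtCK => U HU.
    have HU' : \forall sp \near within W (nbhs (s, p)), U (N sp.1 (Phi0 sp.2)).
      exact: (cN _ HU).
    by apply: filterS HU' => sp; rewrite /= sqrtCK.
  have S0 : sqrtC (N s (Phi0 p)) != 0 by rewrite lt0r_neq0// sqrtC_gt0.
  apply: (nvec_cvg FW VH); first exact: cpt.
  exact: (cvgM (cvg_inv FW S0 cS) cfun).
- move=> s s01.
  apply: (preserves_iso charts A (circle_adapted (hhs s s01)) (psi cq k0)).
  by move=> p Pp; have [e1 e2 e3] := HP _ _ s01 Pp; split.
have hom p s Phi h : bset P p -> 0 <= s <= 1 -> hermitian_metric Q h ->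
    canonical_iso psi h Phi -> (forall v, N s v = h (nv_pt v) (nv_fun v) (nv_fun v)) ->
    H (s, p) = Phi p.
  move=> Pp s01 hh can Nh; have [e1 e2 e3] := HP _ _ s01 Pp.
  have [d1 d2 d3] := canonical_preserves gl can E Pp.
  have [c Vc] := charts _ (PQ _ Pp).
  have [_ inj _ _ _] := circle_fibre_coord hh c.
  apply: inj => //.
  - by have := Nh (H (s, p)); rewrite e1 => /esym.
  - by rewrite /= e2.
  - by rewrite /= e2; exact/esym.
  by rewrite e3// d3.
move=> p Pp; split.
  apply: (hom p 0 Phi0 h0) => //; first by rewrite lexx ler01.
  by move=> v; rewrite /N /hs /combine_metrics subr0 toC1 toC0 mul1r mul0r addr0.
apply: (hom p 1 Phi1 h1) => //; first by rewrite lexx ler01.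
by move=> v; rewrite /N /hs /combine_metrics subrr toC1 toC0 mul1r mul0r add0r.
Qed.

End Isotopy.

(** * Chern classes *)

Section Exponential.
Variable R : realType.
Local Notation C := (Cx R).
Local Notation Re := (@complex.Re R).

Lemma exp2ipi_phase (z : C) : phase (exp2ipi z) = exp2ipi (toC (Re z)).
Proof.
rewrite /exp2ipi phaseM phase_pos ?toC_gt0 ?expR_gt0// mul1r.
by rewrite phase_norm1 ?norm_expi//= mulr0 oppr0 expR0 toC1 mul1r.
Qed.

Definition imaginary (y : R) : C := (0 +i* y)%C.

Lemma imaginaryE y : imaginary y = imaginary 1 * toC y.
Proof. by apply/eqP; rewrite eq_complex /=; apply/andP; split; apply/eqP; ring. Qed.

Lemma imaginaryD x y : imaginary (x + y) = imaginary x + imaginary y.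
Proof. by apply/eqP; rewrite eq_complex /= addr0 !eqxx. Qed.

Lemma exp2ipi_imaginary (z : C) (y : R) :
  exp2ipi (z + imaginary y) = toC (expR (- (2 * pi * y))) * exp2ipi z.
Proof.
case: z => a b; rewrite /exp2ipi /imaginary /= addr0 mulrA -toCM -expRD.
by congr (toC (expR _) * _); rewrite mulrDr opprD addrC.
Qed.

(** To be added to the logarithm of a transition function that is divided by r. *)
Definition log_scale (r : R) : C := imaginary (ln r / (2 * pi)).

Lemma exp2ipi_scale (z : C) (r : R) : 0 < r ->
  exp2ipi (z + log_scale r) = toC r^-1 * exp2ipi z.
Proof.
move=> r0; rewrite exp2ipi_imaginary; congr (toC _ * _).
have pi0 : 2 * pi != 0 :> R by rewrite mulf_neq0// gt_eqF// pi_gt0.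
by rewrite mulrC divfK// expRN lnK.
Qed.

Lemma log_scaleM (r s : R) : 0 < r -> 0 < s ->
  log_scale (r * s) = log_scale r + log_scale s.
Proof. by move=> r0 s0; rewrite /log_scale lnM// mulrDl imaginaryD. Qed.

Lemma log_scale_continuous (z : C) : z != 0 ->
  {for z, continuous (fun z : C => log_scale (Re `|z|))}.
Proof.
move=> z0; have [r r0 rE] : exists2 r, 0 < r & `|z| = toC r.
  by apply: gt0_toC; rewrite normr_gt0.
have c1 : Re `|w| @[w --> z] --> r.
  have cn : `|w| @[w --> z] --> toC r.
    by rewrite -rE; exact: (@norm_continuous _ _ z).
  by move=> B HB; exact: (cn _ (@continuous_Re R (toC r) B HB)).
have c2 : ln (Re `|w|) @[w --> z] --> ln r.
  by move=> B HB; exact: (c1 _ (continuous_ln r0 HB)).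
have c3 : ln (Re `|w|) / (2 * pi) @[w --> z] --> ln r / (2 * pi).
  by apply: cvgM c2 _; exact: cvg_cst.
have c4 : toC (ln (Re `|w|) / (2 * pi)) @[w --> z] --> toC (ln r / (2 * pi)).
  by move=> B HB; exact: (c3 _ (continuous_toC HB)).
have c5 : (fun=> imaginary 1) @ nbhs z --> imaginary 1 by exact: cvg_cst.
have c6 : imaginary 1 * toC (ln (Re `|w|) / (2 * pi)) @[w --> z] -->
    imaginary 1 * toC (ln r / (2 * pi)) by exact: (cvgM c5 c4).
have zE : log_scale (Re `|z|) = imaginary 1 * toC (ln r / (2 * pi)).
  by rewrite rE /log_scale [LHS]imaginaryE.
move=> B HB; have HB' : nbhs (imaginary 1 * toC (ln r / (2 * pi))) B.
  by rewrite -zE; exact: HB.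
have H : \forall w \near z, B (imaginary 1 * toC (ln (Re `|w|) / (2 * pi))).
  exact: (c6 _ HB').
by apply: filterS H => w; rewrite -imaginaryE.
Qed.

End Exponential.

Section Refinement.
Variables (R : realType) (X : topologicalType) (A : set X).

(** Two cocycles are compared on a common refinement, which can be intersected
    with V. *)
Lemma cech_class_refine (U V : X -> set X) (c : cochain2 X) :
  cover_of A V -> (forall x, A x -> V x `<=` U x) ->
  cech_class A (U, c) = cech_class A (V, c).
Proof.
move=> cV VU; apply/seteqP; split=> -[U' c'] [cc [W [b [cW WU lb bE]]]];
  split=> //.
- pose W' x := W x `&` V x.
  have o2 x y q : overlap2 A W' x y q -> overlap2 A W x y q.
    by move=> [Ax Ay [Aq [Wx _] [Wy _]]].
  exists W', b; split.
  + move=> x Ax; have [oW Wx] := cW x Ax; have [oV Vx] := cV x Ax.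
    by split; [exact: openI|].
  + by move=> x Ax y [Wy Vy]; have [] := WU _ Ax _ Wy.
  + by move=> x y q /o2/lb.
  + by move=> x y z q [/o2 H1 /o2 H2]; apply: bE.
- exists W, b; split => // x Ax y Wy.
  by have [Vy U'y] := WU _ Ax _ Wy; split => //; exact: VU Vy.
Qed.

End Refinement.

Lemma scaled_phase (K : fieldType) (e a r t : K) :
  e * (a / r * t) = r^-1 * e * (a * t).
Proof. by rewrite (mulrC a) !mulrA (mulrC e). Qed.

Lemma cocycle_shift (K : comRingType) (a b c r s : K) :
  a - b + c = a + s - (b + (r + s)) + (c + r).
Proof. ring. Qed.

Section ChernClass.
Variables (R : realType) (n : nat) (Y : manifold (Cx R) n.+1) (Q : set Y).
Local Notation C := (Cx R).
Local Notation N := (normal_bundle Q).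
Implicit Types (c : semistable_chart Q) (P : bundle R Y).
Hypothesis charts : forall q, Q q -> exists c, sc_V c q.
Variables (P : bundle R Y) (eta : forall c : semistable_chart Q, btot P -> C).
Hypothesis A : adapted eta.
Variable p0 : btot P.

Lemma intr_Re (m : int) (z : C) : m%:~R = z -> m%:~R = toC (@complex.Re R z).
Proof.
move=> <-; rewrite toC_Re//; exact: realz.
Qed.

(** Replace nonzero sections by their directions: the transition functions become
    their phases, with logarithms Re f, and the integers f_yz - f_xz + f_xy are not
    changed by the real part. *)
Lemma normal_circle_c1 (K : H2 Q) : is_c1 N K -> is_c1 P K.
Proof.
have [G PQ co tr] := A.
move=> [U [s [f [k [[cU KE] sP fc sE kE]]]]].
have exD (v : nvec Q) : exists p, (exists g, nv_fun v g != 0) ->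
    [/\ bset P p, bproj P p = nv_pt v &
        forall c, sc_V c (nv_pt v) -> eta c p = phase (nv_fun v (eqn c))].
  have [v0|nv] := pselect (exists g, nv_fun v g != 0); last by exists p0.
  have [c Vc] := charts (nv_mem v); have [_ _ ex _ _] := co c.
  have Gk : bgrp P (phase (nv_fun v (eqn c))).
    by rewrite G /unit_circle /= norm_phase//; exact/(nvec_neq0 Vc).
  have [p [Pp pE ep]] := ex _ _ Vc Gk; exists p => _; split => // c' Vc'.
  have [a [ra a0 Ea]] := transition_exists Vc Vc'.
  rewrite (tr c c' p a) ?pE// ep.
  by rewrite (normal_generator Vc (nv_normal v) ra Ea) phaseM.
have [D DP] := choice exD.
exists U, (fun x q => D (s x q)), (fun x y q => toC (@complex.Re R (f x y q))), k.
split.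
- by split.
- move=> x Qx; have [sc sN] := sP x Qx.
  split; last first.
    by move=> q Qq Uq; have [/DP[P1 E1 _] E2] := sN q Qq Uq; rewrite E1.
  apply/subspace_continuousP => q [Qq Uq].
  move/subspace_continuousP in sc; have [/DP[P1 E1 H1] /= E2] := sN q Qq Uq.
  have [c Vc] := charts Qq; have [_ _ _ _ crit] := co c.
  set W := within _ _; have FW : Filter W by exact: within_filter.
  have nW : \forall t \near W, Q t /\ U x t by exact: near_within_self.
  have VP : sc_V c (bproj P (D (s x q))) by rewrite E1 E2.
  have VS : sc_V c (nv_pt (s x q)) by rewrite E2.
  have cs : s x @ W --> s x q by exact: (sc q (conj Qq Uq)).
  apply: (crit _ W (fun t => D (s x t)) _ FW P1 VP).
  + by apply: filterS nW => t [Qt Ut]; have [/DP[]] := sN t Qt Ut.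
  + rewrite E1 E2 => B HB; have HB' : \forall t \near W, B t by exact: (@cvg_within _ (nbhs q) _ _ _ HB).
    apply: filterS (filterI HB' nW) => t [Bt [Qt Ut]].
    by have [/DP[_ E3 _] /= E4] := sN t Qt Ut; rewrite /= E3 E4.
  have v0 : nv_fun (s x q) (eqn c) != 0 by apply/(nvec_neq0 VS); case: (sN q Qq Uq).
  have cv : {for s x q, continuous (fun v : nvec Q => phase (nv_fun v (eqn c)))}.
    exact: (phase_continuous (nv_eqn_continuous VS) v0).
  rewrite H1// => B HB.
  have HB1 : \forall t \near W, B (phase (nv_fun (s x t) (eqn c))).
    exact: (cs _ (cv _ HB)).
  have HB2 : \forall t \near W, sc_B c t by exact: (@cvg_within _ (nbhs q) _ _ _ (B_near Vc.1)).
  apply: filterS (filterI (filterI HB1 HB2) nW) => t [[Bt Ct] [Qt Ut]].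
  have [/DP[_ _ H3] /= E4] := sN t Qt Ut.
  by rewrite /= H3// E4.
- move=> x y Qx Qy; have cf := fc x y Qx Qy.
  move/subspace_continuousP in cf; apply/subspace_continuousP => q Hq B HB.
  have cR : {for f x y q, continuous (fun z : C => toC (@complex.Re R z))}.
    by move=> B' HB'; exact: (continuous_Re (continuous_toC HB')).
  exact: (cf q Hq _ (cR _ HB)).
- move=> x y q ov; have [Qx Qy [Qq Ux Uy]] := ov.
  have [e0 sEq] := sE x y q ov.
  rewrite -exp2ipi_phase; set e := exp2ipi _ in e0 sEq *.
  have Ge : bgrp P (phase e) by rewrite G /unit_circle /= norm_phase.
  split => //; have [_ sNx] := sP x Qx; have [_ sNy] := sP y Qy.
  have [/DP[P1 E1 H1] /= F1] := sNx q Qq Ux; have [/DP[P2 E2 H2] /= F2] := sNy q Qq Uy.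
  have [c Vc] := charts Qq; have [_ inj _ ac _] := co c.
  have V1 : sc_V c (bproj P (D (s x q))) by rewrite E1 F1.
  have [a1 a2 a3] := ac _ _ Ge P1 V1.
  apply: inj => //; first by rewrite E2 F2.
    by rewrite a2 E1 E2 F1 F2.
  by rewrite a3 H1 ?F1// H2 ?F2// sEq /= phaseM.
- move=> x y z q ov; rewrite (intr_Re (kE x y z q ov)) ReD ReB toCD toCB.
  by [].
Qed.

(** Over chart domains, lift a section to the normal vectors with the same
    coordinate of modulus 1. The transition functions are divided by the moduli
    r_xy of those of the charts, and log r_xy is an additive cocycle, so that the
    integers f_yz - f_xz + f_xy do not change. *)
Lemma circle_normal_c1 (K : H2 Q) : (exists q, Q q) -> is_c1 P K -> is_c1 N K.
Proof.
have [G PQ co tr] := A.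
move=> [q0 Qq0] [U [s [f [k [[cU KE] sP fc sE kE]]]]].
have [c0 V0] := charts Qq0; have [v0 _ _] := nvec_exists 0 V0.
have exc x : exists c : semistable_chart Q, Q x -> sc_V c x.
  have [/charts[c Vc]|nQ] := pselect (Q x); first by exists c.
  by exists c0.
have [cx cxP] := choice exc.
pose V x := U x `&` sc_B (cx x).
pose w x q := xget v0 [set v : nvec Q | nv_pt v = q /\
  nv_fun v (eqn (cx x)) = eta (cx x) (s x q)].
have VcV x q : Q q -> V x q -> sc_V (cx x) q by move=> Qq [_ Bq].
have wP x q : Q q -> V x q -> nv_pt (w x q) = q /\
    nv_fun (w x q) (eqn (cx x)) = eta (cx x) (s x q).
  move=> Qq Vq; rewrite /w; case: xgetP => [//|no].
  have [v vq vE] := nvec_exists (eta (cx x) (s x q)) (VcV _ _ Qq Vq).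
  by case: (no v).
have sV x q : Q x -> Q q -> V x q -> [/\ bset P (s x q), bproj P (s x q) = q &
    `|eta (cx x) (s x q)| = 1].
  move=> Qx Qq [Uq Bq]; have [_ sx] := sP x Qx; have [S1 S2] := sx q Qq Uq.
  have Vs : sc_V (cx x) (bproj P (s x q)) by rewrite S2.
  have [c1 _ _ _ _] := co (cx x); have [g1 _ _] := c1 _ S1 Vs.
  by split => //; rewrite G in g1.
have wnz x q : Q x -> Q q -> V x q -> exists g, nv_fun (w x q) g != 0.
  move=> Qx Qq Vq; have [w1 w2] := wP x q Qq Vq; have [_ _ n1] := sV x q Qx Qq Vq.
  by exists (eqn (cx x)); rewrite w2 norm1_neq0.
pose r x y q := @complex.Re R `|nv_fun (w x q) (eqn (cx y))|.
have rP x y q : Q x -> Q q -> V x q -> V y q ->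
    0 < r x y q /\ `|nv_fun (w x q) (eqn (cx y))| = toC (r x y q).
  move=> Qx Qq Vx Vy; have [w1 _] := wP x q Qq Vx.
  have Vw : sc_V (cx y) (nv_pt (w x q)) by rewrite w1; exact: VcV.
  have nz : nv_fun (w x q) (eqn (cx y)) != 0.
    by apply/(nvec_neq0 Vw); exact: wnz.
  have [t t0 tE] : exists2 t, 0 < t & `|nv_fun (w x q) (eqn (cx y))| = toC t.
    by apply: gt0_toC; rewrite normr_gt0.
  by rewrite /r tE.
have cV : cover_of Q V.
  move=> x Qx; have [oU Ux] := cU x Qx; have [Bx _] := cxP _ Qx.
  by split; [apply: openI => //; exact: sc_B_open|].
have VU x : Q x -> V x `<=` U x by move=> _ y [].
have wE x y q : Q x -> Q y -> Q q -> V x q -> V y q ->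
    w y q = nv_scale (exp2ipi (f x y q + log_scale (r x y q))) (w x q).
  move=> Qx Qy Qq Vx Vy; have [r0 rE] := rP x y q Qx Qq Vx Vy.
  have [w1 w2] := wP x q Qq Vx; have [w3 w4] := wP y q Qq Vy.
  have Vqx := VcV _ _ Qq Vx; have Vqy := VcV _ _ Qq Vy.
  have [S1 S2 _] := sV x q Qx Qq Vx.
  have ov : overlap2 Q U x y q by split => //; split => //; [case: Vx|case: Vy].
  have [e1 sEq] := sE x y q ov.
  have [a [ra a0 Ea]] := transition_exists Vqx Vqy.
  have Vw : sc_V (cx y) (nv_pt (w y q)) by rewrite w3.
  apply: (nvec_coord_inj Vw); first by rewrite w3 /= w1.
  have Vs : sc_V (cx y) (bproj P (s x q)) by rewrite S2.
  have [_ _ _ ac _] := co (cx y); have [_ _ a3] := ac _ _ e1 S1 Vs.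
  have tr1 := tr (cx x) (cx y) (s x q) a S1; rewrite S2 in tr1.
  have gen : nv_fun (w x q) (eqn (cx y)) = a q * nv_fun (w x q) (eqn (cx x)).
    by have N := nv_normal (w x q); rewrite w1 in N; exact: (normal_generator Vqx N ra Ea).
  have ra1 : toC (r x y q) = `|a q|.
    have [_ _ n1] := sV x q Qx Qq Vx.
    by rewrite -rE gen normrM w2 n1 mulr1.
  rewrite w4 sEq a3 tr1// exp2ipi_scale//= gen w2 toCV ra1 /phase.
  exact: scaled_phase.
exists V, w, (fun x y q => f x y q + log_scale (r x y q)), k.
have wc x : Q x -> forall q, Q q -> V x q ->
    w x @ within (Q `&` V x) (nbhs q) --> w x q.
  move=> Qx q Qq Vq; have [w1 w2] := wP x q Qq Vq; have [sc _] := sP x Qx.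
  move/subspace_continuousP in sc.
  have FW : Filter (within (Q `&` V x) (nbhs q)) by exact: within_filter.
  have nW : \forall t \near within (Q `&` V x) (nbhs q), Q t /\ V x t.
    exact: near_within_self.
  have Vw : sc_V (cx x) (nv_pt (w x q)) by rewrite w1; exact: VcV.
  have [S1 S2 _] := sV x q Qx Qq Vq.
  have Vs : sc_V (cx x) (bproj P (s x q)) by rewrite S2; exact: VcV.
  apply: (nvec_cvg FW Vw).
    rewrite w1 => B HB.
    have HB' : \forall t \near within (Q `&` V x) (nbhs q), B t.
      exact: (@cvg_within _ (nbhs q) _ _ _ HB).
    by apply: filterS (filterI HB' nW) => t [Bt [Qt Vt]]; have [/= -> _] := wP x t Qt Vt.
  rewrite w2 => B HB; have [c1 _ _ _ _] := co (cx x).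
  have [_ _ ce] := c1 _ S1 Vs.
  have HB1 : \forall p \near s x q, bset P p -> B (eta (cx x) p) by exact: (ce _ HB).
  have Uq : U x q by case: Vq.
  have HB2 : \forall t \near q, (Q t /\ U x t) -> bset P (s x t) -> B (eta (cx x) (s x t)).
    exact: (sc q (conj Qq Uq) _ HB1).
  rewrite /=; apply: filterS HB2 => t H [Qt Vt].
  have [_ /= ->] := wP x t Qt Vt; have [S3 _ _] := sV x t Qx Qt Vt.
  by apply: H => //; split => //; case: Vt.
split.
- by split => //; rewrite KE; exact: cech_class_refine.
- move=> x Qx; split; first by apply/subspace_continuousP => q [Qq Vq]; exact: wc.
  by move=> q Qq Vq; have [w1 _] := wP x q Qq Vq; split => //; exact: wnz.
- move=> x y Qx Qy; apply/subspace_continuousP => q [[Qq Vx] Vy].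
  have cf := fc x y Qx Qy; move/subspace_continuousP in cf.
  have Uxy : (Q `&` U x `&` U y) q by split; [split => //; case: Vx|case: Vy].
  have FW : Filter (within (Q `&` V x `&` V y) (nbhs q)) by exact: within_filter.
  have cf1 : f x y @ within (Q `&` V x `&` V y) (nbhs q) --> f x y q.
    move=> B HB.
    have H : \forall t \near q, (Q `&` U x `&` U y) t -> B (f x y t).
      exact: (cf q Uxy B HB).
    by apply: filterS H => t Ht [[Qt [Ut _]] [Ut' _]]; apply: Ht.
  have [w1 _] := wP x q Qq Vx.
  have Vw : sc_V (cx y) (nv_pt (w x q)) by rewrite w1; exact: VcV.
  have nz : nv_fun (w x q) (eqn (cx y)) != 0 by apply/(nvec_neq0 Vw); exact: wnz.
  have cr : log_scale (r x y t) @[t --> within (Q `&` V x `&` V y) (nbhs q)] -->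
      log_scale (r x y q).
    move=> B HB; have H1 := nv_eqn_continuous Vw (log_scale_continuous nz HB).
    have H : \forall t \near q, (Q `&` V x) t -> B (log_scale (r x y t)).
      exact: (wc x Qx q Qq Vx _ H1).
    by apply: filterS H => t Ht [Ht' _]; exact: Ht.
  exact: (cvgD cf1 cr).
- move=> x y q [Qx Qy [Qq Vx Vy]]; split; last exact: wE.
  have [r0 _] := rP x y q Qx Qq Vx Vy.
  rewrite exp2ipi_scale//= mulf_neq0//.
    by rewrite lt0r_neq0// toC_gt0 invr_gt0.
  have ov : overlap2 Q U x y q by split => //; split => //; [case: Vx|case: Vy].
  by have [+ _] := sE x y q ov; rewrite G => /norm1_neq0.
move=> x y z q [[Qx Qy [Qq Vx Vy]] [_ Qz [_ _ Vz]]].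
have ov : overlap3 Q U x y z q.
  by split; split => //; split => //; [case: Vx|case: Vy|case: Vy|case: Vz].
have [rxy0 rxyE] := rP x y q Qx Qq Vx Vy; have [rxz0 rxzE] := rP x z q Qx Qq Vx Vz.
have [ryz0 ryzE] := rP y z q Qy Qq Vy Vz.
have rM : r x z q = r x y q * r y z q.
  apply: (@toC_inj R); rewrite toCM -ryzE (wE x y q)//.
  rewrite [nv_fun (nv_scale _ _) _](_ : _ = exp2ipi (f x y q + log_scale (r x y q)) *
    nv_fun (w x q) (eqn (cx z)))// exp2ipi_scale// 2!normrM.
  have e1 : `|exp2ipi (f x y q)| = 1.
    by have [+ _] := sE x y q ov.1; rewrite G.
  rewrite e1 mulr1 rxzE norm_toC gtr0_norm ?invr_gt0// toCV mulVKf//.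
  by rewrite lt0r_neq0// toC_gt0.
rewrite (kE x y z q ov) rM log_scaleM//; exact: cocycle_shift.
Qed.

Lemma circle_c1 : (exists q, Q q) -> c1 Q P = c1 Q N.
Proof.
move=> exQ; rewrite /c1; congr xget; apply/seteqP; split=> K.
  exact: circle_normal_c1.
exact: normal_circle_c1.
Qed.

End ChernClass.

(** * The gluing theorem *)

Theorem lemma3p7 (R : realType) (T1 T2 : twistor_blowup R)
    (phi : tb_Y T1 -> tb_Y T2) (hphi : gluing_iso phi)
    (X : manifold (Cx R) 4) (p : X -> Cx R)
    (j1 : tb_Y T1 -> X) (j2 : tb_Y T2 -> X)
    (hX : semistable_family phi p j1 j2) (theta : R) :
  let Q := tb_Q T1 in
  (* the bundles P_{V,theta} glue, canonically *)
  (exists (P : bundle R (tb_Y T1))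
      (psi : forall c : semistable_chart Q, btot (sc_bundle theta c) -> btot P),
    is_gluing psi /\
    (forall (P' : bundle R (tb_Y T1))
        (psi' : forall c : semistable_chart Q,
           btot (sc_bundle theta c) -> btot P'),
      is_gluing psi' ->
      exists F : btot P -> btot P',
        [/\ bundle_iso F,
            forall c x, bset (sc_bundle theta c) x ->
              F (psi c x) = psi' c x &
            forall F' : btot P -> btot P', bundle_iso F' ->
              (forall c x, bset (sc_bundle theta c) x ->
                 F' (psi c x) = psi' c x) ->
              forall y, bset P y -> F' y = F y])) /\
  (* the glued bundle is canonically isomorphic to S(N_{Q/Y_1}) *)
  (forall (P : bundle R (tb_Y T1))
      (psi : forall c : semistable_chart Q, btot (sc_bundle theta c) -> btot P),
    is_gluing psi ->
    [/\ forall h, hermitian_metric Q h ->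
          exists Phi : btot P -> nvec Q,
            canonical_iso psi h Phi /\
            (forall Phi' : btot P -> nvec Q, canonical_iso psi h Phi' ->
               forall y, bset P y -> Phi' y = Phi y),
        forall h0 h1 (Phi0 Phi1 : btot P -> nvec Q),
          hermitian_metric Q h0 -> hermitian_metric Q h1 ->
          canonical_iso psi h0 Phi0 -> canonical_iso psi h1 Phi1 ->
          isotopic h0 h1 Phi0 Phi1 &
        c1 Q P = c1 Q (normal_bundle Q)]).
Proof.
move=> Q; have charts := family_charts hX.
have exQ : exists q, Q q.
  have [psiQ _ _ _] := @tb_quadric R T1.
  have e0 : const_mx 1 != 0 :> 'rV[Cx R]_2.
    by apply/eqP => /rowP/(_ 0)/eqP; rewrite !mxE oner_eq0.
  by exists (tb_Psi T1 (const_mx 1, const_mx 1)); exact: psiQ.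
have [q0 Qq0] := exQ; have [c0 _] := charts q0 Qq0.
have exc : exists c : semistable_chart Q, True by exists c0.
split.
  have [psi [gl _]] := adapted_gluing theta charts (direction_adapted Q)
    ((q0, fun=> 0) : direction Q).
  exists (direction_bundle Q), psi; split => // P' psi' gl'.
  exact: (gluing_map charts exQ gl gl').
move=> P psi gl; split.
- by move=> h; exact: (canonical_exists charts exQ gl).
- by move=> h0 h1 Phi0 Phi1; exact: (canonical_isotopic charts exQ gl).
have [eta [A _]] := gluing_adapted exc gl; have [k0] := kn_inhabited c0.
exact: (circle_c1 charts A (psi c0 k0) exQ).
Qed.
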